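(* Let $1\le p<\infty$ and $0\le s<p$. There is a constant $c_{p,s}>0$ depending only on $p$ and $s$ such that the following holds. Let $M,R>0$, let $P$ be a probability distribution supported on $\mathcal{M}^s_{R,M}$ such that the expected persistence diagram $\mathbf{E}(P)$ has a Lebesgue density $f$ satisfying, for some $C>0$, $$\|f\|_{L^\infty(A_k)}\le C^2MR^{-s}2^{ks}\qquad\text{for all } k\in\mathbb{N}_0 .$$ Let $N\ge 2$, let $\mu_1,\dots,\mu_N$ be i.i.d. random measures with law $P$, and let $\hat\mu_{\mathrm H}$ be the Haar wavelet estimator built from $\mu_1,\dots,\mu_N$ with parameters $J=K=\lceil\log_2(N)\rceil$. Then $$\mathbb{E}\left[\mathrm{OT}_p^p(\hat\mu_{\mathrm H},\mathbf{E}(P))\right]\le c_{p,s}\,M R^{p-s}\left(\frac{R}{N^p}+\frac{C R\,a_p(N)}{\sqrt N}+\frac{1}{N^{p-s}}\right),$$ where $a_p(N)=\log_2(N)$ if $p=1$ and $a_p(N)=1$ otherwise.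
   Context: Spaces. $\mathbb{N}_0=\{0,1,2,\dots\}$. $\Omega=\{(t_1,t_2)\in\mathbb{R}^2: t_1<t_2\}$, $\partial\Omega=\{(t,t):t\in\mathbb{R}\}$, $\bar\Omega=\Omega\cup\partial\Omega$. For $x\in\Omega$, $x^\perp$ is the orthogonal projection of $x$ onto $\partial\Omega$. For $R>0$, $$\Omega_R=\{(t_1,t_2)\in\mathbb{R}^2: |t_1+R/\sqrt8|+|t_2-R/\sqrt8|\le R/\sqrt2\}.$$ For $k\in\mathbb{N}_0$, $A_k=\{x\in\Omega_R: R2^{-(k+1)}<\|x-x^\perp\|_2\le R2^{-k}\}$. Persistence measures. For $s\in[0,\infty)$ and a non-negative Radon measure $\mu$ on $\Omega$, $\mathrm{Pers}_s(\mu)=\int_\Omega\|x-x^\perp\|_q^s\,d\mu(x)$, where $q\in[1,\infty]$ is a fixed norm index. $\mathcal{M}^s$ is the set of non-negative Radon measures on $\Omega$ with $\mathrm{Pers}_s(\mu)<\infty$. For $M,R>0$, $\mathcal{M}^s_{R,M}$ is the set of $\mu\in\mathcal{M}^s$ that are supported on $\Omega_R$ and satisfy $\mathrm{Pers}_s(\mu)\le M$. Optimal partial transport. For measures $\mu,\nu$ on $\Omega$ and $1\le p<\infty$, $$\mathrm{OT}_p(\mu,\nu)=\inf_{\gamma\in\mathrm{Adm}(\mu,\nu)}\left(\int_{\bar\Omega\times\bar\Omega}\|x-y\|_p^p\,d\gamma(x,y)\right)^{1/p},$$ where $\mathrm{Adm}(\mu,\nu)$ is the set of Radon measures $\gamma$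 on $\bar\Omega\times\bar\Omega$ with $\gamma(A\times\bar\Omega)=\mu(A)$ and $\gamma(\bar\Omega\times B)=\nu(B)$ for all Borel sets $A,B\subset\Omega$. $\mathrm{OT}_p^p$ denotes its $p$-th power. Expected persistence diagram. If $\mu$ is a random measure with law $P$, $\mathbf{E}(P)$ is the deterministic measure $\mathbf{E}(P)(A)=\mathbb{E}[\mu(A)]$ for Borel $A\subset\Omega$. Adapted Haar system. Put $u(t_1,t_2)=\frac{t_1+t_2}{\sqrt2R}+\frac12$ and $v(t_1,t_2)=\frac{t_2-t_1}{\sqrt2R}$ (so that $\Omega_R=\{(u,v)\in[0,1]^2\}$). Let $\chi_B$ denote the characteristic function of $B$ and $h=\chi_{[0,1/2)}-\chi_{[1/2,1)}$. On $\mathbb{R}^2$ define $\tilde\varphi(a,b)=\chi_{[0,1]}(a)\chi_{[0,1]}(b)$, $\tilde\psi^{\mathrm a}(a,b)=h(a)\chi_{[0,1]}(b)$, $\tilde\psi^{\mathrm b}(a,b)=\chi_{[0,1]}(a)h(b)$, $\tilde\psi^{\mathrm c}(a,b)=h(a)h(b)$. For $j\in\mathbb{N}_0$ and $\ell=(m,n)\in\mathbb{Z}^2$ let $$\varphi_{j,\ell}(t)=R^{-1}2^j\tilde\varphi(2^ju(t)+m,\,2^jv(t)+n),\qquad \psi^\alpha_{j,\ell}(t)=R^{-1}2^j\tilde\psi^\alpha(2^ju(t)+m,\,2^jv(t)+n),\quad \alpha\in\{\mathrm a,\mathrm b,\mathrm c\},$$ and $\mathcal{V}_j=\{\varphi_{j,\ell}:\ell\in\mathbb{Z}^2\}$,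 $\mathcal{W}_j=\{\psi^\alpha_{j,\ell}:\ell\in\mathbb{Z}^2,\ \alpha\in\{\mathrm a,\mathrm b,\mathrm c\}\}$. Haar wavelet estimator. Given $\mu_1,\dots,\mu_N$ and parameters $K\in\mathbb{N}_0$ and an integer $J\ge1$, set $$\hat\alpha_\phi=\frac1N\sum_{i=1}^N\int_{\Omega_R}\phi\,d\mu_i,\qquad \hat\beta_\psi=\frac1N\sum_{i=1}^N\int_{\Omega_R}\psi\,d\mu_i .$$ Define $\hat f$ on $\Omega_R$ by $$\hat f|_{A_k}=\sum_{\phi\in\mathcal{V}_{k+1}}\hat\alpha_\phi\,\phi+\sum_{j=k+1}^{J+K}\sum_{\psi\in\mathcal{W}_j}\hat\beta_\psi\,\psi\quad (0\le k\le K),\qquad \hat f|_{A_k}=0\quad(k\ge K+1),$$ all functions on the right being restricted to $A_k$. $\hat\mu_{\mathrm H}$ is the measure with Lebesgue density $\hat f$ (and $\hat f=0$ outside $\Omega_R$).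
   Formalization: Adm(μ,ν) is read as measures on Ω̄×Ω̄ finite on compact subsets of (Ω̄×Ω̄)\(∂Ω×∂Ω), not of all Ω̄×Ω̄: otherwise, for 1≤s<p, an E(P) with infinite mass near ∂Ω has OT_p=+∞ and the bound fails; for E(P) of finite mass both readings agree. *)

(* Defs.v *)
From HB Require Import structures.
From mathcomp Require Import all_boot all_order all_algebra.
From mathcomp Require Import all_classical all_reals all_analysis.
From mathcomp Require Import measurable_realfun ess_sup_inf.

Set Implicit Arguments.
Unset Strict Implicit.
Unset Printing Implicit Defensive.
Import Order.TTheory GRing.Theory Num.Theory.
Import numFieldNormedType.Exports.

Local Open Scope classical_set_scope.
Local Open Scope ring_scope.

(* R * R, with the Borel structure that lebesgue_measure is defined on. *)
Notation plane R := (measurableTypeR R * measurableTypeR R)%type.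

Definition log2 (R : realType) (x : R) : R := ln x / ln 2.

Section Plane.
Context {R : realType}.
Implicit Types (t x : R * R) (r : R).

Definition Omega : set (R * R) := [set t | t.1 < t.2].
Definition bdOmega : set (R * R) := [set t | t.1 = t.2].
Definition clOmega : set (R * R) := Omega `|` bdOmega.

Definition OmegaR r : set (R * R) :=
  [set t | `|t.1 + r / Num.sqrt 8| + `|t.2 - r / Num.sqrt 8|
           <= r / Num.sqrt 2].

Definition perp x : R * R := ((x.1 + x.2) / 2, (x.1 + x.2) / 2).

(* The l^q norm on the plane for q in [1, +oo]. *)
Definition lnorm (q : \bar R) x : R :=
  match q with
  | q'%:E => (`|x.1| `^ q' + `|x.2| `^ q') `^ q'^-1
  | _ => Num.max `|x.1| `|x.2|
  end.

Definition strip r (k : nat) : set (R * R) :=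
  [set x | OmegaR r x /\
           r / 2 ^+ k.+1 < lnorm 2%:E (x - perp x) <= r / 2 ^+ k].

Definition lebesgue2 : {measure set (plane R) -> \bar R} :=
  (lebesgue_measure \x lebesgue_measure)%E.

(* A Radon measure on a Borel subset S of T is represented by its extension by
   zero to T. In the Polish spaces used here, a Borel measure which is finite
   on compact sets is automatically regular. *)
Definition finite_on_compacts (T : topologicalType) (S : set T)
    (mu : set T -> \bar R) : Prop :=
  forall K, compact K -> K `<=` S -> (mu K < +oo)%E.

Definition concentrated_on (T : Type) (S : set T) (mu : set T -> \bar R) :
  Prop := mu (~` S) = 0%E.

Definition Pers (q : \bar R) (s : R) (mu : {measure set (plane R) -> \bar R}) :
  \bar R := (\int[mu]_(x in Omega) ((lnorm q (x - perp x)) `^ s)%:E)%E.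

Definition M_s (q : \bar R) (s : R) : set {measure set (plane R) -> \bar R} :=
  [set mu : {measure set (plane R) -> \bar R} |
     [/\ concentrated_on Omega mu, finite_on_compacts Omega mu &
               (Pers q s mu < +oo)%E]].

Definition M_sRM (q : \bar R) (s r M : R) :
    set {measure set (plane R) -> \bar R} :=
  [set mu : {measure set (plane R) -> \bar R} |
     [/\ M_s q s mu, concentrated_on (OmegaR r) mu &
               (Pers q s mu <= M%:E)%E]].

(* Plans live on clOmega x clOmega. Their local finiteness is only required
   away from bdOmega x bdOmega: a measure of finite persistence may have
   infinite mass near the diagonal, in which case no plan of finite cost is
   finite on the compact subsets of clOmega x clOmega which meet
   bdOmega x bdOmega. *)
Definition Adm (mu nu : set (R * R) -> \bar R) :
    set {measure set (plane R * plane R) -> \bar R} :=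
  [set gam : {measure set (plane R * plane R) -> \bar R} |
     [/\ concentrated_on (clOmega `*` clOmega) gam,
     finite_on_compacts ((clOmega `*` clOmega) `\` (bdOmega `*` bdOmega)) gam,
     (forall A : set (plane R), measurable A -> A `<=` Omega ->
        gam (A `*` clOmega) = mu A) &
     (forall B : set (plane R), measurable B -> B `<=` Omega ->
        gam (clOmega `*` B) = nu B)]].

(* The arguments are bare set functions; Adm mu nu is empty, and OT p mu nu is
   +oo, when mu or nu is not nonnegative on the Borel subsets of Omega. *)
Definition OT (p : R) (mu nu : set (R * R) -> \bar R) : \bar R :=
  ereal_inf [set ((\int[gam]_(z in clOmega `*` clOmega)
                     ((lnorm p%:E (z.1 - z.2)) `^ p)%:E) `^ p^-1)%E
            | gam in Adm mu nu].

Definition is_lebesgue_density (mu : set (R * R) -> \bar R) (f : R * R -> R) :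
  Prop :=
  measurable_fun (Omega : set (plane R)) f /\
  forall A : set (plane R), measurable A -> A `<=` Omega ->
    mu A = (\int[lebesgue2]_(x in A) (f x)%:E)%E.

Definition Linfty_norm (A : set (R * R)) (f : R * R -> R) : \bar R :=
  Lnorm lebesgue2 +oo%E (EFin \o (f \_ A)).

End Plane.

Section Haar.
Context {R : realType}.
Implicit Types (r : R) (t : R * R) (w : R -> R -> R).

Definition ucoord r t : R := (t.1 + t.2) / (Num.sqrt 2 * r) + 1 / 2.
Definition vcoord r t : R := (t.2 - t.1) / (Num.sqrt 2 * r).

Definition chi01 : R -> R := \1_(`[0, 1]%classic).
Definition haar : R -> R :=
  fun a => \1_(`[0, 1 / 2[%classic) a - \1_(`[1 / 2, 1[%classic) a.

Definition phi_mother (a b : R) : R := chi01 a * chi01 b.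
Definition psi_mothers : seq (R -> R -> R) :=
  [:: fun a b => haar a * chi01 b;
      fun a b => chi01 a * haar b;
      fun a b => haar a * haar b].

Definition dilate r w (j : nat) (l : int * int) t : R :=
  r^-1 * 2 ^+ j * w (2 ^+ j * ucoord r t + l.1%:~R)
                    (2 ^+ j * vcoord r t + l.2%:~R).

Section Estimator.
Variables (r : R) (N : nat) (mu : 'I_N -> {measure set (plane R) -> \bar R}).

Definition emp_coef (g : R * R -> R) : R :=
  N%:R^-1 * \sum_(i < N) \int[mu i]_(x in OmegaR r) g x.

(* For each t only finitely many terms are nonzero, as the finitely supported
   sum requires. A function whose support meets the diagonal may fail to be
   integrable, and its coefficient is then a junk value of Rintegral; in f_hat
   such functions are only evaluated at points where they vanish. *)
Definition haar_layer w (j : nat) t : R :=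
  \sum_(l \in [set: int * int]) emp_coef (dilate r w j l) * dilate r w j l t.

Definition f_hat (J K : nat) t : R :=
  \sum_(k < K.+1) \1_(strip r k) t *
    (haar_layer phi_mother k.+1 t +
     \sum_(k.+1 <= j < (J + K).+1) \sum_(w <- psi_mothers) haar_layer w j t).

Definition mu_hat (J K : nat) : set (R * R) -> \bar R :=
  fun A => (\int[lebesgue2]_(x in A) (f_hat J K x)%:E)%E.

End Estimator.
End Haar.

Section MeasureSpace.
Variable R : realType.

Definition meas : Type := {measure set (plane R) -> \bar R}.

HB.instance Definition _ := gen_eqMixin meas.
HB.instance Definition _ := gen_choiceMixin meas.
HB.instance Definition _ := isPointed.Build meas (mzero : meas).

(* The sigma-algebra generated by the evaluations mu |-> mu A, A Borel. *)
Definition meas_evals : set (set meas) :=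
  \bigcup_(A in @measurable _ (plane R))
    preimage_set_system [set: meas] (fun mu : meas => mu A)
      (measurable : set (set (\bar R))).

Definition measT := g_sigma_algebraType meas_evals.

End MeasureSpace.

Definition EPD (R : realType) (P : probability (measT R) R) :
    set (R * R) -> \bar R :=
  fun A => (\int[P]_m (m : meas R) A)%E.

Definition iid_with_law (R : realType) (d d' : measure_display)
    (T : measurableType d) (Y : measurableType d') (Pr : probability T R)
    (P : probability Y R) (N : nat) (X : 'I_N -> T -> Y) : Prop :=
  [/\ (forall i, measurable_fun setT (X i)),
      (forall i B, measurable B -> Pr (X i @^-1` B) = P B) &
      (forall (I : {set 'I_N}) (B : 'I_N -> set Y),
         (forall i, measurable (B i)) ->
         Pr (\bigcap_(i in [set` I]) (X i @^-1` B i)) =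
         (\prod_(i in I) Pr (X i @^-1` B i))%E)].

(* Main.v *)
(* On the strip A_k, almost surely, the Haar estimator has constant density on
   each dyadic leaf cell of side 2^-(J+K+1) (in the coordinates u, v), and gives
   it the average of the masses mu_i of the leaf: each partial Haar expansion is
   an orthogonal projection on step functions. The masses of the leaves of A_k
   are transported greedily up the dyadic tree: what can be matched inside a
   leaf is matched there, what remains is matched in the parent block, and so
   on; the residue at the top is sent to the diagonal, which is at a distance
   comparable to the side of the top blocks. The cost is a sum over the levels
   of (block side)^p times the sum over the blocks of |estimated mass - expected
   mass|. By independence the mean square of such a difference is at most
   B_k E(P)(block) / N, where B_k ~ M R^-s 2^(ks) bounds the mass that a measure
   of persistence at most M gives to A_k; the Cauchy-Schwarz inequality over the
   blocks and the density bound then give 2^(ks) 2^j / 2^k / sqrt N at level j.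
   The sum over j is geometric unless p = 1, the sum over k is geometric because
   s < p. The measure E(P) below level K is projected onto the diagonal. *)

Require Import Defs.
From HB Require Import structures.
From mathcomp Require Import all_boot all_order all_algebra.
From mathcomp Require Import all_classical all_reals all_analysis.
From mathcomp Require Import measurable_realfun ess_sup_inf.
From mathcomp Require Import ring lra zify.

Set Implicit Arguments.
Unset Strict Implicit.
Unset Printing Implicit Defensive.
Import Order.TTheory GRing.Theory Num.Theory.
Import numFieldNormedType.Exports.

Local Open Scope classical_set_scope.
Local Open Scope ring_scope.

(** * Greedy transport along a tree *)

(** [OT] is an infimum with no evident measurable dependence on the sample. Everything is therefore
    phrased through [has_plan], an explicit plan whose p-th power cost adds up under superposition.
    This avoids triangle inequalities between strips and yields, for almost every sample, a majorant
    affine in finitely many measurable deviations. Integrals of nonnegative functions are monotone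
    without measurability, so only the majorant has to be measurable. Grid lines are the second
    difficulty: [chi01] is closed at both ends, so neighbouring Haar functions overlap there. Since
    [EPD P] has a density, the grid is null for it, hence for almost every sample, and all Haar
    identities are proved off the grid. The work is done strip by strip because a sample may have
    infinite mass near the diagonal. With J = K the leaf side is 2^-(2K+1): the cost inside leaves
    then outweighs the number K+1 of strips and still decays like 2^(-(p-s)K), as the tail does. *)

Section GreedyTransport.
Context {R : realFieldType} {I : finType}.
Implicit Types (a b x y : I -> R) (G c : I -> I -> R).

Definition class_sum (T : finType) (h : I -> T) (x : I -> R) (t : T) : R :=
  \sum_(i | h i == t) x i.

Definition discrepancy (T : finType) (h : I -> T) a b : R :=
  \sum_t `|class_sum h a t - class_sum h b t|.

Lemma sum_class_sum (T : finType) (h : I -> T) x :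
  \sum_t class_sum h x t = \sum_i x i.
Proof. by rewrite [RHS](partition_big h predT). Qed.

Lemma class_sum_coarsen (T U : finType) (h : I -> T) (h' : I -> U)
    (par : T -> U) x u : (forall i, h' i = par (h i)) ->
  class_sum h' x u = \sum_(t | par t == u) class_sum h x t.
Proof.
move=> hE; rewrite /class_sum (partition_big h (fun t => par t == u)) /=.
  apply: eq_bigr => t /eqP <-; apply: eq_bigl => i.
  by rewrite hE; case: (eqVneq (h i) t) => [->|]; rewrite ?eqxx ?andbF.
by move=> i; rewrite hE.
Qed.

(** [G] is the matched mass; [x] and [y] are the rests of source and target, still to be matched at
    a coarser level or sent to the diagonal. *)
Definition partial_plan a b G x y :=
  [/\ forall i j, 0 <= G i j, forall i, 0 <= x i, forall j, 0 <= y j,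
      forall i, a i = \sum_j G i j + x i &
      forall j, b j = \sum_i G i j + y j].

(* In every class t the amount min (S_a, S_b) is matched proportionally;
   x i * y j / max (S_a, S_b) does so, also when both sums vanish. *)
Lemma greedy_step (T : finType) (h : I -> T) x y :
    (forall i, 0 <= x i) -> (forall i, 0 <= y i) ->
  exists G x' y', [/\ partial_plan x y G x' y',
    forall i j, G i j != 0 -> h i = h j,
    forall t, class_sum h x' t
              = Num.max (class_sum h x t - class_sum h y t) 0 &
    forall t, class_sum h y' t
              = Num.max (class_sum h y t - class_sum h x t) 0].
Proof.
move=> x0 y0; pose X := class_sum h x; pose Y := class_sum h y.
have X0 t : 0 <= X t by apply: sumr_ge0.
have Y0 t : 0 <= Y t by apply: sumr_ge0.
pose m t := Num.max (X t) (Y t).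
have Xm t : X t <= m t by rewrite le_max lexx.
have Ym t : Y t <= m t by rewrite le_max lexx orbT.
have m0 t : 0 <= m t by apply: le_trans (Xm t).
have mV (A : I -> R) t : (class_sum h A t <= m t) -> 0 <= class_sum h A t ->
    m t * (class_sum h A t / m t) = class_sum h A t.
  move=> Am A0; have [mt0|mt0] := eqVneq (m t) 0; last by rewrite mulrC divfK.
  by apply/eqP; rewrite mt0 mul0r eq_sym eq_le A0 -mt0 Am.
have frac (u v : R) : 0 <= u -> u <= v -> 0 <= 1 - u / v.
  move=> u0 uv; rewrite subr_ge0; have [->|v0] := eqVneq v 0.
    by rewrite invr0 mulr0.
  by rewrite ler_pdivrMr ?mul1r // lt_def v0 (le_trans u0).
exists (fun i j => if h i == h j then x i * y j / m (h i) else 0).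
exists (fun i => x i * (1 - Y (h i) / m (h i))).
exists (fun j => y j * (1 - X (h j) / m (h j))).
split.
- split.
  + by move=> i j; case: ifP => // _; rewrite divr_ge0 ?mulr_ge0.
  + by move=> i; rewrite mulr_ge0 ?frac.
  + by move=> i; rewrite mulr_ge0 ?frac.
  + move=> i; rewrite -big_mkcond /= -mulr_suml -mulr_sumr -/(class_sum _ _ _).
    have -> : \sum_(j | h i == h j) y j = Y (h i).
      by apply: eq_bigl => j; rewrite eq_sym.
    by ring.
  + move=> j; rewrite -big_mkcond /=.
    have -> : \sum_(i | h i == h j) x i * y j / m (h i)
              = X (h j) * (y j / m (h j)).
      rewrite /X /class_sum mulr_suml; apply: eq_bigr => i /eqP ->.
      by rewrite mulrA.
    by ring.
- by move=> i j; case: (eqVneq (h i) (h j)) => // _; rewrite eqxx.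
- move=> t; have -> : class_sum h (fun i => x i * (1 - Y (h i) / m (h i))) t
     = X t * (1 - Y t / m t).
    by rewrite /X /class_sum mulr_suml; apply: eq_bigr => i /eqP ->.
  rewrite -/(X t) -/(Y t) mulrBr mulr1 /m.
  have [XY|YX] := leP (X t) (Y t).
    (* When [Y t = 0] the quotient is 0 by convention, but then [X t = 0] as well. *)
    rewrite (_ : X t * (Y t / Y t) = X t) ?subrr; last first.
      have [Yt0|Yt0] := eqVneq (Y t) 0; last by rewrite divff ?mulr1.
      by apply/eqP; rewrite Yt0 mul0r mulr0 eq_sym eq_le X0 -Yt0 XY.
    by rewrite max_r // subr_le0.
  rewrite mulrCA divff ?mulr1 ?gt_eqF ?(le_lt_trans (Y0 t)) //.
  by rewrite max_l // subr_ge0 ltW.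
- move=> t; have -> : class_sum h (fun i => y i * (1 - X (h i) / m (h i))) t
     = Y t * (1 - X t / m t).
    by rewrite /Y /class_sum mulr_suml; apply: eq_bigr => i /eqP ->.
  rewrite -/(X t) -/(Y t) mulrBr mulr1 /m.
  have [XY|YX] := leP (X t) (Y t).
    rewrite max_l ?subr_ge0 //; have [Yt0|Yt0] := eqVneq (Y t) 0.
      have -> : X t = 0 by apply/eqP; rewrite eq_le X0 -Yt0 XY.
      by rewrite !mul0r mulr0.
    by rewrite mulrCA divff ?mulr1.
  rewrite divff ?gt_eqF ?(le_lt_trans (Y0 t)) // mulr1 subrr max_r //.
  by rewrite subr_le0 ltW.
Qed.

(** Mass matched at level m + 1 is taken from the residue of level m, whose total is at most the
    discrepancy at level m; hence the shift between [D m.+1] and [h m]. At level 0 the matched mass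
    is bounded by the whole target mass. *)
Theorem greedy_transport (T : nat -> finType) (h : forall n, I -> T n)
    (par : forall n, T n -> T n.+1) (D : nat -> R) a b c n :
    (forall m i, h m.+1 i = par m (h m i)) ->
    (forall m i j, (m <= n)%N -> h m i = h m j -> c i j <= D m) ->
    (forall m, 0 <= D m) ->
    (forall i, 0 <= a i) -> (forall i, 0 <= b i) ->
  exists G x y, [/\ partial_plan a b G x y,
    \sum_i \sum_j G i j * c i j <= D 0%N * (\sum_i b i)
      + \sum_(m < n) D m.+1 * discrepancy (h m) a b,
    \sum_i x i <= discrepancy (h n) a b &
    \sum_i y i <= discrepancy (h n) a b].
Proof.
move=> hE cD D0 a0 b0.
(* The induction needs the residues exactly, class by class: in each class only the excess of the
   larger side is left. *)
suff: exists G x y, [/\ partial_plan a b G x y,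
    \sum_i \sum_j G i j * c i j <= D 0%N * (\sum_i b i)
      + \sum_(m < n) D m.+1 * discrepancy (h m) a b,
    forall t, class_sum (h n) x t
      = Num.max (class_sum (h n) a t - class_sum (h n) b t) 0 &
    forall t, class_sum (h n) y t
      = Num.max (class_sum (h n) b t - class_sum (h n) a t) 0].
  move=> [G [x [y [pl cost xE yE]]]]; exists G, x, y; split => //.
    rewrite -(sum_class_sum (h n)); apply: ler_sum => t _.
    by rewrite xE ge_max ler_norm normr_ge0.
  rewrite -(sum_class_sum (h n)); apply: ler_sum => t _.
  by rewrite yE ge_max distrC ler_norm normr_ge0.
have addcost m (G : I -> I -> R) : (m <= n)%N -> (forall i j, 0 <= G i j) ->
    (forall i j, G i j != 0 -> h m i = h m j) ->
    \sum_i \sum_j G i j * c i j <= D m * \sum_i \sum_j G i j.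
  move=> mn G0 Gh; rewrite mulr_sumr; apply: ler_sum => i _.
  rewrite mulr_sumr; apply: ler_sum => j _; rewrite mulrC.
  have [->|Gij] := eqVneq (G i j) 0; first by rewrite !mulr0.
  by rewrite ler_wpM2r //; apply: cD => //; exact: Gh.
elim: n cD addcost => [|n IH] cD addcost.
  have [G [x [y [pl Gh xE yE]]]] := greedy_step (h 0%N) a0 b0.
  exists G, x, y; split => //; rewrite big_ord0 addr0.
  case: pl => G0 x0 y0 aE bE; apply: le_trans (addcost 0%N _ _ _ _) _ => //.
  rewrite ler_wpM2l // exchange_big /=; apply: ler_sum => j _.
  by rewrite [leRHS]bE lerDl.
have [||G [x [y [[G0 x0 y0 aE bE] cost xE yE]]]] := IH.
- by move=> m i j /leqW; apply: cD.
- by move=> m G /leqW; apply: addcost.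
have [G' [x' [y' [[G'0 x'0 y'0 xE' yE'] Gh xE2 yE2]]]] :=
  greedy_step (h n.+1) x0 y0.
(* Matching removes equal amounts from both sides, so in a coarser class the residues have the same
   signed imbalance as [a] and [b]. *)
have diff t : class_sum (h n.+1) x t - class_sum (h n.+1) y t =
    class_sum (h n.+1) a t - class_sum (h n.+1) b t.
  rewrite !(class_sum_coarsen _ _ (hE n)) -!sumrB; apply: eq_bigr => u _.
  rewrite xE yE; case: (leP (class_sum (h n) a u - class_sum (h n) b u) 0);
  by case: (leP (class_sum (h n) b u - class_sum (h n) a u) 0); lra.
exists (fun i j => G i j + G' i j), x', y'; split.
- split => // [i j|i|j]; first by rewrite addr_ge0.
    by rewrite big_split /= -addrA -xE'.
  by rewrite big_split /= -addrA -yE'.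
- rewrite big_ord_recr /= addrA.
  under eq_bigr do under eq_bigr do rewrite mulrDl.
  under eq_bigr do rewrite big_split /=.
  rewrite big_split lerD //=; apply: le_trans (addcost n.+1 _ _ _ _) _ => //.
  rewrite ler_wpM2l //; apply: (@le_trans _ _ (\sum_i x i)).
    by apply: ler_sum => i _; rewrite [leRHS]xE' lerDl.
  rewrite -(sum_class_sum (h n)); apply: ler_sum => t _.
  by rewrite xE ge_max ler_norm normr_ge0.
- by move=> t; rewrite xE2 diff.
- move=> t; rewrite yE2; congr Num.max.
  by rewrite -[LHS]opprB diff opprB.
Qed.

End GreedyTransport.

(** * Empirical means *)

Section IidVariance.
Context {R : realType}.

Lemma bounded_integrable d (T : measurableType d)
    (mu : {measure set T -> \bar R}) (f : T -> R) (c : R) :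
  (mu setT < +oo)%E -> measurable_fun setT f -> (forall x, `|f x| <= c) ->
  mu.-integrable setT (EFin \o f).
Proof.
move=> muoo mf fc; apply: measurable_bounded_integrable => //.
exists c; split; first by rewrite num_real.
by move=> M cM x _ /=; rewrite (le_trans (fc x)) ?ltW.
Qed.

Let P_lty d (T : measurableType d) (P : probability T R) : (P setT < +oo)%E.
Proof. by rewrite probability_setT ltry. Qed.

Lemma Rintegral_sum d (T : measurableType d) (mu : {measure set T -> \bar R})
    (I : Type) (s : seq I) (F : I -> T -> R) :
  (forall i, mu.-integrable setT (EFin \o F i)) ->
  \int[mu]_x (\sum_(i <- s) F i x) = \sum_(i <- s) \int[mu]_x F i x.
Proof.
move=> iF; rewrite /Rintegral.
under eq_integral do rewrite -sumEFin.
rewrite integral_sum// -sum_fine// => i _.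
exact: (integrable_fin_num measurableT (iF i)).
Qed.

(** The rectangle hypothesis identifies the law of [(U, V)] with [P \x P] by uniqueness of product
    measures, and Fubini splits the integral. Boundedness of [g] keeps every integral finite, so
    [fine] loses nothing. *)
Lemma Rintegral_indep_pair d d' (T : measurableType d) (Y : measurableType d')
    (Pr : probability T R) (P : probability Y R) (U V : T -> Y)
    (g : Y -> R) (c : R) :
    measurable_fun setT U -> measurable_fun setT V ->
    (forall A B, measurable A -> measurable B ->
       Pr (U @^-1` A `&` V @^-1` B) = (P A * P B)%E) ->
    measurable_fun setT g -> (forall y, `|g y| <= c) ->
  \int[Pr]_w (g (U w) * g (V w)) = (\int[P]_y g y) ^+ 2.
Proof.
move=> mU mV indep mg gc.
have c0 : 0 <= c by apply: le_trans (gc point).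
pose W w := (U w, V w).
have mW : measurable_fun setT W by exact/measurable_fun_pairP.
pose G (z : Y * Y) := g z.1 * g z.2.
have mG : measurable_fun setT G.
  by apply: measurable_funM; apply: measurableT_comp.
have Gc z : `|G z| <= c * c by rewrite normrM ler_pM.
have WE A : measurable A -> pushforward Pr W A = (P \x P)%E A.
  move=> mA; apply/esym; exact: product_measure_unique.
have iG : (P \x P)%E.-integrable setT (EFin \o G).
  apply: bounded_integrable mG Gc.
  by have /= <- := WE _ measurableT; rewrite /pushforward preimage_setT P_lty.
have iGW : Pr.-integrable setT (EFin \o (G \o W)).
  by apply: (bounded_integrable (P_lty Pr) (measurableT_comp mG mW)) => w; exact: Gc.
have ig : P.-integrable setT (EFin \o g) by exact: bounded_integrable (P_lty P) mg gc.
rewrite /Rintegral.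
transitivity (fine (\int[(P \x P)%E]_z (G z)%:E)%E).
  congr fine; transitivity (\int[pushforward Pr W]_z (G z)%:E)%E.
    by rewrite integral_pushforward//; exact: measurableT_comp.
  by apply: eq_measure_integral => A mA _; exact: WE.
rewrite -integral12_prod_meas1// /fubini_F /=.
set th := (\int[P]_y (g y)%:E)%E.
have thE : th = (fine th)%:E.
  by rewrite fineK//; exact: (integrable_fin_num measurableT ig).
transitivity (fine (\int[P]_x ((fine th)%:E * (g x)%:E))%E); last first.
  by rewrite integralZl// -/th thE -EFinM.
congr fine; apply: eq_integral => x _.
transitivity (\int[P]_y ((g x)%:E * (g y)%:E))%E => //.
by rewrite integralZl// -/th -thE muleC.
Qed.

Lemma iid_pair d d' (T : measurableType d) (Y : measurableType d')
    (Pr : probability T R) (P : probability Y R) N (X : 'I_N -> T -> Y) i j :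
    iid_with_law Pr P X -> i != j ->
  forall A B, measurable A -> measurable B ->
    Pr (X i @^-1` A `&` X j @^-1` B) = (P A * P B)%E.
Proof.
move=> [mX lawX indX] ij A B mA mB.
(* Only the values at [i] and [j] matter: joint independence is applied to the index set {i, j}. *)
pose C k := if k == i then A else B.
have mC k : measurable (C k) by rewrite /C; case: ifP.
have ijs : i \notin [set j]%SET by rewrite finset.in_set1.
have := indX (i |: [set j])%SET C mC.
rewrite big_setU1//= big_set1 !lawX// /C eqxx eq_sym (negbTE ij) => <-.
congr (Pr _); apply/seteqP; split=> [w [Aw Bw] k /=|w wC].
  by rewrite !finset.inE => /orP[] /eqP ->; rewrite ?eqxx// eq_sym (negbTE ij).
split.
  by have := wC i; rewrite /= eqxx; apply; rewrite !finset.inE eqxx.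
have := wC j; rewrite /= eq_sym (negbTE ij); apply.
by rewrite !finset.inE eqxx orbT.
Qed.

(** Centring kills the off-diagonal products by independence, leaving the variance divided by N; and
    [0 <= h <= b] gives [h^2 <= b h], so the variance is at most [b] times the mean. Keeping the
    mean instead of a second factor [b] is what makes the bound summable over blocks. *)
Lemma iid_mean_square_bound d d' (T : measurableType d)
    (Y : measurableType d') (Pr : probability T R) (P : probability Y R) N
    (X : 'I_N -> T -> Y) (h : Y -> R) (b : R) :
    (0 < N)%N -> iid_with_law Pr P X ->
    measurable_fun setT h -> (forall y, 0 <= h y <= b) ->
  (\int[Pr]_w (((N%:R^-1 * \sum_(i < N) h (X i w) - \int[P]_y h y) ^+ 2)%:E)
   <= (b * (\int[P]_y h y) / N%:R)%:E)%E.
Proof.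
move=> N0 iidX mh hb; have [mX lawX _] := iidX.
have h0 y : 0 <= h y by have /andP[] := hb y.
have hB y : h y <= b by have /andP[] := hb y.
set th := \int[P]_y h y.
have hB' y : `|h y| <= b by rewrite ger0_norm.
have ih := bounded_integrable (P_lty P) mh hB'.
have th0 : 0 <= th by apply: Rintegral_ge0.
pose g y := h y - th.
have mg : measurable_fun setT g by apply: measurable_funB.
have gc y : `|g y| <= b + th.
  by rewrite (le_trans (ler_normB _ _))// lerD// ger0_norm.
have c0 : 0 <= b + th by apply: le_trans (gc point).
have intc (k : R) : \int[P]__ k = k.
  by rewrite Rintegral_cst//= (probability_setT P) mulr1.
have g0 : \int[P]_y g y = 0.
  rewrite RintegralB//; last exact: finite_measure_integrable_cst.
  by rewrite intc subrr.
have mgX i : measurable_fun setT (g \o X i) by exact: measurableT_comp.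
have igg i j : Pr.-integrable setT (EFin \o (fun w => g (X i w) * g (X j w))).
  apply: (@bounded_integrable _ _ _ _ ((b + th) ^+ 2) (P_lty Pr)) => [|w].
    exact: (measurable_funM (mgX i) (mgX j)).
  by rewrite normrM expr2 ler_pM.
have E_offdiag i j : i != j -> \int[Pr]_w (g (X i w) * g (X j w)) = 0.
  move=> ij; rewrite (@Rintegral_indep_pair _ _ _ _ Pr P _ _ g (b + th))//.
    by rewrite g0 expr0n.
  exact: iid_pair iidX ij.
have E_diag i : \int[Pr]_w (g (X i w) * g (X i w)) <= b * th.
  pose G y := g y * g y.
  have mG : measurable_fun setT G by exact: measurable_funM.
  have GE w : g (X i w) * g (X i w) = (G \o X i) w by [].
  have -> : \int[Pr]_w (g (X i w) * g (X i w)) = \int[P]_y G y.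
    rewrite /Rintegral; congr fine.
    transitivity (\int[pushforward Pr (X i)]_y (G y)%:E)%E.
      by rewrite integral_pushforward//; [exact/measurable_EFinP|exact: igg].
    by apply: eq_measure_integral => A mA _; exact: lawX.
  have iG : P.-integrable setT (EFin \o G).
    apply: (@bounded_integrable _ _ _ _ ((b + th) ^+ 2) (P_lty P)) => // y.
    by rewrite normrM expr2 ler_pM.
  have ibh k : P.-integrable setT (EFin \o (fun y => k * h y)).
    by apply: (integrableZl measurableT k ih).
  have icst k : P.-integrable [set: Y] (EFin \o (fun=> k : R)).
    exact: finite_measure_integrable_cst.
  (* The gap between the two integrands is [(b - h y) * h y], and the larger one integrates to
     [b * th - th^2]. *)
  apply: (@le_trans _ _ (\int[P]_y ((b - 2 * th) * h y + th ^+ 2))).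
    apply: le_Rintegral => //.
      exact: (integrableD measurableT (ibh _) (icst _)).
    move=> y _; rewrite /G /g -subr_ge0.
    have -> : (b - 2 * th) * h y + th ^+ 2 - (h y - th) * (h y - th)
      = (b - h y) * h y by ring.
    by rewrite mulr_ge0// subr_ge0.
  rewrite (RintegralD measurableT (ibh _) (icst _)).
  rewrite RintegralZl// intc -/th.
  by rewrite -subr_ge0 (_ : _ - _ = th ^+ 2) ?sqr_ge0//; ring.
pose Z w := N%:R^-1 * \sum_(i < N) h (X i w) - th.
have ZE w : Z w ^+ 2 = \sum_(i < N) \sum_(j < N)
    (N%:R^-1 ^+ 2 * (g (X i w) * g (X j w))).
  have -> : Z w = N%:R^-1 * \sum_(i < N) g (X i w).
    rewrite /Z /g sumrB sumr_const card_ord mulrBr -[th *+ N]mulr_natr.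
    by rewrite (mulrCA _ th) mulVf ?mulr1// pnatr_eq0 -lt0n.
  rewrite exprMn; set q := N%:R^-1 ^+ 2; rewrite expr2 mulr_suml mulr_sumr; apply: eq_bigr => i _.
  by rewrite mulr_sumr mulr_sumr.
have iggN i j : Pr.-integrable setT
    (EFin \o (fun w => N%:R^-1 ^+ 2 * (g (X i w) * g (X j w)))).
  by apply: (integrableZl measurableT _ (igg i j)).
have iggs i : Pr.-integrable setT (EFin \o (fun w => \sum_(j < N)
    (N%:R^-1 ^+ 2 * (g (X i w) * g (X j w))))).
  rewrite (_ : EFin \o _ = fun w => \sum_(j < N)
      (N%:R^-1 ^+ 2 * (g (X i w) * g (X j w)))%:E)%E.
    by apply: integrable_sum => // j _; exact: iggN.
  by apply/funext => w; rewrite /= sumEFin.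
have iZ : Pr.-integrable setT (EFin \o (fun w => Z w ^+ 2)).
  rewrite (_ : EFin \o _ = fun w => \sum_(i < N) (\sum_(j < N)
      (N%:R^-1 ^+ 2 * (g (X i w) * g (X j w))))%:E)%E.
    by apply: integrable_sum => // i _; exact: iggs.
  by apply/funext => w; rewrite /= sumEFin ZE.
rewrite -(fineK (integrable_fin_num measurableT iZ)) lee_fin.
rewrite -/(Rintegral Pr setT (fun w => Z w ^+ 2)).
under eq_Rintegral do rewrite ZE.
rewrite Rintegral_sum//.
apply: (@le_trans _ _ (\sum_(i < N) N%:R^-1 ^+ 2 * (b * th))).
  apply: ler_sum => i _; rewrite Rintegral_sum// (bigD1 i)//= big1 ?addr0.
    by rewrite RintegralZl// ler_wpM2l ?exprn_ge0 ?invr_ge0.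
  by move=> j ji; rewrite RintegralZl// E_offdiag ?mulr0// eq_sym.
rewrite sumr_const card_ord -mulr_natr expr2.
have N0' : (N%:R : R) != 0 by rewrite pnatr_eq0 -lt0n.
by rewrite le_eqVlt; apply/orP; left; apply/eqP; field.
Qed.

End IidVariance.

(** * Strips and dyadic cells *)

Section Geometry.
Context {R : realType}.
Implicit Types (t x y : R * R) (r : R) (L k a b : nat).

Let sqrt2_gt0 : 0 < Num.sqrt 2 :> R. Proof. by rewrite sqrtr_gt0. Qed.

Let sqrt2_neq0 : Num.sqrt 2 != 0 :> R. Proof. by rewrite gt_eqF. Qed.

Let sqr_sqrt2 : Num.sqrt 2 * Num.sqrt 2 = 2 :> R.
Proof. by rewrite -expr2 sqr_sqrtr. Qed.

Lemma ucoordK r t : 0 < r ->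
  t.1 + t.2 = Num.sqrt 2 * r * (ucoord r t - 1 / 2).
Proof. by move=> r0; rewrite /ucoord; field; rewrite gt_eqF. Qed.

Lemma vcoordK r t : 0 < r -> t.2 - t.1 = Num.sqrt 2 * r * vcoord r t.
Proof. by move=> r0; rewrite /vcoord; field; rewrite gt_eqF. Qed.

Lemma Omega_vcoord r t : 0 < r -> Omega t <-> 0 < vcoord r t.
Proof.
move=> r0; rewrite /Omega /= -subr_gt0 (vcoordK _ r0) pmulr_rgt0//.
by rewrite mulr_gt0.
Qed.

(** With c = r / sqrt 8 the two terms are 2c|u - v| and 2c|u + v - 1|, and the right side is 2c.
    Since |a| + |b| is the larger of |a + b| and |a - b|, the condition says |2u - 1| <= 1 and |2v -
    1| <= 1. *)
Lemma OmegaR_uvcoord r t : 0 < r ->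
  OmegaR r t <-> (0 <= ucoord r t <= 1 /\ 0 <= vcoord r t <= 1).
Proof.
move=> r0; rewrite /OmegaR /=; set u := ucoord r t; set v := vcoord r t.
have s8 : Num.sqrt 8 = 2 * Num.sqrt 2 :> R.
  rewrite (_ : 8 = 2 ^+ 2 * 2) ?sqrtrM ?exprn_ge0//; last by ring.
  by rewrite sqr_sqrt2.
pose c := r / Num.sqrt 8.
have c0 : 0 < c by rewrite divr_gt0// s8 mulr_gt0.
have -> : r / Num.sqrt 2 = 2 * c by rewrite /c s8; field.
have sE : Num.sqrt 2 * r = 4 * c.
  rewrite /c s8 -[in LHS](mulfK sqrt2_neq0 (Num.sqrt 2)) sqr_sqrt2.
  by field.
have := ucoordK t r0; have := vcoordK t r0; rewrite sE -/u -/v -/c => vE uE.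
have -> : t.1 = 2 * c * (u - 1 / 2 - v) by lra.
have -> : t.2 = 2 * c * (u - 1 / 2 + v) by lra.
have -> : 2 * c * (u - 1 / 2 - v) + c = 2 * c * (u - v) by field.
have -> : 2 * c * (u - 1 / 2 + v) - c = 2 * c * (u + v - 1) by field.
have c20 : 0 < 2 * c by rewrite mulr_gt0.
move: (2 * c) c20 => c2 c20; rewrite !normrM (gtr0_norm c20) -mulrDr.
rewrite -[leRHS]mulr1 ler_pM2l//.
split => [|[/andP[u0 u1] /andP[v0 v1]]].
  by case: (ler0P (u - v)); case: (ler0P (u + v - 1)) => *; split; apply/andP; split; lra.
by case: (ler0P (u - v)); case: (ler0P (u + v - 1)) => *; lra.
Qed.

Lemma sub_perp x : x - perp x = ((x.1 - x.2) / 2, (x.2 - x.1) / 2).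
Proof.
by rewrite /perp; apply/pair_equal_spec; split => /=; field.
Qed.

Lemma lnorm2E x : lnorm 2%:E x = Num.sqrt (`|x.1| ^+ 2 + `|x.2| ^+ 2).
Proof.
by rewrite /lnorm powR12_sqrt ?addr_ge0 ?powR_ge0// !(powR_mulrn 2).
Qed.

Lemma lnorm2_sub_perp r t : 0 < r -> 0 <= vcoord r t ->
  lnorm 2%:E (t - perp t) = r * vcoord r t.
Proof.
move=> r0 v0; rewrite sub_perp lnorm2E /= -[t.1 - t.2]opprB !mulNr normrN.
rewrite (vcoordK _ r0); move: (vcoord r t) v0 => v v0.
have z0 : 0 <= Num.sqrt 2 * r * v / 2.
  by rewrite divr_ge0// !mulr_ge0// ltW.
rewrite ger0_norm//; set z := _ / 2 in z0 *.
rewrite (_ : z ^+ 2 + z ^+ 2 = (Num.sqrt 2 * z) ^+ 2).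
  rewrite sqrtr_sqr ger0_norm ?(mulr_ge0 (ltW sqrt2_gt0) z0)//.
  by rewrite /z !mulrA sqr_sqrt2; field.
by rewrite [RHS]exprMn [X in _ = X * _]expr2 sqr_sqrt2; ring.
Qed.

(** Both coordinates of [t - perp t] have absolute value [(t.2 - t.1) / 2], and every l^q norm
    dominates a coordinate. The factor 1/2 is uniform in [q], which keeps the final constant
    independent of [q]. *)
Lemma lnorm_sub_perp_ge (q : \bar R) r t : (1 <= q)%E -> 0 < r ->
  0 <= vcoord r t -> r * vcoord r t / 2 <= lnorm q (t - perp t).
Proof.
move=> q1 r0 v0; rewrite sub_perp.
have rv0 : 0 <= r * vcoord r t by rewrite mulr_ge0// ltW.
have d0 : 0 <= (t.2 - t.1) / 2.
  by rewrite (vcoordK _ r0) divr_ge0// (mulr_ge0 (mulr_ge0 _ _) v0)// ltW.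
have s1 : 1 <= Num.sqrt 2 :> R.
  by rewrite -[leLHS]sqrtr1 ler_sqrt// ler1n.
have le : r * vcoord r t / 2 <= (t.2 - t.1) / 2.
  by rewrite (vcoordK _ r0) ler_wpM2r// -mulrA ler_peMl.
have N1 : `|(t.1 - t.2) / 2| = (t.2 - t.1) / 2.
  by rewrite -[t.1 - t.2]opprB mulNr normrN ger0_norm.
apply: le_trans le _; case: q q1 => [q|_|//]; rewrite /lnorm /= N1 ger0_norm//.
  rewrite lee_fin => q1; have q0 : 0 < q by apply: lt_le_trans q1.
  rewrite -[leLHS](@powRr1 _ ((t.2 - t.1) / 2))// -(@divff _ q) ?gt_eqF//.
  rewrite powRrM ge0_ler_powR ?invr_ge0 ?nnegrE ?powR_ge0 ?addr_ge0 ?powR_ge0//.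
    exact: ltW.
  by rewrite lerDl powR_ge0.
by rewrite maxxx.
Qed.

Lemma strip_uvcoord r k t : 0 < r -> strip r k t <->
  (0 <= ucoord r t <= 1 /\ (2 ^+ k.+1)^-1 < vcoord r t <= (2 ^+ k)^-1).
Proof.
move=> r0; split=> [[/(OmegaR_uvcoord _ r0) [uu /andP[v0 v1]]]|].
  by rewrite (lnorm2_sub_perp r0)// ltr_pM2l// ler_pM2l.
move=> [uu /andP[v0 v1]].
have v0' : 0 <= vcoord r t.
  by apply: ltW; apply: lt_trans v0; rewrite invr_gt0 exprn_gt0.
split; last by rewrite (lnorm2_sub_perp r0)// ltr_pM2l// ler_pM2l// v0 v1.
apply/(OmegaR_uvcoord _ r0); split => //; rewrite v0' (le_trans v1)//.
by rewrite invf_le1 ?exprn_gt0// exprn_ege1// ler1n.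
Qed.

Lemma strip_sub_Omega r k : 0 < r -> strip r k `<=` Omega.
Proof.
move=> r0 t /(strip_uvcoord _ _ r0) [_ /andP[v0 _]].
by apply/(Omega_vcoord _ r0); apply: lt_trans v0; rewrite invr_gt0 exprn_gt0.
Qed.

Lemma ucoord_le r t x : 0 < r ->
  `|t.1 - x.1| <= r * (`|ucoord r t - ucoord r x| + `|vcoord r t - vcoord r x|) /\
  `|t.2 - x.2| <= r * (`|ucoord r t - ucoord r x| + `|vcoord r t - vcoord r x|).
Proof.
move=> r0; have := ucoordK t r0; have := vcoordK t r0.
have := ucoordK x r0; have := vcoordK x r0.
set s := Num.sqrt 2 * r => vx ux vt ut.
have s2 : s / 2 <= r.
  rewrite /s ler_pdivrMr// mulrC ler_pM2l// leNgt; apply/negP => h.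
  by have := sqr_sqrt2; nra.
have s0 : 0 <= s / 2 by rewrite divr_ge0// mulr_ge0// ltW.
have -> : t.1 - x.1 =
  s / 2 * ((ucoord r t - ucoord r x) - (vcoord r t - vcoord r x)) by lra.
have -> : t.2 - x.2 =
  s / 2 * ((ucoord r t - ucoord r x) + (vcoord r t - vcoord r x)) by lra.
move: (ucoord r t - _) (vcoord r t - _) => du dv.
by split; rewrite normrM (ger0_norm s0) ler_pM// ?ler_normB ?ler_normD.
Qed.

End Geometry.

(** * Measurability and area of dyadic cells *)

Section Cells.
Context {R : realType}.
Implicit Types (t x y : R * R) (r : R) (L k a b : nat).

Lemma measurable_ucoord r : measurable_fun setT (ucoord r : plane R -> R).
Proof.
apply: measurable_funD => //; apply: measurable_funM => //.
by apply: measurable_funD; [exact: measurable_fst|exact: measurable_snd].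
Qed.

Lemma measurable_vcoord r : measurable_fun setT (vcoord r : plane R -> R).
Proof.
apply: measurable_funM => //.
by apply: measurable_funB; [exact: measurable_snd|exact: measurable_fst].
Qed.

(** Cells are open, and all their edges are left to [grid]: there closed and half-open conventions
    for the Haar functions disagree, and a null set hides the difference. *)
Definition cell r L a b : set (R * R) :=
  [set t | (a%:R < 2 ^+ L * ucoord r t < a.+1%:R) /\
           (b%:R < 2 ^+ L * vcoord r t < b.+1%:R)].

Definition grid r L : set (R * R) :=
  [set t | (exists z : int, 2 ^+ L * ucoord r t = z%:~R) \/
           (exists z : int, 2 ^+ L * vcoord r t = z%:~R)].

Lemma measurable_uv_itv L (g : R * R -> R) (i : interval R) :
  measurable_fun setT (g : plane R -> R) ->
  measurable ([set t | 2 ^+ L * g t \in i] : set (plane R)).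
Proof.
move=> mg; have mh : measurable_fun setT (fun t : plane R => 2 ^+ L * g t).
  exact: measurable_funM.
have := mh measurableT [set` i] (measurable_itv i).
by rewrite setTI; congr measurable; apply/seteqP; split.
Qed.

Lemma measurable_cell r L a b : measurable (cell r L a b : set (plane R)).
Proof.
have -> : cell r L a b =
    [set t | 2 ^+ L * ucoord r t \in `]a%:R, a.+1%:R[]
    `&` [set t | 2 ^+ L * vcoord r t \in `]b%:R, b.+1%:R[].
  by apply/seteqP; split => t /=; rewrite !in_itv.
apply: measurableI; apply: measurable_uv_itv => //.
  exact: measurable_ucoord.
exact: measurable_vcoord.
Qed.

Lemma measurable_OmegaR r : 0 < r -> measurable (OmegaR r : set (plane R)).
Proof.
move=> r0; have -> : OmegaR r =
    [set t | 2 ^+ 0 * ucoord r t \in `[0, 1]]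
    `&` [set t | 2 ^+ 0 * vcoord r t \in `[0, 1]].
  by apply/seteqP; split => t /=; rewrite !in_itv/= expr0 !mul1r OmegaR_uvcoord.
apply: measurableI; apply: measurable_uv_itv => //.
  exact: measurable_ucoord.
exact: measurable_vcoord.
Qed.

Lemma measurable_strip r k : 0 < r -> measurable (strip r k : set (plane R)).
Proof.
move=> r0; have -> : strip r k =
    [set t | 2 ^+ 0 * ucoord r t \in `[0, 1]]
    `&` [set t | 2 ^+ 0 * vcoord r t \in `](2 ^+ k.+1)^-1, (2 ^+ k)^-1]].
  by apply/seteqP; split => t /=; rewrite !in_itv/= expr0 !mul1r strip_uvcoord.
apply: measurableI; apply: measurable_uv_itv => //.
  exact: measurable_ucoord.
exact: measurable_vcoord.
Qed.

Lemma measurable_Omega : measurable (Omega : set (plane R)).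
Proof.
have -> : Omega = [set t : R * R | 2 ^+ 0 * vcoord 1 t \in `]0, +oo[].
  apply/seteqP; split => t /=; rewrite in_itv/= expr0 mul1r andbT.
    by move/(Omega_vcoord _ ltr01).
  by move=> ?; apply/(Omega_vcoord _ ltr01).
exact: (measurable_uv_itv _ _ (measurable_vcoord 1)).
Qed.

Lemma measurable_clOmega : measurable (clOmega : set (plane R)).
Proof.
have -> : clOmega = [set t : R * R | 2 ^+ 0 * vcoord 1 t \in `[0, +oo[].
  apply/seteqP; split => t /=; rewrite in_itv/= expr0 mul1r andbT /clOmega
    /Omega /bdOmega /=; have := vcoordK t (@ltr01 R); rewrite mulr1 => tE.
    have s0 : 0 < Num.sqrt 2 :> R by rewrite sqrtr_gt0.
    by rewrite -(pmulr_rge0 _ s0) -tE subr_ge0 => -[/ltW//|->].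
  have s0 : 0 < Num.sqrt 2 :> R by rewrite sqrtr_gt0.
  by rewrite -(pmulr_rge0 _ s0) -tE subr_ge0 le_eqVlt => /orP[/eqP|]; [right|left].
exact: (measurable_uv_itv _ _ (measurable_vcoord 1)).
Qed.

Lemma gridE r L : grid r L =
  \bigcup_(z in [set: int])
    ([set t | 2 ^+ L * ucoord r t \in `[z%:~R, z%:~R]]
     `|` [set t | 2 ^+ L * vcoord r t \in `[z%:~R, z%:~R]]).
Proof.
apply/seteqP; split => t /=.
  by move=> [[z zE]|[z zE]]; exists z => //; [left|right];
    rewrite /= in_itv/= zE lexx.
move=> [z _ [|]] /=; rewrite in_itv/= => /andP[h1 h2].
  by left; exists z; apply/eqP; rewrite eq_le h2.
by right; exists z; apply/eqP; rewrite eq_le h2.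
Qed.

Lemma measurable_grid r L : measurable (grid r L : set (plane R)).
Proof.
rewrite gridE; apply: countable_bigcupT_measurable => [|z].
  exact: countableP.
apply: measurableU; apply: measurable_uv_itv => //.
  exact: measurable_ucoord.
exact: measurable_vcoord.
Qed.

(** At a fixed first coordinate each integer determines one point on a line of either family, so
    every section is countable. *)
Lemma lebesgue2_grid r L : 0 < r -> lebesgue2 (grid r L) = 0%E.
Proof.
move=> r0; rewrite /lebesgue2 /= /product_measure1.
apply: integral0_eq => x _ /=; apply: countable_lebesgue_measure0.
rewrite xsectionE gridE.
have s0 : Num.sqrt 2 * r != 0 by rewrite gt_eqF// mulr_gt0// sqrtr_gt0.
have L0 : (2 ^+ L : R) != 0 by rewrite expf_neq0.
apply: (@sub_countable _ _ _ (\bigcup_(z in [set: int])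
  ([set (z%:~R / 2 ^+ L - 1 / 2) * (Num.sqrt 2 * r) - x]
   `|` [set (z%:~R / 2 ^+ L) * (Num.sqrt 2 * r) + x]))); last first.
  apply: bigcup_countable => [|z _]; first exact: countableP; apply: finite_set_countable.
  by rewrite finite_setU; split; exact: finite_set1.
apply: subset_card_le => y /= [z _] [|] /=; rewrite in_itv/= -eq_le => /eqP zE;
  exists z => //; [left|right] => /=; rewrite zE.
  by rewrite [_ * ucoord _ _]mulrC mulfK// /ucoord /= addrK mulfVK//; ring.
by rewrite [_ * vcoord _ _]mulrC mulfK// /vcoord /= mulfVK//; ring.
Qed.

Lemma lebesgue2_diamond (al be s : R) : 0 <= s ->
  lebesgue2 [set t | (al < t.1 + t.2 < al + s) /\ (be < t.2 - t.1 < be + s)]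
  = (s ^+ 2 / 2)%:E.
Proof.
move=> s0; set A := [set t | _].
(* The shear (x, y) |-> (x, y - x) maps A to B and translates x-sections. *)
pose B : set (plane R) :=
  [set t | (al < 2 * t.1 + t.2 < al + s) /\ (be < t.2 < be + s)].
have mB : measurable B.
  have m1 : measurable_fun setT (fun t : plane R => 2 * t.1 + t.2).
    by apply: measurable_funD => //; apply: measurable_funM.
  have -> : B = ((fun t : plane R => 2 * t.1 + t.2) @^-1` `]al, al + s[)
      `&` ((fun t : plane R => t.2) @^-1` `]be, be + s[).
    by apply/seteqP; split => t /=; rewrite !in_itv.
  apply: measurableI; rewrite -[X in measurable X]setTI.
    by apply: m1 => //; exact: measurable_itv.
  by apply: measurable_snd => //; exact: measurable_itv.
have itvI (u v w z : R) : lebesgue_measure [set y | u < y < v /\ w < y < z] =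
    if Num.max u w < Num.min v z then (Num.min v z - Num.max u w)%:E else 0%E.
  have -> : [set y | u < y < v /\ w < y < z] = `]Num.max u w, Num.min v z[%classic.
    apply/seteqP; split => y /=; rewrite in_itv/= gt_max lt_min.
      by move=> [/andP[-> ->] /andP[-> ->]].
    by move=> /andP[/andP[-> ->] /andP[-> ->]].
  by rewrite lebesgue_measure_itv /= lte_fin; case: ifP.
transitivity (lebesgue2 B).
  apply: eq_integral => x _ /=; rewrite !xsectionE.
  have -> : pair x @^-1` A = [set y | (al - x) < y < (al + s - x) /\
      (be + x) < y < (be + s + x)].
    by apply/seteqP; split => y; rewrite /A /=; lra.
  have -> : pair x @^-1` B = [set y | (al - 2 * x) < y < (al + s - 2 * x) /\
      be < y < be + s].
    by apply/seteqP; split => y; rewrite /B /=; lra.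
  rewrite !itvI.
  have -> : Num.max (al - 2 * x) be = Num.max (al - x) (be + x) - x.
    by case: (leP (al - x)); case: (leP (al - 2 * x)); lra.
  have -> : Num.min (al + s - 2 * x) (be + s) = Num.min (al + s - x) (be + s + x) - x.
    by case: (leP (al + s - x)); case: (leP (al + s - 2 * x)); lra.
  by rewrite ltrD2r; case: ifP => // _; congr EFin; ring.
rewrite /lebesgue2 /=.
(* Uniqueness of the product measure reverses the order of integration: at a fixed second coordinate
   the sections of [B] are intervals of constant length [s / 2]. *)
rewrite (product_measure_unique (m' := (lebesgue_measure \x^ lebesgue_measure)%E))//; last first.
  by move=> C D mC mD; exact: product_measure2E.
rewrite /product_measure2.
transitivity (\int[lebesgue_measure]_(y in `]be, (be + s)%R[%classic) (cst (s / 2)%:E) y)%E.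
  rewrite [RHS]integral_mkcond; apply: eq_integral => y _ /=.
  rewrite ysectionE patchE; case: ifPn.
    rewrite inE/= in_itv/= => yb.
    have -> : pair^~ y @^-1` B = `](al - y) / 2, (al - y) / 2 + s / 2[%classic.
      by apply/seteqP; split => x; rewrite /B /= in_itv /=; lra.
    rewrite lebesgue_measure_itv/= lte_fin; case: ifPn => [_|].
      by rewrite -EFinB; congr EFin; ring.
    by rewrite -leNgt => ?; congr EFin; lra.
  rewrite notin_setE /= in_itv/= => yb.
  have -> : pair^~ y @^-1` B = set0.
    by apply/seteqP; split => x //; rewrite /B /= => -[_ /yb].
  by rewrite measure0.
rewrite integral_cst//= lebesgue_measure_itv/= lte_fin; case: ifPn => [_|].
  by rewrite -EFinB -EFinM; congr EFin; field.
by rewrite -leNgt => ?; rewrite mule0; congr EFin; nra.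
Qed.

Lemma lebesgue2_cell r L a b : 0 < r ->
  lebesgue2 (cell r L a b) = (r ^+ 2 / 4 ^+ L)%:E.
Proof.
move=> r0; have L0 : (0 : R) < 2 ^+ L by rewrite exprn_gt0.
pose s := Num.sqrt 2 * r / 2 ^+ L.
have s0 : 0 < s by rewrite divr_gt0// mulr_gt0// sqrtr_gt0.
have sE : Num.sqrt 2 * r = 2 ^+ L * s by rewrite /s [RHS]mulrCA divff ?mulr1// gt_eqF.
have -> : r ^+ 2 / 4 ^+ L = s ^+ 2 / 2.
  rewrite /s !exprMn sqr_sqrtr// exprVn.
  have -> : (4 : R) = 2 ^+ 2 by ring.
  by rewrite -!exprM mulnC; field; rewrite expf_neq0.
rewrite -(lebesgue2_diamond (s * (a%:R - 2 ^+ L / 2)) (s * b%:R) (ltW s0)).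
congr (lebesgue2 _); apply/seteqP.
have E t : (cell r L a b t <->
  (s * (a%:R - 2 ^+ L / 2) < t.1 + t.2 < s * (a%:R - 2 ^+ L / 2) + s) /\
  (s * b%:R < t.2 - t.1 < s * b%:R + s)).
  rewrite /cell /= (ucoordK _ r0) (vcoordK _ r0) sE -[a.+1%:R]natr1 -[b.+1%:R]natr1.
  move: (ucoord r t) (vcoord r t) (2 ^+ L) (a%:R) (b%:R) => u v l a' b'.
  have -> : l * s * (u - 1 / 2) = s * (l * u - l / 2) by field.
  have -> : s * (a' - l / 2) + s = s * (a' - l / 2 + 1) by ring.
  have -> : l * s * v = s * (l * v) by ring.
  have -> : s * b' + s = s * (b' + 1) by ring.
  by rewrite !(ltr_pM2l s0); lra.
by split => t /E.
Qed.

End Cells.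

Lemma measure_bigcup_finType d (T : ringOfSetsType d) (R : realFieldType)
    (mu : {content set T -> \bar R}) (I : finType) (F : I -> set T) :
  (forall i, measurable (F i)) -> trivIset setT F ->
  mu (\bigcup_i F i) = (\sum_i mu (F i))%E.
Proof.
move=> mF tF; have IE : [set` enum I] = [set: I].
  by apply/seteqP; split => i //= _; rewrite mem_enum.
rewrite -IE measure_fin_bigcup ?IE//; last exact: finite_finset.
by rewrite -IE -fsbig_seq ?enum_uniq// big_enum.
Qed.

(** * Leaves of a strip *)

Section Leaves.
Context {R : realType}.
Implicit Types (t x y : R * R) (r : R) (L k : nat).

(* The cells of level L in the k-th strip are indexed by their column and by
   their row, the latter counted from the bottom of the strip. *)
Definition leafI L k : finType := ('I_(2 ^ L) * 'I_(2 ^ (L - k.+1)))%type.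

(** In the strip, [2^L * v] runs from [2^(L-k-1)] to twice that number: the offset is the first row
    of the strip and also its number of rows. *)
Definition leaf r L k (i : leafI L k) : set (R * R) :=
  cell r L i.1 (2 ^ (L - k.+1) + i.2).

Lemma measurable_leaf r L k i : measurable (@leaf r L k i : set (plane R)).
Proof. exact: measurable_cell. Qed.

Lemma lebesgue2_leaf r L k i : 0 < r ->
  lebesgue2 (@leaf r L k i) = (r ^+ 2 / 4 ^+ L)%:E.
Proof. exact: lebesgue2_cell. Qed.

Let expB L k : (k < L)%N -> (2 : R) ^+ L = 2 ^+ k.+1 * (2 ^ (L - k.+1))%:R.
Proof. by move=> kL; rewrite natrX -exprD subnKC. Qed.

Let expV1 L k : (k < L)%N ->
  2 ^+ L / 2 ^+ k.+1 = (2 ^ (L - k.+1))%:R :> R.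
Proof.
by move=> kL; rewrite (expB kL) mulrAC divff ?mul1r// expf_neq0.
Qed.

Let expV2 L k : (k < L)%N -> 2 ^+ L / 2 ^+ k = (2 * 2 ^ (L - k.+1))%:R :> R.
Proof.
by move=> kL; rewrite (expB kL) exprS natrM; field; rewrite expf_neq0.
Qed.

Lemma leaf_sub_strip r L k i : 0 < r -> (k < L)%N ->
  @leaf r L k i `<=` strip r k.
Proof.
move=> r0 kL t; case: i => a b [/= /andP[a1 a2] /andP[b1 b2]].
apply/(strip_uvcoord _ _ r0).
have L0 : (0 : R) < 2 ^+ L by rewrite exprn_gt0.
have k0 : (0 : R) < 2 ^+ k by rewrite exprn_gt0.
have aL : (a.+1%:R : R) <= 2 ^+ L by rewrite -natrX ler_nat.
have u0 : 0 <= 2 ^+ L * ucoord r t by apply: le_trans (ltW a1).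
rewrite pmulr_rge0// in u0; rewrite u0 -(@ler_pM2l _ (2 ^+ L))// mulr1.
rewrite (le_trans (ltW a2) aL); split => //.
rewrite -(@ltr_pM2l _ (2 ^+ L))// -(@ler_pM2l _ (2 ^+ L))//.
rewrite (expV1 kL) (expV2 kL).
rewrite (le_lt_trans _ b1) ?ler_nat ?leq_addr//=.
rewrite (le_trans (ltW b2))// ler_nat mul2n -addnn ltn_add2l.
exact: ltn_ord.
Qed.

Lemma trivIset_leaf r L k : trivIset setT (@leaf r L k).
Proof.
move=> [a b] [a' b'] _ _ [t [[/= /andP[a1 a2] /andP[b1 b2]]]].
move=> [/= /andP[a1' a2'] /andP[b1' b2']].
have := lt_trans a1 a2'; have := lt_trans a1' a2; rewrite !ltr_nat !ltnS => h1 h2.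
have := lt_trans b1 b2'; have := lt_trans b1' b2; rewrite !ltr_nat !ltnS !leq_add2l => h3 h4.
by congr pair; apply/val_inj/eqP; rewrite eqn_leq ?h1 ?h2 ?h3 ?h4.
Qed.

Lemma strip_leaf r L k t : 0 < r -> (k < L)%N -> strip r k t ->
  ~ grid r L t -> exists i, @leaf r L k i t.
Proof.
move=> r0 kL /(strip_uvcoord _ _ r0) [/andP[u0 u1] /andP[v0 v1]] Gt.
have L0 : (0 : R) < 2 ^+ L by rewrite exprn_gt0.
have ne (x : R) : ~ (exists z : int, x = z%:~R) -> 0 <= x ->
    exists a, a%:R < x < a.+1%:R.
  move=> xz x0; exists (Num.truncn x).
  have /andP[h ->] := truncn_itv x0; rewrite andbT lt_neqAle h andbT.
  by apply/eqP => xE; apply: xz; exists (Num.truncn x)%:Z; exact/esym/xE.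
have u0' : 0 <= 2 ^+ L * ucoord r t by rewrite mulr_ge0// ltW.
have v0' : 0 <= 2 ^+ L * vcoord r t.
  rewrite mulr_ge0 ?(ltW L0)// (le_trans _ (ltW v0))// invr_ge0 exprn_ge0//.
have [a aE] := ne _ (fun h => Gt (or_introl h)) u0'.
have [b bE] := ne _ (fun h => Gt (or_intror h)) v0'.
have /andP[a1 a2] := aE; have /andP[b1 b2] := bE.
have aL : (a < 2 ^ L)%N.
  rewrite -(ltr_nat R) (lt_le_trans a1)// natrX -[leRHS]mulr1 ler_pM2l//.
have bk : (2 ^ (L - k.+1) <= b)%N.
  by rewrite -ltnS -(ltr_nat R) -(expV1 kL) (lt_trans _ b2)// ltr_pM2l.
have bL : (b - 2 ^ (L - k.+1) < 2 ^ (L - k.+1))%N.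
  rewrite ltn_subLR// addnn -mul2n -(ltr_nat R) -(expV2 kL).
  by rewrite (lt_le_trans b1)// ler_pM2l.
exists (Ordinal aL, Ordinal bL); split => //=.
by rewrite subnKC.
Qed.

Lemma measure_strip_leaf r L k (mu : {measure set (plane R) -> \bar R})
    (A : set (R * R)) : 0 < r -> (k < L)%N ->
    mu (grid r L `&` strip r k) = 0%E -> measurable (A : set (plane R)) ->
  mu (A `&` strip r k) = (\sum_i mu (A `&` @leaf r L k i))%E.
Proof.
move=> r0 kL G0 mA.
have mS := measurable_strip k r0.
have mG : measurable (grid r L `&` strip r k : set (plane R)).
  by apply: measurableI => //; exact: measurable_grid.
have mAl i : measurable (A `&` @leaf r L k i : set (plane R)).
  by apply: measurableI => //; exact: measurable_leaf.
have mU : measurable (\bigcup_i (A `&` @leaf r L k i) : set (plane R)).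
  by apply: fin_bigcup_measurable => //; exact: finite_finset.
rewrite -measure_bigcup_finType//; last first.
  move=> i j _ _ [t [[_ ti] [_ tj]]].
  by apply: (@trivIset_leaf r L k) => //; exists t.
apply/eqP; rewrite eq_le; apply/andP; split; last first.
  apply: le_measure; rewrite ?inE//; first exact: measurableI.
  by move=> t [i _ [At lt]]; split => //; exact: leaf_sub_strip lt.
rewrite -[leRHS](measureU0 mU mG G0).
apply: le_measure; rewrite ?inE//; [exact: measurableI|exact: measurableU|].
move=> t [At St]; have [Gt|Gt] := pselect (grid r L t); first by right.
by left; have [i it] := strip_leaf r0 kL St Gt; exists i.
Qed.

(** At level [k.+1] the strip is a single row of [2^(k+1)] leaves, so its area is r^2 / 2^(k+1). *)
Lemma lebesgue2_strip_le r k : 0 < r ->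
  (lebesgue2 (strip r k) <= (r ^+ 2 / 2 ^+ k)%:E)%E.
Proof.
move=> r0; rewrite -[strip r k]setTI (@measure_strip_leaf r k.+1)//; last first.
  apply/eqP; rewrite eq_le measure_ge0 andbT -(lebesgue2_grid k.+1 r0).
  apply: le_measure; rewrite ?inE//.
    by apply: measurableI; [exact: measurable_grid|exact: measurable_strip].
  exact: measurable_grid.
under eq_bigr do rewrite setTI lebesgue2_leaf//.
rewrite sumEFin lee_fin sumr_const card_prod !card_ord subnn muln1.
have -> : r ^+ 2 / 4 ^+ k.+1 *+ 2 ^ k.+1 = r ^+ 2 / 2 ^+ k.+1.
  rewrite -[_ *+ 2 ^ _]mulr_natr natrX (_ : 4 = 2 * 2) ?exprMn; last by ring.
  by field; rewrite expf_neq0.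
by rewrite ler_pM2l ?exprn_gt0// lef_pV2 ?posrE ?exprn_gt0// ler_eXn2l ?ltr1n.
Qed.

End Leaves.

(** * Transport plans *)

Section CompactMeasurable.
Context {R : realType}.

(** Rational boxes are countable and generate the topology. [B] is empty for boxes not contained in
    [V], so the union may run over all parameters. This is what gives compact sets a measure under a
    plan. *)
Lemma open_measurable_plane2 (V : set ((R * R) * (R * R))) :
  open V -> measurable (V : set (plane R * plane R)).
Proof.
move=> oV; pose near (n : nat) (q : rat) : set R := ball (ratr q : R) n.+1%:R^-1.
pose box n q1 q2 q3 q4 : set ((R * R) * (R * R)) :=
  (near n q1 `*` near n q2) `*` (near n q3 `*` near n q4).
pose B n q1 q2 q3 q4 : set ((R * R) * (R * R)) :=
  [set z | box n q1 q2 q3 q4 z /\ box n q1 q2 q3 q4 `<=` V].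
have mB n q1 q2 q3 q4 : measurable (B n q1 q2 q3 q4 : set (plane R * plane R)).
  have [bV|bV] := pselect (box n q1 q2 q3 q4 `<=` V).
    have -> : B n q1 q2 q3 q4 = box n q1 q2 q3 q4.
      by apply/seteqP; split => z // [].
    have mb q : measurable (near n q : set (measurableTypeR R)).
      exact: measurable_ball.
    by apply: measurableX; apply: measurableX; exact: mb.
  have -> : B n q1 q2 q3 q4 = set0 by apply/seteqP; split => z // [].
  exact: measurable0.
suff -> : V = \bigcup_n \bigcup_q1 \bigcup_q2 \bigcup_q3 \bigcup_q4 B n q1 q2 q3 q4.
  apply: bigcupT_measurable => n; do 4 apply: bigcupT_measurable_rat => ?.
  exact: mB.
apply/seteqP; split => [z Vz|z [n _ [q1 _ [q2 _ [q3 _ [q4 _ [bz bV]]]]]]]; last exact: bV.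
have /nbhs_ballP[e /= e0 eV] : nbhs z V by exact: open_nbhs_nbhs.
(* The radius 1 / (n + 1) is below e / 2, so a box containing [z] stays in the ball of radius [e]
   about [z]. *)
pose n := Num.truncn (2 / e).
have n0 : (0 : R) < n.+1%:R^-1 by rewrite invr_gt0.
have ne : n.+1%:R^-1 * 2 < e.
  rewrite mulrC ltr_pdivrMr// mulrC -ltr_pdivrMr//.
  have e2 : 0 <= 2 / e by rewrite divr_ge0// ltW.
  by have /andP[_] := truncn_itv e2.
have near_ex (d x : R) : 0 < d -> exists q, ball (ratr q : R) d x.
  move=> d0; have /(rat_in_itvoo) [q] : x - d < x + d by lra.
  rewrite in_itv /= => qx; exists q; rewrite /ball /=.
  by rewrite ltr_norml; lra.
have near_tri (d x y : R) q : d * 2 < e ->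
    ball (ratr q : R) d x -> ball (ratr q : R) d y -> ball x e y.
  by rewrite /ball /= !ltr_norml; lra.
have [q1 z1] := near_ex _ z.1.1 n0; have [q2 z2] := near_ex _ z.1.2 n0.
have [q3 z3] := near_ex _ z.2.1 n0; have [q4 z4] := near_ex _ z.2.2 n0.
exists n => //; exists q1 => //; exists q2 => //; exists q3 => //; exists q4 => //.
split; first by [].
move=> w [[w1 w2] [w3 w4]]; apply: eV; split; split => /=.
- exact: near_tri ne z1 w1.
- exact: near_tri ne z2 w2.
- exact: near_tri ne z3 w3.
- exact: near_tri ne z4 w4.
Qed.

Lemma compact_measurable_plane2 (K : set ((R * R) * (R * R))) :
  compact K -> measurable (K : set (plane R * plane R)).
Proof.
move=> cK; have clK : closed K.
  by apply: compact_closed cK; exact: (@norm_hausdorff R ((R * R) * (R * R))%type).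
rewrite -[K]setCK; apply: measurableC; apply: open_measurable_plane2.
by rewrite openC.
Qed.

End CompactMeasurable.

Section Plans.
Context {R : realType}.
Variable p : R.
Hypothesis p1 : 1 <= p.
Implicit Types (x y : R * R) (al be : set (R * R) -> \bar R).
Implicit Types (gam : {measure set (plane R * plane R) -> \bar R}).

Let p0 : 0 < p. Proof. exact: lt_le_trans p1. Qed.

Definition tcost (z : (R * R) * (R * R)) : R := (lnorm p%:E (z.1 - z.2)) `^ p.

Lemma tcost_ge0 z : 0 <= tcost z. Proof. exact: powR_ge0. Qed.

Lemma tcostE z :
  tcost z = `|z.1.1 - z.2.1| `^ p + `|z.1.2 - z.2.2| `^ p.
Proof.
by rewrite /tcost /lnorm -powRrM mulVf ?gt_eqF// powRr1// addr_ge0.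
Qed.

Lemma measurable_tcost : measurable_fun setT (tcost : plane R * plane R -> R).
Proof.
rewrite (_ : tcost = fun z => `|z.1.1 - z.2.1| `^ p + `|z.1.2 - z.2.2| `^ p);
  last by apply/funext => z; exact: tcostE.
have mp (f : plane R * plane R -> R) : measurable_fun setT f ->
    measurable_fun setT (fun z => `|f z| `^ p).
  move=> mf; apply: (measurableT_comp (measurable_powR _)).
  exact: (measurableT_comp (@normr_measurable R setT)).
have m1 : measurable_fun setT (fun z : plane R * plane R => z.1) by exact: measurable_fst.
have m2 : measurable_fun setT (fun z : plane R * plane R => z.2) by exact: measurable_snd.
apply: measurable_funD; apply: mp; apply: measurable_funB.
- exact: (measurableT_comp measurable_fst m1).
- exact: (measurableT_comp measurable_fst m2).
- exact: (measurableT_comp measurable_snd m1).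
- exact: (measurableT_comp measurable_snd m2).
Qed.

Lemma tcost_le_lin r x y (e : R) : 0 < r -> 0 <= e ->
    `|ucoord r x - ucoord r y| <= e -> `|vcoord r x - vcoord r y| <= e ->
  tcost (x, y) <= 2 * (2 * r * e) `^ p.
Proof.
move=> r0 e0 ue ve; have [h1 h2] := ucoord_le x y r0.
have le : r * (`|ucoord r x - ucoord r y| + `|vcoord r x - vcoord r y|)
    <= 2 * r * e.
  by rewrite [2 * r]mulrC -mulrA ler_pM2l//; lra.
have rr : 0 <= 2 * r * e by rewrite !mulr_ge0// ltW.
rewrite tcostE /= mulrDl !mul1r.
by apply: lerD; apply: ge0_ler_powR; rewrite ?nnegrE//; rewrite ?(ltW p0)//;
  [exact: le_trans le|exact: le_trans le].
Qed.

Definition plan_dom : set ((R * R) * (R * R)) := clOmega `*` clOmega.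

Lemma measurable_plan_dom : measurable (plan_dom : set (plane R * plane R)).
Proof. by apply: measurableX; exact: measurable_clOmega. Qed.

(* The bound is on the p-th power of the cost, which adds up when plans are
   superposed. *)
Definition has_plan al be (c : \bar R) : Prop := exists gam,
  [/\ concentrated_on (clOmega `*` clOmega) gam,
     finite_on_compacts ((clOmega `*` clOmega) `\` (bdOmega `*` bdOmega)) gam,
     (forall A : set (plane R), measurable A -> A `<=` Omega ->
        gam (A `*` clOmega) = al A),
     (forall B : set (plane R), measurable B -> B `<=` Omega ->
        gam (clOmega `*` B) = be B) &
     (\int[gam]_(z in plan_dom) (tcost z)%:E <= c)%E].

Lemma has_plan_OT al be (c : R) : has_plan al be c%:E ->
  (OT p al be `^ p <= c%:E)%E.
Proof.
move=> [gam [g1 g2 g3 g4 gc]].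
have int0 : (0 <= \int[gam]_(z in plan_dom) (tcost z)%:E)%E.
  by apply: integral_ge0 => z _; rewrite lee_fin tcost_ge0.
set I := (\int[gam]_(z in plan_dom) (tcost z)%:E)%E in gc int0 *.
have OT0 : (0 <= OT p al be)%E.
  by apply: le_ereal_inf_tmp => _ [g _ <-]; exact: poweR_ge0.
have OTI : (OT p al be <= I `^ p^-1)%E by apply: ereal_inf_lbound; exists gam.
have : (OT p al be `^ p <= (I `^ p^-1) `^ p)%E.
  by apply: gt0_ler_poweR => //; rewrite ?(ltW p0)// in_itv/= ?OT0 ?poweR_ge0 ?leey.
rewrite -poweRrM mulVf ?gt_eqF// poweRe1// => h; exact: le_trans gc.
Qed.

(** Marginals are tested only on Borel subsets of [Omega]; mass that a plan puts on the diagonal is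
    invisible to them, which is the partial character of the transport. *)
Lemma eq_has_plan al al' be be' c c' :
    (forall A : set (plane R), measurable A -> A `<=` Omega -> al A = al' A) ->
    (forall B : set (plane R), measurable B -> B `<=` Omega -> be B = be' B) ->
    (c <= c')%E -> has_plan al be c -> has_plan al' be' c'.
Proof.
move=> alE beE cc [gam [g1 g2 g3 g4 gc]]; exists gam; split => //.
- by move=> A mA AO; rewrite g3// alE.
- by move=> B mB BO; rewrite g4// beE.
- exact: le_trans cc.
Qed.

Lemma has_plan0 : has_plan (fun=> 0%E) (fun=> 0%E) 0%E.
Proof.
exists mzero; split => //; first by move=> K _ _; exact: ltry.
by rewrite integral_measure_zero.
Qed.

Lemma has_planD al be c al' be' c' : has_plan al be c -> has_plan al' be' c' ->
  has_plan (fun A => al A + al' A)%E (fun B => be B + be' B)%E (c + c')%E.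
Proof.
move=> [g [g1 g2 g3 g4 gc]] [h [h1 h2 h3 h4 hc]]; exists (measure_add g h).
split.
- by apply: etrans (measure_addE g h _) _; rewrite g1 h1 adde0.
- move=> K cK KD; rewrite [ltLHS](measure_addE g h K).
  by rewrite lte_add_pinfty ?g2 ?h2.
- by move=> A mA AO; rewrite [LHS](measure_addE g h) g3 ?h3.
- by move=> B mB BO; rewrite [LHS](measure_addE g h) g4 ?h4.
- rewrite ge0_integral_measure_add ?leeD//; first exact: measurable_plan_dom.
    by move=> z _; rewrite lee_fin tcost_ge0.
  by apply/measurable_EFinP; apply: measurable_funTS; exact: measurable_tcost.
Qed.

Lemma has_plan_sum (I : Type) (s : seq I)
    (al be : I -> set (R * R) -> \bar R) (c : I -> \bar R) :
  (forall i, has_plan (al i) (be i) (c i)) ->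
  has_plan (fun A => \sum_(i <- s) al i A)%E (fun B => \sum_(i <- s) be i B)%E
           (\sum_(i <- s) c i)%E.
Proof.
move=> h; elim: s => [|i s IH].
  by apply: eq_has_plan has_plan0 => [A _ _|B _ _|]; rewrite big_nil.
by apply: eq_has_plan (has_planD (h i) IH) => [A _ _|B _ _|]; rewrite big_cons.
Qed.

Lemma has_planZ al be (c w : R) : 0 <= w -> has_plan al be c%:E ->
  has_plan (fun A => w%:E * al A)%E (fun B => w%:E * be B)%E (w * c)%:E.
Proof.
move=> w0 [g [g1 g2 g3 g4 gc]]; exists (mscale (NngNum w0) g).
have sE A : mscale (NngNum w0) g A = (w%:E * g A)%E by [].
split.
- by apply: etrans (sE _) _; rewrite g1 mule0.
- move=> K cK KD; rewrite [ltLHS]sE.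
  by rewrite lte_mul_pinfty ?lee_fin// g2.
- by move=> A mA AO; rewrite [LHS]sE g3.
- by move=> B mB BO; rewrite [LHS]sE g4.
- rewrite ge0_integral_mscale//=.
  + by rewrite EFinM lee_wpmul2l ?lee_fin.
  + exact: measurable_plan_dom.
  + by apply/measurable_EFinP; apply: measurable_funTS; exact: measurable_tcost.
  + by move=> z _; rewrite lee_fin tcost_ge0.
Qed.

(** The product measure serves as the plan, without normalization: each marginal carries the total
    mass of the other factor. [has_planZ] rescales it afterwards, so zero masses need no separate
    case here. *)
Lemma has_plan_prod (m1 m2 : {finite_measure set (plane R) -> \bar R})
    (S1 S2 : set (plane R)) (c : R) :
    measurable S1 -> measurable S2 -> S1 `<=` clOmega -> S2 `<=` clOmega ->
    m1 (~` S1) = 0%E -> m2 (~` S2) = 0%E -> 0 <= c ->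
    (forall x y, S1 x -> S2 y -> tcost (x, y) <= c) ->
  has_plan (fun A => m1 A * m2 setT)%E (fun B => m1 setT * m2 B)%E
           (c%:E * (m1 setT * m2 setT))%E.
Proof.
move=> mS1 mS2 S1O S2O m1S m2S c0 Sc.
have mO := @measurable_clOmega R.
have prodE (A B : set (plane R)) : measurable A -> measurable B ->
    (m1 \x m2)%E (A `*` B) = (m1 A * m2 B)%E.
  by move=> mA mB; exact: product_measure1E.
have null (m : {finite_measure set (plane R) -> \bar R}) (S : set (plane R)) :
    measurable S -> S `<=` clOmega -> m (~` S) = 0%E -> m clOmega = m setT.
  move=> mS SO mS0; apply/esym; rewrite -(setUv (clOmega : set (plane R))).
  apply: measureU0 => //; first exact: measurableC.
  - apply/eqP; rewrite eq_le measure_ge0 andbT -mS0.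
    by apply: le_measure; rewrite ?inE//; [exact: measurableC|exact: measurableC|exact: subsetC].
have m1O := null m1 S1 mS1 S1O m1S; have m2O := null m2 S2 mS2 S2O m2S.
have gT : (m1 \x m2)%E setT = (m1 setT * m2 setT)%E.
  by rewrite -setXTT prodE.
have gfin : ((m1 \x m2)%E setT < +oo)%E.
  by rewrite gT ltey_eq fin_numM ?fin_num_measure.
have gS : (m1 \x m2)%E (~` (S1 `*` S2)) = 0%E.
  have -> : ~` (S1 `*` S2) = (~` S1 `*` setT) `|` (setT `*` ~` S2).
    apply/seteqP; split => [[x y] /= /not_andP[]|[x y] /= [[h _]|[_ h]] []//];
      by [left|right].
  have mS1C := measurableC mS1; have mS2C := measurableC mS2.
  have g1 : (m1 \x m2)%E (~` S1 `*` setT) = 0%E.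
    by rewrite prodE// m1S mul0e.
  have g2 : (m1 \x m2)%E (setT `*` ~` S2) = 0%E.
    by rewrite prodE// m2S mule0.
  by apply: etrans (measureU0 _ _ g2) g1; exact: measurableX.
exists (m1 \x m2)%E; split.
- apply/eqP; rewrite eq_le measure_ge0 andbT -gS; apply: le_measure; rewrite ?inE//.
  + by apply: measurableC; exact: measurable_plan_dom.
  + by apply: measurableC; exact: measurableX.
  + by apply: subsetC => z [/S1O ? /S2O ?].
- move=> K cK _; apply: le_lt_trans gfin; apply: le_measure; rewrite ?inE//.
  exact: compact_measurable_plane2.
- by move=> A mA AO; rewrite [LHS](prodE _ _ mA mO) m2O.
- by move=> B mB BO; rewrite [LHS](prodE _ _ mO mB) m1O.
- rewrite -gT; apply: (@le_trans _ _ (\int[(m1 \x m2)%E]_(z in plan_dom) (cst c%:E) z)%E).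
    apply: ae_ge0_le_integral => //.
    + exact: measurable_plan_dom.
    + by move=> z _; rewrite lee_fin tcost_ge0.
    + by apply/measurable_EFinP; apply: measurable_funTS; exact: measurable_tcost.
    + exists (~` (S1 `*` S2)); split => //.
        by apply: measurableC; exact: measurableX.
      move=> [x y] /= /not_implyP[_] h [Sx Sy]; apply: h.
      by rewrite lee_fin Sc.
  rewrite integral_cst; last exact: measurable_plan_dom.
  rewrite lee_wpmul2l ?lee_fin//; apply: le_measure; rewrite ?inE//.
  exact: measurable_plan_dom.
Qed.

End Plans.

(** * Plans by projection to the diagonal and by superposition of products *)

Section PlanConstructions.
Context {R : realType}.
Variable p : R.
Hypothesis p1 : 1 <= p.
Implicit Types (x y : R * R).

(** The sum of the two heights above the diagonal is continuous and positive on [K], so its compact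
    image stays away from 0. Local finiteness of a plan thus only concerns mass at a positive
    distance from the diagonal. *)
Lemma compact_offdiag_gap (K : set ((R * R) * (R * R))) : compact K ->
    K `<=` (clOmega `*` clOmega) `\` (bdOmega `*` bdOmega) ->
  exists2 e : R, 0 < e &
    forall z, K z -> e <= (z.1.2 - z.1.1) + (z.2.2 - z.2.1).
Proof.
move=> cK KD; pose g (z : (R * R) * (R * R)) : R :=
  (z.1.2 - z.1.1) + (z.2.2 - z.2.1).
have g0 z : K z -> 0 < g z.
  move=> /KD[] [] /= z1 z2 z3; rewrite /g.
  have ge0 x : clOmega x -> 0 <= x.2 - x.1.
    by rewrite subr_ge0 => -[/ltW//|]; rewrite /bdOmega /= => ->.
  have bd x : clOmega x -> ~ bdOmega x -> 0 < x.2 - x.1.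
    by rewrite subr_gt0 => -[].
  have [b1|b1] := pselect (bdOmega z.1); last first.
    by rewrite ltr_pwDl ?ge0 ?bd.
  have [b2|b2] := pselect (bdOmega z.2); first by case: z3.
  by rewrite ltr_wpDl ?ge0 ?bd.
have cg : continuous g.
  move=> z; apply: cvgD; apply: cvgB.
  - exact: (@continuous_comp _ _ _ fst snd z cvg_fst cvg_snd).
  - exact: (@continuous_comp _ _ _ fst fst z cvg_fst cvg_fst).
  - exact: (@continuous_comp _ _ _ snd snd z cvg_snd cvg_snd).
  - exact: (@continuous_comp _ _ _ snd fst z cvg_snd cvg_fst).
have cgK : compact (g @` K).
  by apply: continuous_compact cK; exact: continuous_subspaceT.
have clgK : closed (g @` K) by apply: compact_closed cgK; exact: Rhausdorff.
have N0 : (~` (g @` K)) 0 by move=> [z /g0 + gz]; rewrite gz ltxx.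
have : nbhs 0 (~` (g @` K)).
  by apply: open_nbhs_nbhs; split => //; rewrite openC.
move=> /nbhs_ballP[e /= e0 eK]; exists e => // z Kz.
rewrite leNgt; apply/negP => ze; apply: (eK (g z)); last by exists z.
by rewrite /ball /= sub0r normrN gtr0_norm ?g0.
Qed.

Lemma measurable_perp : measurable_fun setT (perp : plane R -> plane R).
Proof.
have m : measurable_fun setT (fun t : plane R => (t.1 + t.2) / 2).
  by apply: measurable_funM => //; exact: measurable_funD.
exact: (measurable_fun_pair m m).
Qed.

(** The plan is the image of [nu] restricted to [S] under [x |-> (perp x, x)]; its first marginal
    sits on the diagonal and does not count. [nu] may be infinite near the diagonal, so finiteness
    is only asked at height at least [e]. *)
Lemma has_plan_project (nu : {measure set (plane R) -> \bar R})
    (S : set (plane R)) (c : \bar R) : measurable S -> S `<=` Omega ->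
    (forall e : R, 0 < e ->
       (nu (S `&` [set x : plane R | (e <= x.2 - x.1)%R]) < +oo)%E) ->
    (\int[nu]_(x in S) (tcost p (perp x, x))%:E <= c)%E ->
  has_plan p (fun=> 0%E) (fun B => nu (B `&` S)) c.
Proof.
move=> mS SO nufin nuc; pose phi (x : plane R) : plane R * plane R := (perp x, x).
have mphi : measurable_fun setT phi.
  by apply: measurable_fun_pair; [exact: measurable_perp|exact: measurable_id].
have [gam gamE] : exists gam : {measure set (plane R * plane R) -> \bar R},
    forall A, gam A = nu ((phi @^-1` A) `&` S).
  by unshelve eexists (pushforward (mrestr nu mS) phi).
have mO := @measurable_clOmega R.
have mcost : measurable_fun setT (fun x => (tcost p (phi x))%:E).
  apply/measurable_EFinP; apply: (measurableT_comp _ mphi).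
  exact: measurable_tcost p1.
exists gam; split.
- rewrite /concentrated_on gamE (_ : _ `&` _ = set0) ?measure0//.
  apply/seteqP; split => x //= -[xO Sx]; apply: xO; split; first by right.
  by left; exact: SO.
- move=> K cK KD; have [e e0 eK] := compact_offdiag_gap cK KD.
  rewrite gamE; apply: le_lt_trans (nufin e e0); apply: le_measure; rewrite ?inE.
  + apply: measurableI => //; rewrite -[X in measurable X]setTI.
    by apply: mphi => //; exact: compact_measurable_plane2.
  + apply: measurableI => //; rewrite -[X in measurable X]setTI.
    have m : measurable_fun setT (fun x : plane R => x.2 - x.1).
      by apply: measurable_funB; [exact: measurable_snd|exact: measurable_fst].
    have := m measurableT `[e, +oo[%classic (measurable_itv _).
    by congr measurable; apply/seteqP; split => x /=; rewrite in_itv/= andbT.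
  + move=> x [Kx Sx]; split => //=.
    by have := eK _ Kx; rewrite /phi /perp /= subrr add0r.
- move=> A mA AO; rewrite gamE (_ : _ `&` _ = set0) ?measure0//.
  by apply/seteqP; split => x //= -[[/AO]]; rewrite /Omega /= ltxx.
- move=> B mB BO; rewrite gamE; congr (nu _); apply/seteqP.
  split=> x /= [xB Sx]; split => //; first by case: xB.
  by split => //; right.
- apply: le_trans nuc; rewrite (eq_measure_integral (pushforward (mrestr nu mS) phi)).
    rewrite ge0_integral_pushforward//.
    + have mD : measurable (phi @^-1` plan_dom).
        rewrite -[X in measurable X]setTI; apply: mphi => //.
        exact: measurable_plan_dom.
      have mSC := measurableC mS.
      have mc : measurable_fun (phi @^-1` plan_dom) (EFin \o tcost p \o phi).
        exact: measurable_funTS.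
      have S0 : mrestr nu mS (~` S) = 0%E by rewrite /mrestr setICl measure0.
      rewrite (ge0_negligible_integral mSC mD mc _ S0)//; last first.
        by move=> x _; rewrite lee_fin tcost_ge0.
      have -> : phi @^-1` plan_dom `\` ~` S = S.
        rewrite setDE setCK; apply/seteqP; split => [x []//|x Sx].
        by split => //; split; [right|left; exact: SO].
      rewrite le_eqVlt; apply/orP; left; apply/eqP.
      apply: eq_measure_integral => A mA AS.
      by rewrite /= /mrestr setIidl.
    + exact: measurable_plan_dom.
    + by apply/measurable_EFinP; apply: measurable_funTS; exact: measurable_tcost.
    + by move=> z _; rewrite lee_fin tcost_ge0.
  by move=> A mA _; exact: gamE.
Qed.

Lemma measurable_set1_plane (z : plane R) : measurable [set z].
Proof.
have -> : [set z] = [set z.1] `*` [set z.2].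
  case: z => a b; apply/seteqP; split=> [[c d] [-> ->]//|[c d] /= [-> ->]//].
by apply: measurableX; exact: measurable_set1.
Qed.

(** The entry [G i j] is spread as the product of [m1 i] and [m2 j], divided by their total masses;
    the rests [x i] and [y i] are exchanged with a Dirac mass at a diagonal point, which no Borel
    subset of [Omega] sees. *)
Lemma has_plan_discrete (I : finType)
    (m1 m2 : I -> {finite_measure set (plane R) -> \bar R})
    (S : I -> set (plane R)) (l n a b x y : I -> R) (G : I -> I -> R)
    (cst : I -> I -> R) (cd : R) (pt : I -> R * R) :
    partial_plan a b G x y ->
    (forall i, m1 i setT = (l i)%:E) -> (forall i, m2 i setT = (n i)%:E) ->
    (forall i, l i = 0 -> a i = 0) -> (forall i, n i = 0 -> b i = 0) ->
    (forall i, measurable (S i)) -> (forall i, S i `<=` clOmega) ->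
    (forall i, m1 i (~` S i) = 0%E) -> (forall i, m2 i (~` S i) = 0%E) ->
    (forall i j, 0 <= cst i j) -> 0 <= cd -> (forall i, bdOmega (pt i)) ->
    (forall i j s t, S i s -> S j t -> tcost p (s, t) <= cst i j) ->
    (forall i s, S i s -> tcost p (s, pt i) <= cd) ->
    (forall i s, S i s -> tcost p (pt i, s) <= cd) ->
  has_plan p (fun A => \sum_i (a i / l i)%:E * m1 i A)%E
             (fun B => \sum_i (b i / n i)%:E * m2 i B)%E
             (\sum_i \sum_j G i j * cst i j + cd * (\sum_i x i + \sum_i y i))%:E.
Proof.
move=> [G0 x0 y0 aE bE] m1T m2T la nb mS SO m1S m2S cst0 cd0 ptO Sc Sd dS.
have l0 i : 0 <= l i by rewrite -lee_fin -m1T.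
have n0 i : 0 <= n i by rewrite -lee_fin -m2T.
(* Where a total mass vanishes, the quotients of the statement are 0 by convention; the entries of
   the partial plan vanish there too, so nothing is lost. *)
have Ga i j : l i = 0 -> G i j = 0.
  move=> /la ai0; apply/eqP; rewrite eq_le G0 andbT -ai0 aE.
  by rewrite (bigD1 j)//= -addrA lerDl addr_ge0// sumr_ge0.
have Gb i j : n j = 0 -> G i j = 0.
  move=> /nb bj0; apply/eqP; rewrite eq_le G0 andbT -bj0 bE.
  by rewrite (bigD1 i)//= -addrA lerDl addr_ge0// sumr_ge0.
have xa i : l i = 0 -> x i = 0.
  move=> /la ai0; apply/eqP; rewrite eq_le x0 andbT -ai0 aE.
  by rewrite lerDr sumr_ge0.
have yb i : n i = 0 -> y i = 0.
  move=> /nb bi0; apply/eqP; rewrite eq_le y0 andbT -bi0 bE.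
  by rewrite lerDr sumr_ge0.
have canc (u v : R) : (v = 0 -> u = 0) -> u / v * v = u.
  move=> uv; have [v0|v0] := eqVneq v 0; last by rewrite divfK.
  by rewrite v0 mulr0 uv.
have m1f i A : measurable A -> m1 i A = (fine (m1 i A))%:E.
  by move=> mA; rewrite fineK// fin_num_measure.
have m2f i A : measurable A -> m2 i A = (fine (m2 i A))%:E.
  by move=> mA; rewrite fineK// fin_num_measure.
pose dir i : {finite_measure set (plane R) -> \bar R} := dirac (pt i : plane R).
have dirT i : dir i setT = 1%E by rewrite /dir /= diracT.
have dirO i (B : set (plane R)) : B `<=` Omega -> dir i B = 0%E.
  move=> BO; rewrite /dir /= diracE memNset// => /BO.
  by rewrite /Omega /= (ptO i) ltxx.
pose P i : set (plane R) := [set pt i].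
have mP i : measurable (P i) by exact: measurable_set1_plane.
have dirP i : dir i (~` P i) = 0%E by rewrite /dir /= diracE memNset//; apply.
have PO i : P i `<=` clOmega by move=> z ->; right.
have P1 i j : has_plan p
    (fun A => (G i j / (l i * n j))%:E * (m1 i A * (n j)%:E))%E
    (fun B => (G i j / (l i * n j))%:E * ((l i)%:E * m2 j B))%E
    (G i j * cst i j)%:E.
  have H := has_plan_prod p1 (mS i) (mS j) (SO i) (SO j) (m1S i) (m2S j)
    (cst0 i j) (Sc i j).
  rewrite m1T m2T -!EFinM in H.
  have w0 : 0 <= G i j / (l i * n j) by rewrite divr_ge0// mulr_ge0.
  apply: eq_has_plan (has_planZ p1 w0 H) => //.
  rewrite lee_fin [cst i j * _]mulrC mulrA canc// => /eqP.
  by rewrite mulf_eq0 => /orP[] /eqP; [exact: Ga|exact: Gb].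
have P2 i : has_plan p (fun A => (x i / l i)%:E * m1 i A)%E
    (fun=> 0%E) (x i * cd)%:E.
  have H := has_plan_prod p1 (mS i) (mP i) (SO i) (PO i) (m1S i) (dirP i) cd0.
  have {}H := H (fun u v Su Pv => ltac:(rewrite Pv; exact: Sd Su)).
  rewrite m1T dirT mule1 -EFinM in H.
  have w0 : 0 <= x i / l i by rewrite divr_ge0.
  apply: eq_has_plan (has_planZ p1 w0 H) => [A _ _|B _ BO|].
  - by rewrite mule1.
  - by rewrite dirO// !mule0.
  - by rewrite lee_fin [cd * _]mulrC mulrA canc//; exact: xa.
have P3 i : has_plan p (fun=> 0%E) (fun B => (y i / n i)%:E * m2 i B)%E
    (y i * cd)%:E.
  have H := has_plan_prod p1 (mP i) (mS i) (PO i) (SO i) (dirP i) (m2S i) cd0.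
  have {}H := H (fun u v Pu Sv => ltac:(rewrite Pu; exact: dS Sv)).
  rewrite m2T dirT mul1e in H.
  rewrite -EFinM in H.
  have w0 : 0 <= y i / n i by rewrite divr_ge0.
  apply: eq_has_plan (has_planZ p1 w0 H) => [A _ AO|B _ _|].
  - by rewrite dirO// mul0e mule0.
  - by rewrite mul1e.
  - by rewrite lee_fin [cd * _]mulrC mulrA canc//; exact: yb.
have P1' := has_plan_sum p1 (index_enum I) (fun i =>
  has_plan_sum p1 (index_enum I) (P1 i)).
apply: eq_has_plan (has_planD p1 P1' (has_planD p1
  (has_plan_sum p1 (index_enum I) P2) (has_plan_sum p1 (index_enum I) P3))).
- move=> A mA AO; rewrite [X in (_ + (_ + X))%E]big1// adde0 -big_split /=.
  apply: eq_bigr => i _; rewrite (m1f i A mA).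
  under eq_bigr do rewrite -!EFinM.
  rewrite sumEFin -EFinM -EFinD; congr EFin.
  rewrite aE mulrDl mulrDl; congr (_ + _); rewrite !mulr_suml.
  apply: eq_bigr => j _; rewrite -[in RHS](canc _ _ (Gb i j)) invfM; ring.
- move=> B mB BO; rewrite [X in (_ + (X + _))%E]big1// add0e exchange_big /=.
  rewrite -big_split /=; apply: eq_bigr => j _; rewrite (m2f j B mB).
  under eq_bigr do rewrite -!EFinM.
  rewrite sumEFin -EFinM -EFinD; congr EFin.
  rewrite bE mulrDl mulrDl; congr (_ + _); rewrite !mulr_suml.
  apply: eq_bigr => i _; rewrite -[in RHS](canc _ _ (Ga i j)) invfM; ring.
- under eq_bigr do rewrite sumEFin.
  rewrite !sumEFin -!EFinD lee_fin mulrDr !mulr_sumr lerD// lerD//.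
    by rewrite le_eqVlt; apply/orP; left; apply/eqP/eq_bigr => i _; rewrite mulrC.
  by rewrite le_eqVlt; apply/orP; left; apply/eqP/eq_bigr => i _; rewrite mulrC.
Qed.

End PlanConstructions.

(** * The Haar estimator *)

Import HBNNSimple.

Section IntegralOffNull.
Context {d : measure_display} {T : measurableType d} {R : realType}.
Variables (mu : {measure set T -> \bar R}) (N : set T).
Hypotheses (mN : measurable N) (N0 : mu N = 0%E).
Implicit Types F G : T -> \bar R.

(** No measurability is assumed of [F] and [G]: the integral is a supremum over simple functions,
    and one lying below [F], multiplied by the indicator of the complement of [N], lies below [G]
    and has the same integral. This covers the transport cost as a function of the sample. *)
Lemma ge0_le_integral_off_null F G :
    (forall x, 0 <= F x)%E -> (forall x, 0 <= G x)%E ->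
    (forall x, ~ N x -> (F x <= G x)%E) ->
  (\int[mu]_x F x <= \int[mu]_x G x)%E.
Proof.
move=> F0 G0 FG; rewrite !ge0_integralTE//; apply: ge_ereal_sup => _ [h hF <-].
pose h' := mul_nnsfun h (indic_nnsfun R (measurableC mN)).
have h'E x : h' x = h x * \1_(~` N) x by [].
apply: (@le_trans _ _ (sintegral mu h')).
  rewrite -!integralT_nnsfun le_eqVlt; apply/orP; left; apply/eqP.
  apply: ge0_ae_eq_integral => //.
  - exact/measurable_EFinP.
  - exact/measurable_EFinP.
  - by move=> x _; rewrite lee_fin.
  - by move=> x _; rewrite lee_fin.
  - exists N; split => // x hx; apply: contrapT => Nx.
    by apply: hx => _; rewrite h'E indicE mem_set// mulr1.
apply: ereal_sup_ubound; exists h' => // x.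
rewrite h'E indicE; have [Nx|Nx] := pselect (N x).
  by rewrite memNset ?mulr0// => /(_ Nx).
by rewrite mem_set// mulr1 (le_trans (hF x))// FG.
Qed.

Lemma eq_integral_off_null (D : set T) F G :
    (forall x, D x -> ~ N x -> F x = G x) ->
  (\int[mu]_(x in D) F x = \int[mu]_(x in D) G x)%E.
Proof.
move=> FG; rewrite [LHS]integral_mkcond [RHS]integral_mkcond.
have FG' x : ~ N x -> (F \_ D) x = (G \_ D) x.
  by move=> Nx; rewrite !patchE; case: ifPn => // /set_mem Dx; exact: FG.
rewrite [LHS]integralE [RHS]integralE; congr (_ - _)%E; apply/eqP; rewrite eq_le.
  by apply/andP; split; apply: ge0_le_integral_off_null => // x Nx;
    rewrite !funeposE FG'.
by apply/andP; split; apply: ge0_le_integral_off_null => // x Nx;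
  rewrite !funenegE FG'.
Qed.

End IntegralOffNull.

(** * One-dimensional Haar identities *)

Section Haar1D.
Context {R : realType}.
Implicit Types (a b : R) (f : R -> R).

Definition nonint a := forall z : int, a <> z%:~R.

Definition unit_profile f :=
  [/\ measurable_fun setT f, forall a, `|f a| <= 1 &
      forall a, f a != 0 -> 0 <= a <= 1].

Lemma chi01_profile : unit_profile (chi01 : R -> R).
Proof.
split; first by apply: measurable_indic; exact: measurable_itv.
  by move=> a; rewrite /chi01 indicE; case: (_ \in _); rewrite ?normr1 ?normr0.
move=> a; rewrite /chi01 indicE mem_setE in_itv /=.
by case: (_ <= _ <= _) => //; rewrite eqxx.
Qed.

Lemma haarE a : haar a =
  (if 0 <= a < 1 / 2 then 1 else if 1 / 2 <= a < 1 then - 1 else 0).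
Proof.
rewrite /haar !indicE !mem_setE !in_itv /=.
case: (boolP (0 <= a < 1 / 2)) => h1; case: (boolP (1 / 2 <= a < 1)) => h2;
  by rewrite /= ?subr0 ?sub0r//; lra.
Qed.

Lemma haar_profile : unit_profile (haar : R -> R).
Proof.
split.
- by apply: measurable_funB; apply: measurable_indic; exact: measurable_itv.
- by move=> a; rewrite haarE; case: ifP => _; [|case: ifP => _];
    rewrite ?normrN ?normr1 ?normr0.
- move=> a; rewrite haarE; case: ifPn => [h _|_]; first by lra.
  by case: ifPn => [h _|_]; [lra|rewrite eqxx].
Qed.

Lemma floor_frac a : nonint a ->
  exists al : R, a = (Num.floor a)%:~R + al /\ 0 < al < 1.
Proof.
move=> na; exists (a - (Num.floor a)%:~R); split; first by rewrite addrC subrK.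
have /andP[h1 h2] := floor_itv a; rewrite intrD in h2.
apply/andP; split; last by lra.
by rewrite subr_gt0 lt_neqAle h1 andbT; apply/eqP => /esym/na.
Qed.

Lemma floor_eqP a (z : int) al : a = z%:~R + al -> 0 <= al < 1 ->
  Num.floor a = z.
Proof. by move=> -> h; apply: floor_def; rewrite intrD; lra. Qed.

(** Off the integers a point lies in only one integer translate of [0, 1]; at an integer two closed
    translates meet. *)
Lemma profile_supp f a (m : int) : unit_profile f -> nonint a ->
  f (a + m%:~R) != 0 -> m = - Num.floor a.
Proof.
move=> [_ _ fs] na /fs h; have [al [aE al01]] := floor_frac na.
suff : Num.floor a = - m by move=> ->; rewrite opprK.
apply: (@floor_eqP _ _ (a + m%:~R)); first by rewrite intrN; ring.
have am1 : a + m%:~R != 1.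
  by apply/eqP => am; apply: (na (1 - m)); rewrite intrB -[a](addrK m%:~R) am.
by rewrite lt_neqAle am1.
Qed.

(** The two-scale relation for projection kernels: the kernel of averaging over unit intervals plus
    the Haar kernel is the kernel of averaging over half intervals. *)
Lemma haar_floor a b : nonint a -> nonint b ->
  chi01 (a + (- Num.floor b)%:~R) = (Num.floor a == Num.floor b)%:R :> R /\
  haar (a + (- Num.floor b)%:~R) * haar (b + (- Num.floor b)%:~R)
    + (Num.floor a == Num.floor b)%:R
  = 2 * (Num.floor (2 * a) == Num.floor (2 * b))%:R :> R.
Proof.
move=> na nb; have [al [aE al01]] := floor_frac na.
have [be [bE be01]] := floor_frac nb.
move: (Num.floor a) (Num.floor b) aE bE => fa fb aE bE.
have fl2 (x : R) (z : int) (ga : R) : x = z%:~R + ga -> 0 < ga < 1 ->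
    Num.floor (2 * x) = z + z + (if 1 / 2 <= ga then 1 else 0).
  move=> -> g01; case: (leP (1 / 2) ga) => g2.
    apply: (@floor_eqP _ _ (2 * ga - 1)); last by lra.
    by rewrite !intrD mulr1z; ring.
  apply: (@floor_eqP _ _ (2 * ga)); last by lra.
  by rewrite !intrD mulr0z; ring.
rewrite (fl2 _ _ _ aE al01) (fl2 _ _ _ bE be01) intrN.
have -> : b - fb%:~R = be by rewrite bE; ring.
have al0 : 0 <= al by lra.
have be0 : 0 <= be by lra.
have al1 : al < 1 by lra.
have be1 : be < 1 by lra.
have [fab|ab] := eqVneq fa fb.
  rewrite fab in aE *; have -> : a - fb%:~R = al by rewrite aE; ring.
  split.
    by rewrite /chi01 indicE mem_setE in_itv /= al0 ltW.
  rewrite !haarE (inj_eq (addrI _)) al0 al1 be0 be1 /= !andbT.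
  by case: (leP (1 / 2) al) => _; case: (leP (1 / 2) be) => _ /=;
    rewrite ?eqxx /=; ring.
have faR : a - fb%:~R <= al - 1 \/ 1 + al <= a - fb%:~R.
  have [lt|gt|eq] := ltgtP fa fb.
  - left; rewrite aE; move: lt; rewrite -lezD1 -(ler_int R) intrD; lra.
  - right; rewrite aE; move: gt; rewrite -lezD1 -(ler_int R) intrD; lra.
  - by rewrite eq eqxx in ab.
have -> : chi01 (a - fb%:~R) = 0 :> R.
  rewrite /chi01 indicE mem_setE in_itv /=.
  rewrite (_ : (_ <= _ <= _) = false)//; apply/negP => h.
  by case: faR; lra.
have -> : haar (a - fb%:~R) = 0 :> R.
  rewrite haarE; case: ifPn => [h|_]; first by case: faR; lra.
  by case: ifPn => // h; case: faR; lra.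
split => //; rewrite mul0r add0r.
case: eqP => [|_]; last by rewrite mulr0.
by case: (1 / 2 <= al); case: (1 / 2 <= be); move/eqP: ab; lia.
Qed.

End Haar1D.

(** * The estimator as a telescoping sum of averages *)

Section HaarEstimator.
Context {R : realType}.
Variables (r : R) (N : nat) (mu : 'I_N -> {measure set (plane R) -> \bar R}).
Hypothesis r0 : 0 < r.
Implicit Types (t x : R * R) (j k L : nat) (w : R -> R -> R).

Lemma grid_nonint j t : ~ grid r j t ->
  nonint (2 ^+ j * ucoord r t) /\ nonint (2 ^+ j * vcoord r t).
Proof. by move=> g; split => z h; apply: g; [left|right]; exists z. Qed.

Lemma grid_le j L : (j <= L)%N -> grid r j `<=` grid r L.
Proof.
move=> jL; have E (z : int) : (2 ^+ (L - j) * z)%:~R = 2 ^+ (L - j) * z%:~R :> R.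
  by rewrite intrM rmorphXn.
move=> t [[z zE]|[z zE]]; [left|right]; exists (2 ^+ (L - j) * z);
  by rewrite E -zE [RHS]mulrA -exprD subnK.
Qed.

(** The dyadic square around [t], given by floors because these index the translates; off the grid
    it agrees with the open [leaf]. *)
Definition hcell j t : set (R * R) :=
  [set x | Num.floor (2 ^+ j * ucoord r x) = Num.floor (2 ^+ j * ucoord r t) /\
           Num.floor (2 ^+ j * vcoord r x) = Num.floor (2 ^+ j * vcoord r t)].

Lemma floorE (a : R) (z : int) : Num.floor a = z <-> a \in `[z%:~R, (z + 1)%:~R[.
Proof.
rewrite in_itv /=; split => [<-|]; [exact: floor_itv|exact: floor_def].
Qed.

Lemma measurable_hcell j t : measurable (hcell j t : set (plane R)).
Proof.
have -> : hcell j t =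
    [set x | 2 ^+ j * ucoord r x \in
       `[(Num.floor (2 ^+ j * ucoord r t))%:~R,
         (Num.floor (2 ^+ j * ucoord r t) + 1)%:~R[]
    `&` [set x | 2 ^+ j * vcoord r x \in
       `[(Num.floor (2 ^+ j * vcoord r t))%:~R,
         (Num.floor (2 ^+ j * vcoord r t) + 1)%:~R[].
  by apply/seteqP; split => x [/floorE h1 /floorE h2].
apply: measurableI; apply: measurable_uv_itv.
  exact: measurable_ucoord.
exact: measurable_vcoord.
Qed.

Lemma leaf_grid L k (i : leafI L k) t : leaf r i t -> ~ grid r L t.
Proof.
move=> [/= /andP[a1 a2] /andP[b1 b2]] [[z zE]|[z zE]].
  move: a1 a2; rewrite zE !(ltr_int R (Posz _)) (ltr_int R _ (Posz _)); lia.
move: b1 b2; rewrite zE !(ltr_int R (Posz _)) (ltr_int R _ (Posz _)); lia.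
Qed.

Lemma hcell_leaf L k (i : leafI L k) t x : leaf r i t -> ~ grid r L x ->
  hcell L t x <-> leaf r i x.
Proof.
move=> [/= a12 b12] gx; have [nu nv] := grid_nonint gx.
have nE (a : R) (n : nat) : n%:R < a < n.+1%:R -> Num.floor a = n%:Z.
  move=> /andP[h1 h2]; apply/floorE; rewrite in_itv /= (ltW h1) /=.
  by rewrite (_ : n%:Z + 1 = n.+1%:Z)//; lia.
have En (a : R) (n : nat) : nonint a -> Num.floor a = n%:Z -> n%:R < a < n.+1%:R.
  move=> na /floorE; rewrite in_itv /= => /andP[h1 h2].
  rewrite (_ : n%:Z + 1 = n.+1%:Z) in h2; last by lia.
  by rewrite h2 lt_neqAle h1 !andbT; apply/eqP => /esym /(na n%:Z).
rewrite /hcell /= (nE _ _ a12) (nE _ _ b12); split.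
  by move=> [/(En _ _ nu) h1 /(En _ _ nv) h2]; split.
by move=> [/= h1 h2]; split; apply: nE.
Qed.

Definition tensor w := exists f g : R -> R,
  [/\ unit_profile f, unit_profile g & w = fun a b => f a * g b].

Lemma phi_tensor : tensor phi_mother.
Proof. by exists chi01, chi01; split => //; exact: chi01_profile. Qed.

Lemma psi_tensor w : List.In w psi_mothers -> tensor w.
Proof.
have c := @chi01_profile R; have h := @haar_profile R.
by move=> [<-|[<-|[<-|//]]]; [exists haar, chi01|exists chi01, haar|exists haar, haar].
Qed.

(** The index of the one translate that can be nonzero at [t]; the signs arise because [dilate] adds
    its index. *)
Definition cidx j t : int * int :=
  (- Num.floor (2 ^+ j * ucoord r t), - Num.floor (2 ^+ j * vcoord r t)).

Lemma dilate_supp w j l t : tensor w -> ~ grid r j t ->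
  dilate r w j l t != 0 -> l = cidx j t.
Proof.
move=> [f [g [pf pg ->]]] /grid_nonint[nu nv]; rewrite /dilate !mulf_eq0 !negb_or.
move=> /andP[_ /andP[/(profile_supp pf nu) h1 /(profile_supp pg nv) h2]].
by case: l h1 h2 => l1 l2 /= -> ->.
Qed.

Lemma measurable_dilate w j l : tensor w ->
  measurable_fun setT (dilate r w j l : plane R -> R).
Proof.
move=> [f [g [[mf _ _] [mg _ _] ->]]]; apply: measurable_funM => //.
apply: measurable_funM.
  apply: (measurableT_comp mf); apply: measurable_funD => //.
  by apply: measurable_funM => //; exact: measurable_ucoord.
apply: (measurableT_comp mg); apply: measurable_funD => //.
by apply: measurable_funM => //; exact: measurable_vcoord.
Qed.

Lemma dilate_bound w j l t : tensor w -> `|dilate r w j l t| <= r^-1 * 2 ^+ j.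
Proof.
move=> [f [g [[_ f1 _] [_ g1 _] ->]]]; rewrite /dilate normrM.
have c0 : 0 <= r^-1 * 2 ^+ j by rewrite mulr_ge0 ?exprn_ge0// invr_ge0 ltW.
rewrite (ger0_norm c0) ler_piMr// normrM -[leRHS]mulr1.
by apply: ler_pM.
Qed.

Lemma haar_layerE w j t : tensor w -> ~ grid r j t ->
  haar_layer r mu w j t =
  emp_coef r mu (dilate r w j (cidx j t)) * dilate r w j (cidx j t) t.
Proof.
move=> tw gt; rewrite /haar_layer -(@fsbig_widen _ _ _ _ [set cidx j t])//.
  by rewrite fsbig_set1.
move=> l [_ /= lt]; apply/eqP; rewrite mulf_eq0; apply/orP; right.
by apply: contrapT => /negP h; apply: lt; exact: dilate_supp h.
Qed.

Lemma emp_coef_restrict L (D : set (R * R)) (g : R * R -> R) :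
    (forall i, mu i (grid r L) = 0%E) -> D `<=` OmegaR r ->
    (forall x, OmegaR r x -> ~ D x -> ~ grid r L x -> g x = 0) ->
  emp_coef r mu g = N%:R^-1 * \sum_(i < N) \int[mu i]_(x in D) g x.
Proof.
move=> mug DO gD; rewrite /emp_coef; congr (_ * _); apply: eq_bigr => i _.
rewrite /Rintegral; congr fine; rewrite integral_mkcond [RHS]integral_mkcond.
apply: (eq_integral_off_null (@measurable_grid R r L) (mug i)) => x _ xg.
rewrite !patchE; case: ifPn => [/set_mem Ox|/negP Ox]; case: ifPn => // h.
  by rewrite gD// => Dx; move/negP: h; apply; rewrite mem_set.
by exfalso; apply: Ox; rewrite mem_set//; apply: DO; exact: set_mem h.
Qed.

(** This is the kernel of the orthogonal projection on level j: integrated against a measure in [x],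
    it gives the mass of the square of [t] divided by its area. *)
Lemma phi_prod j t x : ~ grid r j t -> ~ grid r j x ->
  dilate r phi_mother j (cidx j t) x * dilate r phi_mother j (cidx j t) t
  = (r^-1 * 2 ^+ j) ^+ 2 * \1_(hcell j t) x.
Proof.
move=> /grid_nonint[nut nvt] /grid_nonint[nux nvx].
rewrite /dilate /phi_mother /cidx /= !(haar_floor _ _).1//.
rewrite !eqxx mulr1 indicE.
have -> : (x \in hcell j t) =
  (Num.floor (2 ^+ j * ucoord r x) == Num.floor (2 ^+ j * ucoord r t)) &&
  (Num.floor (2 ^+ j * vcoord r x) == Num.floor (2 ^+ j * vcoord r t)).
  apply/idP/andP => [/set_mem[-> ->]//|[/eqP h1 /eqP h2]].
  by rewrite mem_set.
by case: (_ == _); case: (_ == _) => /=; ring.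
Qed.

Let double (a : R) j : 2 ^+ j.+1 * a = 2 * (2 ^+ j * a).
Proof. by rewrite exprS mulrA. Qed.

(** If two points shared a half interval but no unit interval, [haar_floor] would make a product of
    two Haar values equal to 2, although each is at most 1 in absolute value. *)
Lemma hcell_sub j t x : ~ grid r j t -> ~ grid r j x ->
  hcell j.+1 t x -> hcell j t x.
Proof.
move=> /grid_nonint[nut nvt] /grid_nonint[nux nvx] [h1 h2].
have [_ hb _] := @haar_profile R.
suff H (a b : R) : nonint a -> nonint b -> Num.floor (2 * a) = Num.floor (2 * b) ->
    Num.floor a = Num.floor b.
  by split; apply: H => //; rewrite -!double.
move=> na nb ab; have [_] := haar_floor na nb; rewrite ab eqxx mulr1.
case: eqP => // _; rewrite addr0 => h.
have : `|2 : R| <= 1 * 1 by rewrite -h normrM ler_pM.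
by rewrite ger0_norm// mulr1 (ler_nat R 2 1).
Qed.

(** By [haar_floor], [4 * \1_(hcell j.+1 t) x] is a product of two factors, each a Haar product plus
    an indicator. Expanding it and removing the product of the indicators leaves exactly the three
    wavelets. *)
Lemma psi_prod j t x : ~ grid r j t -> ~ grid r j x ->
  \sum_(w <- psi_mothers)
    dilate r w j (cidx j t) x * dilate r w j (cidx j t) t
  = (r^-1 * 2 ^+ j) ^+ 2 * (4 * \1_(hcell j.+1 t) x - \1_(hcell j t) x).
Proof.
move=> /grid_nonint[nut nvt] /grid_nonint[nux nvx].
rewrite /psi_mothers !big_cons big_nil addr0 /dilate /cidx /=.
have [ex ux] := haar_floor nux nut; have [ey vx] := haar_floor nvx nvt.
have [ex' _] := haar_floor nut nut; have [ey' _] := haar_floor nvt nvt.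
rewrite ex ey ex' ey' !eqxx.
have iE m : \1_(hcell m t) x =
  (Num.floor (2 ^+ m * ucoord r x) == Num.floor (2 ^+ m * ucoord r t))%:R *
  (Num.floor (2 ^+ m * vcoord r x) == Num.floor (2 ^+ m * vcoord r t))%:R :> R.
  rewrite indicE; have -> : (x \in hcell m t) =
    (Num.floor (2 ^+ m * ucoord r x) == Num.floor (2 ^+ m * ucoord r t)) &&
    (Num.floor (2 ^+ m * vcoord r x) == Num.floor (2 ^+ m * vcoord r t)).
    apply/idP/andP => [/set_mem[-> ->]//|[/eqP h1 /eqP h2]].
    by rewrite mem_set.
  by case: (_ == _); case: (_ == _) => /=; rewrite ?mulr1 ?mulr0.
rewrite !iE !double.
set e1 := (_ == _)%:R in ux *; set e2 := (_ == _)%:R in vx *.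
move: ux vx; set s1 := (_ == _)%:R; set s2 := (_ == _)%:R.
set hx := haar _; set ht := haar _; set kx := haar _; set kt := haar _.
move=> ux vx; set c := r^-1 * 2 ^+ j.
have -> : 4 * (s1 * s2) = (2 * s1) * (2 * s2) by ring.
by rewrite -ux -vx (_ : true%:R = 1 :> R)//; ring.
Qed.

Variables (L k : nat).
Hypothesis kL : (k < L)%N.
Hypothesis mu_grid : forall i, mu i (grid r L) = 0%E.
Hypothesis mu_strip : forall i, (mu i (strip r k) < +oo)%E.

(* The part of the level-j cell of t on which the Haar functions are constant. *)
Definition gcell j t : set (R * R) := (OmegaR r `&` hcell j t) `\` grid r L.

Lemma measurable_gcell j t : measurable (gcell j t : set (plane R)).
Proof.
apply: measurableD; last exact: measurable_grid.
by apply: measurableI; [exact: measurable_OmegaR|exact: measurable_hcell].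
Qed.

(** Squares of level j > k do not cross the boundary of strip k. Hence every coefficient actually
    used integrates over a set of finite mass, even if [mu i] is infinite near the diagonal. *)
Lemma gcell_sub_strip j t : (k < j <= L)%N -> strip r k t -> ~ grid r L t ->
  gcell j t `<=` strip r k.
Proof.
move=> /andP[kj jL] St gt x [[Ox hx] gx].
have gjt : ~ grid r j t by move=> /(grid_le jL).
have gjx : ~ grid r j x by move=> /(grid_le jL).
have [i ti] := strip_leaf r0 kj St gjt.
exact: (leaf_sub_strip r0 kj ((hcell_leaf ti gjx).1 hx)).
Qed.

Lemma gcell_succ j t : (j < L)%N -> ~ grid r L t ->
  gcell j t `&` hcell j.+1 t = gcell j.+1 t.
Proof.
move=> jL gt; apply/seteqP; split => x [].
  by move=> [[Ox hx] gx] hx1.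
move=> [Ox hx] gx; split => //; split => //; split => //.
apply: hcell_sub => // [/(grid_le (ltnW jL))//|/(grid_le (ltnW jL))//].
Qed.

Lemma gcell_leaf (i : leafI L k) t : leaf r i t -> gcell L t = leaf r i.
Proof.
move=> ti; apply/seteqP; split => x.
  by move=> [[Ox hx] gx]; apply/(hcell_leaf ti gx).
move=> xi; have gx := leaf_grid xi; split => //; split.
  by have [] := leaf_sub_strip r0 kL xi.
exact/(hcell_leaf ti gx).
Qed.

Definition gmean j t : R := N%:R^-1 * \sum_(i < N) fine (mu i (gcell j t)).

Lemma haar_layer_gcell w j t : (j <= L)%N -> tensor w -> ~ grid r L t ->
  haar_layer r mu w j t = N%:R^-1 * \sum_(i < N)
    (\int[mu i]_(x in gcell j t) dilate r w j (cidx j t) x)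
      * dilate r w j (cidx j t) t.
Proof.
move=> jL tw gt; have gjt : ~ grid r j t by move=> /(grid_le jL).
rewrite haar_layerE// (@emp_coef_restrict L (gcell j t))//.
- by rewrite -mulrA mulr_suml.
- by move=> x [[]].
- move=> x Ox Dx gx; apply: contrapT => /eqP h; apply: Dx; split => //.
  split => //; have gjx : ~ grid r j x by move=> /(grid_le jL).
  have := dilate_supp tw gjx h; rewrite /cidx => -[/oppr_inj h1 /oppr_inj h2].
  by split.
Qed.

Lemma integrable_dilate w j t i : (k < j <= L)%N -> tensor w ->
    strip r k t -> ~ grid r L t ->
  (mu i).-integrable (gcell j t) (EFin \o dilate r w j (cidx j t)).
Proof.
move=> kjL tw St gt; apply: measurable_bounded_integrable.
- exact: measurable_gcell.
- apply: le_lt_trans (mu_strip i); apply: le_measure; rewrite ?inE.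
  + exact: measurable_gcell.
  + exact: measurable_strip.
  + exact: gcell_sub_strip.
- by apply: measurable_funTS; exact: measurable_dilate.
- exists (r^-1 * 2 ^+ j); split; first by rewrite num_real.
  by move=> M hM x _ /=; rewrite (le_trans (dilate_bound _ _ _ tw))// ltW.
Qed.

Lemma gcell_fin j t i : (k < j <= L)%N -> strip r k t -> ~ grid r L t ->
  (mu i (gcell j t) < +oo)%E.
Proof.
move=> kjL St gt; apply: le_lt_trans (mu_strip i); apply: le_measure; rewrite ?inE.
- exact: measurable_gcell.
- exact: measurable_strip.
- exact: gcell_sub_strip.
Qed.

Lemma Rintegral_gcell_indic j j' t i (a b : R) : (k < j <= L)%N ->
    strip r k t -> ~ grid r L t ->
  \int[mu i]_(x in gcell j t) (a * \1_(hcell j' t) x + b)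
  = a * fine (mu i (gcell j t `&` hcell j' t)) + b * fine (mu i (gcell j t)).
Proof.
move=> kjL St gt; have mg := @measurable_gcell j t.
have mh := @measurable_hcell j' t.
have fin := gcell_fin i kjL St gt.
have bnd (f : R * R -> R) (c : R) : measurable_fun setT (f : plane R -> R) ->
    (forall x, `|f x| <= c) -> (mu i).-integrable (gcell j t) (EFin \o f).
  move=> mf fc; apply: measurable_bounded_integrable => //.
    exact: measurable_funTS.
  exists c; split; first by rewrite num_real.
  by move=> M hM x _ /=; rewrite (le_trans (fc x))// ltW.
have i1 : (mu i).-integrable (gcell j t) (EFin \o (\1_(hcell j' t) : R * R -> R)).
  apply: (bnd _ 1); first exact: measurable_indic.
  by move=> x; rewrite indicE; case: (_ \in _); rewrite ?normr1 ?normr0.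
rewrite RintegralD//.
- rewrite RintegralZl// Rintegral_cst//; congr (_ * _ + _).
  by rewrite /Rintegral integral_indic// setIC.
- exact: (integrableZl mg a i1).
- by apply: (bnd (fun=> b) `|b|).
Qed.

Lemma phi_layer j t : (k < j <= L)%N -> strip r k t -> ~ grid r L t ->
  haar_layer r mu phi_mother j t = (r^-1 * 2 ^+ j) ^+ 2 * gmean j t.
Proof.
move=> kjL St gt; have /andP[kj jL] := kjL.
have gjt : ~ grid r j t by move=> /(grid_le jL).
rewrite haar_layer_gcell//; last exact: phi_tensor.
rewrite /gmean mulrCA; congr (_ * _); rewrite mulr_sumr; apply: eq_bigr => i _.
rewrite -RintegralZr; last 2 first.
- exact: measurable_gcell.
- by apply: integrable_dilate => //; exact: phi_tensor.
transitivity (\int[mu i]_(x in gcell j t)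
    (0 * \1_(hcell j t) x + (r^-1 * 2 ^+ j) ^+ 2)).
  apply: eq_Rintegral => x /set_mem [[Ox hx] gx]; rewrite phi_prod//.
    by rewrite indicE mem_set// mulr1 mul0r add0r.
  by move=> /(grid_le jL).
by rewrite Rintegral_gcell_indic// mul0r add0r.
Qed.

(** Integrating the kernel identity of [psi_prod] turns the wavelets of level j into the increment
    of the average density from level j to level j + 1. *)
Lemma psi_layers j t : (k < j < L)%N -> strip r k t -> ~ grid r L t ->
  \sum_(w <- psi_mothers) haar_layer r mu w j t
  = (r^-1 * 2 ^+ j.+1) ^+ 2 * gmean j.+1 t - (r^-1 * 2 ^+ j) ^+ 2 * gmean j t.
Proof.
move=> /andP[kj jL] St gt; have jL' := ltnW jL.
have kjL : (k < j <= L)%N by rewrite kj.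
have gjt : ~ grid r j t by move=> /(grid_le jL').
have E : \sum_(w <- psi_mothers) haar_layer r mu w j t
  = N%:R^-1 * \sum_(i < N) \int[mu i]_(x in gcell j t)
    \sum_(w <- psi_mothers)
      dilate r w j (cidx j t) x * dilate r w j (cidx j t) t.
  have tw := @psi_tensor; rewrite /psi_mothers !big_cons big_nil !addr0.
  rewrite !haar_layer_gcell//;
    try by apply: tw => /=; auto.
  rewrite -!mulrDr -!big_split /=; congr (_ * _); apply: eq_bigr => i _.
  have iw w : List.In w psi_mothers -> (mu i).-integrable (gcell j t)
      (EFin \o (fun x => dilate r w j (cidx j t) x * dilate r w j (cidx j t) t)).
    move=> /tw tww; exact: (integrableZr (measurable_gcell j t)
      (dilate r w j (cidx j t) t) (integrable_dilate i kjL tww St gt)).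
  have iw' w : List.In w psi_mothers -> (mu i).-integrable (gcell j t)
      (EFin \o (dilate r w j (cidx j t))).
    by move=> /tw tww; exact: integrable_dilate.
  have mg := @measurable_gcell j t.
  rewrite -!RintegralZr//; try by apply: iw' => /=; auto.
  rewrite -RintegralD//; try by apply: iw => /=; auto.
  rewrite -RintegralD//; try by apply: iw => /=; auto.
    apply: eq_Rintegral => x _; rewrite !big_cons big_nil addr0; ring.
  exact: (integrableD mg (iw _ (or_intror (or_introl erefl)))
    (iw _ (or_intror (or_intror (or_introl erefl))))).
rewrite E {E} /gmean ![_ * (N%:R^-1 * _)]mulrCA -mulrBr; congr (_ * _).
rewrite !mulr_sumr -sumrB; apply: eq_bigr => i _.
set c := (r^-1 * 2 ^+ j) ^+ 2.
transitivity (\int[mu i]_(x in gcell j t) (4 * c * \1_(hcell j.+1 t) x + - c)).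
  apply: eq_Rintegral => x /set_mem [[Ox hx] gx]; rewrite psi_prod//.
    have -> : \1_(hcell j t) x = 1 :> R by rewrite indicE mem_set.
    by rewrite -/c; ring.
  by move=> /(grid_le jL').
rewrite Rintegral_gcell_indic// gcell_succ// /c [2 ^+ j.+1]exprS; ring.
Qed.

Lemma strip_inj k1 k2 t : strip r k1 t -> strip r k2 t -> k1 = k2.
Proof.
move=> /(strip_uvcoord _ _ r0)[_ /andP[v1 v2]].
move=> /(strip_uvcoord _ _ r0)[_ /andP[v1' v2']].
have lt (a b : nat) : (a < b)%N -> (2 ^+ b)^-1 <= (2 ^+ a.+1)^-1 :> R.
  by move=> ab; rewrite lef_pV2 ?posrE ?exprn_gt0// ler_eXn2l ?ltr1n.
apply/eqP; rewrite eqn_leq (leqNgt k1) (leqNgt k2); apply/andP; split; apply/negP => /lt h.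
  by have := lt_le_trans v1' (le_trans v2 h); rewrite ltxx.
by have := lt_le_trans v1 (le_trans v2' h); rewrite ltxx.
Qed.

Lemma f_hat_leaf (J K : nat) (i : leafI L k) t : L = (J + K).+1 -> (k <= K)%N ->
    leaf r i t ->
  f_hat r mu J K t
  = N%:R^-1 * (\sum_(n < N) fine (mu n (leaf r i))) / (r ^+ 2 / 4 ^+ L).
Proof.
move=> LE kK ti; have St := leaf_sub_strip r0 kL ti; have gt := leaf_grid ti.
have kK1 : (k < K.+1)%N by [].
rewrite /f_hat (bigD1 (Ordinal kK1))//= [X in _ + X]big1 ?addr0; last first.
  move=> k' k'k; rewrite indicE memNset ?mul0r// => St'.
  by move/eqP: k'k; apply; apply: val_inj; exact: strip_inj St' St.
rewrite indicE mem_set// mul1r -LE phi_layer ?ltnSn//.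
under eq_big_nat => j /andP[kj jL] do rewrite psi_layers ?kj//.
rewrite telescope_sumr// addrC subrK /gmean (gcell_leaf ti).
have -> : (4 : R) = 2 * 2 by ring.
rewrite invf_div [LHS]mulrC; congr (_ * _).
by rewrite [in RHS]exprMn -exprVn; ring.
Qed.

End HaarEstimator.

Lemma ae_mono d (T : semiRingOfSetsType d) (R : realFieldType)
    (mu : set T -> \bar R) (A B : T -> Prop) :
  (forall x, A x -> B x) -> {ae mu, forall x, A x} -> {ae mu, forall x, B x}.
Proof.
move=> AB [N [mN N0 AN]]; exists N; split => // x /= Bx; apply: AN => /= Ax.
exact/Bx/AB.
Qed.

Section EstimatorMeasure.
Context {R : realType}.
Variables (r : R) (N J K : nat).
Variable mu : 'I_N -> {measure set (plane R) -> \bar R}.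
Hypothesis r0 : 0 < r.
Let L := (J + K).+1.
Hypothesis mu_grid : forall i, mu i (grid r L) = 0%E.
Hypothesis mu_strip : forall i k, (mu i (strip r k) < +oo)%E.

Definition leaf_mean k (i : leafI L k) : R :=
  N%:R^-1 * (\sum_(n < N) fine (mu n (leaf r i))).

Lemma mu_hatE (A : set (plane R)) : measurable A ->
  mu_hat r mu J K A = (\sum_(k < K.+1) \sum_(i : leafI L k)
    (leaf_mean i / (r ^+ 2 / 4 ^+ L))%:E * lebesgue2 (A `&` leaf r i))%E.
Proof.
move=> mA; pose c k (i : leafI L k) := leaf_mean i / (r ^+ 2 / 4 ^+ L).
have c0 k i : 0 <= @c k i.
  apply: divr_ge0; last by rewrite divr_ge0 ?exprn_ge0// ltW.
  by rewrite /leaf_mean mulr_ge0 ?invr_ge0 ?sumr_ge0// => n _; exact: fine_ge0.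
pose g (t : R * R) : R := \sum_(k < K.+1) \sum_(i : leafI L k) c k i * \1_(leaf r i) t.
have mg k (i : leafI L k) :
    measurable_fun A (fun t : plane R => (c k i * \1_(leaf r i) t)%:E).
  apply/measurable_EFinP; apply: measurable_funTS; apply: measurable_funM => //.
  by apply: measurable_indic; exact: measurable_leaf.
have ge0 k (i : leafI L k) t : (0 <= (c k i * \1_(leaf r i) t)%:E)%E.
  by rewrite lee_fin mulr_ge0// indicE.
transitivity (\int[lebesgue2]_(t in A) (g t)%:E)%E.
  (* Off the Lebesgue-null grid a point lies in exactly one leaf or in none of the strips up to [K],
     so both densities can be read off. *)
  rewrite /mu_hat; apply: (eq_integral_off_null (measurable_grid r L)).
    exact: lebesgue2_grid.
  move=> t _ gt; congr EFin; rewrite /g.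
  have [[k [kK St]]|nS] := pselect (exists k, (k < K.+1)%N /\ strip r k t).
    have kL : (k < L)%N by rewrite /L; lia.
    have [i ti] := strip_leaf r0 kL St gt.
    rewrite (f_hat_leaf r0 kL mu_grid (fun n => mu_strip n k) _ _ ti)//.
    rewrite (bigD1 (Ordinal kK))//= [X in _ + X]big1 ?addr0; last first.
      move=> k' k'k; apply: big1 => i' _.
      rewrite indicE memNset ?mulr0// => ti'; move/eqP: k'k; apply; apply: val_inj.
      have k'L : (k' < L)%N by rewrite /L; have := ltn_ord k'; lia.
      exact: strip_inj (leaf_sub_strip r0 k'L ti') St.
    rewrite (bigD1 i)//= [X in _ + X]big1 ?addr0; last first.
      move=> i' i'i; rewrite indicE memNset ?mulr0// => ti'; move/eqP: i'i; apply.
      by apply: (@trivIset_leaf _ r L k) => //; exists t.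
    by rewrite indicE mem_set// mulr1.
  have nS' (k : 'I_K.+1) : ~ strip r k t by move=> h; apply: nS; exists k.
  rewrite /f_hat big1 ?big1//.
    move=> k _; apply: big1 => i _; rewrite indicE memNset ?mulr0// => ti.
    have kL : (k < L)%N by rewrite /L; have := ltn_ord k; lia.
    by apply: (nS' k); exact: leaf_sub_strip ti.
  by move=> k _; rewrite indicE memNset ?mul0r//; exact: nS'.
rewrite /g; under eq_integral do rewrite -sumEFin.
rewrite ge0_integral_sum//; last 2 first.
- move=> k; under eq_fun do rewrite -sumEFin; exact: emeasurable_sum.
- by move=> k t _; rewrite -sumEFin; apply: sume_ge0.
apply: eq_bigr => k _; under eq_integral do rewrite -sumEFin.
rewrite ge0_integral_sum//; apply: eq_bigr => i _.
under eq_integral do rewrite EFinM.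
rewrite ge0_integralZl//.
- by rewrite integral_indic//; [rewrite setIC|exact: measurable_leaf].
- apply/measurable_EFinP; apply: measurable_indic; exact: measurable_leaf.
- by rewrite lee_fin.
Qed.

End EstimatorMeasure.

(** * The expected diagram as a measure *)

Section ExpectedMeasure.
Context {R : realType}.
Variable P : probability (measT R) R.

Lemma measurable_eval (A : set (plane R)) : measurable A ->
  measurable_fun setT (fun m : measT R => (m : meas R) A).
Proof.
move=> mA _ B mB; rewrite setTI; apply: sub_sigma_algebra.
by exists A => //; exists B => //; rewrite setTI.
Qed.

Let epd0 : EPD P set0 = 0%E.
Proof. by rewrite /EPD; apply: integral0_eq => m _; rewrite measure0. Qed.

Let epd_ge0 A : (0 <= EPD P A)%E.
Proof. by apply: integral_ge0 => m _; exact: measure_ge0. Qed.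

Let epd_sigma : semi_sigma_additive (EPD P : set (plane R) -> \bar R).
Proof.
move=> F mF tF mUF; rewrite [X in _ --> X](_ : _ =
    (\int[P]_m (\sum_(0 <= k <oo) (m : meas R) (F k)))%E); last first.
  apply: eq_integral => m _.
  by apply/esym/cvg_lim => //; exact: measure_sigma_additive.
rewrite integral_nneseries//; last by move=> n; exact: measurable_eval.
by apply: is_cvg_nneseries => n _ _; exact: epd_ge0.
Qed.

HB.instance Definition _ :=
  isMeasure.Build _ _ _ (EPD P : set (plane R) -> \bar R) epd0 epd_ge0 epd_sigma.

End ExpectedMeasure.

(** * Mass of a strip and null sets *)

Section StripMass.
Context {R : realType}.
Variables (q : \bar R) (s M r C : R) (P : probability (measT R) R).
Variable f : R * R -> R.
Hypotheses (q1 : (1 <= q)%E) (s0 : 0 <= s) (M0 : 0 < M) (r0 : 0 < r) (C0 : 0 < C).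
Hypothesis PM : {ae P, forall m : measT R, M_sRM q s r M m}.
Hypothesis Pf : is_lebesgue_density (EPD P) f.
Hypothesis fC : forall k : nat, (Linfty_norm (strip r k) f
       <= (C ^+ 2 * M * r `^ (- s) * 2 `^ (k%:R * s))%:E)%E.

(** The common scale of two bounds on strip k: the mass of one diagram up to the factor [4 ^ s], and
    the density of the expected diagram up to [C ^ 2]. *)
Definition strip_scale k : R := M * r `^ (- s) * 2 `^ (k%:R * s).

Lemma strip_scale_gt0 k : 0 < strip_scale k.
Proof. by rewrite !mulr_gt0// powR_gt0. Qed.

(** Markov's inequality: on the strip the distance to the diagonal is at least [r / 2^(k+2)]. One
    factor 2 comes from the lower edge of the strip, the other from [lnorm_sub_perp_ge]; together
    they give [4 ^ s]. *)
Lemma M_sRM_strip (m : meas R) k : M_sRM q s r M m ->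
  (m (strip r k) <= (4 `^ s * strip_scale k)%:E)%E.
Proof.
move=> [_ _ mM]; pose c := (r / 2 ^+ k.+2) `^ s.
have k0 : (0 : R) < 2 ^+ k.+2 by rewrite exprn_gt0.
have c0 : 0 < c by rewrite powR_gt0// divr_gt0.
have -> : 4 `^ s * strip_scale k = c^-1 * M.
  have -> : 4 `^ s = 2 `^ (2 * s) :> R.
    by rewrite powRrM (powR_mulrn 2)//; congr (_ `^ _); ring.
  rewrite /c powRM ?invr_ge0 ?ltW// invfM -powRN.
  have -> : ((2 ^+ k.+2)^-1 `^ s)^-1 = 2 `^ (k.+2%:R * s) :> R.
    have E : (2 ^+ k.+2)^-1 `^ s * 2 `^ (k.+2%:R * s) = 1 :> R.
      rewrite powRrM powR_mulrn// -powRM ?invr_ge0 ?(ltW k0)//.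
      by rewrite mulVf ?gt_eqF// powR1.
    have h0 : (2 ^+ k.+2)^-1 `^ s != 0 :> R.
      by rewrite gt_eqF// powR_gt0// invr_gt0.
    by apply: (mulfI h0); rewrite E divff.
  rewrite (_ : k.+2%:R = 2 + k%:R) ?mulrDl ?powRD ?pnatr_eq0 ?implybT//.
    by rewrite /strip_scale; ring.
  by rewrite -[k.+2]/(2 + k)%N natrD.
rewrite EFinM lee_pdivlMl//; apply: le_trans mM.
have mS := measurable_strip k r0.
rewrite -(integral_cst m mS) /Pers integral_mkcond [leRHS]integral_mkcond.
apply: (ge0_le_integral_off_null (@measurable0 _ _) (measure0 _)) => t.
- by rewrite patchE; case: ifP => _ //=; rewrite lee_fin ltW.
- by rewrite patchE; case: ifP => _ //=; rewrite lee_fin powR_ge0.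
move=> _; rewrite !patchE; case: ifPn => [/set_mem St|_]; last first.
  by case: ifP => _ //=; rewrite lee_fin powR_ge0.
rewrite mem_set; last exact: strip_sub_Omega St.
have [_ /andP[v1 _]] := (strip_uvcoord k t r0).1 St.
have v0 : 0 <= vcoord r t.
  by apply: ltW; apply: lt_trans v1; rewrite invr_gt0 exprn_gt0.
rewrite lee_fin /c; apply: ge0_ler_powR => //; rewrite ?nnegrE.
- by rewrite divr_ge0 ?ltW.
- by apply: le_trans (lnorm_sub_perp_ge q1 r0 v0); rewrite divr_ge0// mulr_ge0// ltW.
apply: le_trans (lnorm_sub_perp_ge q1 r0 v0).
rewrite [2 ^+ k.+2]exprSr invfM mulrA ler_pM2r ?invr_gt0// ler_pM2l//.
exact: ltW.
Qed.

Lemma EPD_outside : EPD P (~` (Omega `&` OmegaR r)) = 0%E.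
Proof.
have mO := @measurable_Omega R; have mOR := measurable_OmegaR r0.
rewrite /EPD.
transitivity (\int[P]_m (cst 0%E m : \bar R))%E; last by rewrite integral_cst// mul0e.
apply: ae_eq_integral => //.
  by apply: measurable_eval; apply: measurableC; exact: measurableI.
apply: ae_mono PM => m [[m1 _ _] m2 _] _ /=.
rewrite setCI; apply/eqP; rewrite eq_le measure_ge0 andbT.
have -> : m (~` Omega `|` ~` OmegaR r) = m (~` Omega).
  by apply: measureU0 => //; exact: measurableC.
by rewrite m1.
Qed.

(** The density controls only subsets of [Omega]; the rest of [A] is null by the support condition
    on [P]. *)
Lemma EPD_null (A : set (plane R)) : measurable A -> lebesgue2 A = 0%E ->
  EPD P A = 0%E.
Proof.
move=> mA A0; have mO := @measurable_Omega R; have mOR := measurable_OmegaR r0.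
have mAO : measurable (A `&` Omega) by exact: measurableI.
have [mf fE] := Pf.
have AO0 : EPD P (A `&` Omega) = 0%E.
  rewrite fE//.
  apply: null_set_integral => //.
    by apply/measurable_EFinP; apply: measurable_funS mf => // x [].
  apply/eqP; rewrite eq_le measure_ge0 andbT -A0.
  by apply: le_measure; rewrite ?inE// => x [].
apply/eqP; rewrite eq_le measure_ge0 andbT.
have mC : measurable (~` (Omega `&` OmegaR r) : set (plane R)).
  by apply: measurableC; exact: measurableI.
rewrite -[leRHS]AO0 -[leRHS](measureU0 (mu := EPD P) mAO mC EPD_outside).
apply: le_measure; rewrite ?inE//; first exact: measurableU.
move=> x Ax; have [Ox|Ox] := pselect (Omega x); first by left.
by right => -[].
Qed.

(** A nonnegative variable of mean zero vanishes almost surely. Applied to the grid, it lets all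
    samples avoid the edges of the leaves. *)
Lemma ae_eval0 (A : set (plane R)) : measurable A -> EPD P A = 0%E ->
  {ae P, forall m : measT R, (m : meas R) A = 0%E}.
Proof.
move=> mA A0; have := (ae_eq_integral_abs P measurableT (measurable_eval mA)).1.
have -> : (\int[P]_x `|(x : meas R) A|)%E = 0%E.
  by rewrite -A0; apply: eq_integral => m _; rewrite gee0_abs.
by move=> /(_ erefl); apply: ae_mono => m /(_ I).
Qed.

Lemma EPD_strip_le k : (EPD P (strip r k) <= (4 `^ s * strip_scale k)%:E)%E.
Proof.
have b0 : 0 <= 4 `^ s * strip_scale k.
  by rewrite mulr_ge0 ?powR_ge0// ltW// strip_scale_gt0.
have mS := measurable_strip k r0.
rewrite /EPD -[leRHS]mule1 -(probability_setT P) -(integral_cst P measurableT).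
apply: ae_ge0_le_integral => //.
- exact: measurable_eval.
- by apply: ae_mono PM => m Mm _; exact: M_sRM_strip.
Qed.

Lemma EPD_strip_density_le k :
  (EPD P (strip r k) <= (C ^+ 2 * strip_scale k * (r ^+ 2 / 2 ^+ k))%:E)%E.
Proof.
have [mf fE] := Pf; have mS := measurable_strip k r0.
have SO := strip_sub_Omega (k := k) r0.
have b0 : 0 <= C ^+ 2 * strip_scale k.
  by rewrite mulr_ge0 ?exprn_ge0 ?ltW// strip_scale_gt0.
have mfS : measurable_fun (strip r k : set (plane R)) (EFin \o f).
  by apply/measurable_EFinP; apply: measurable_funS mf => //; exact: measurable_Omega.
rewrite fE// -[leLHS]gee0_abs; last by rewrite -fE//; exact: measure_ge0.
apply: le_trans (le_abse_integral _ mS mfS) _.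
apply: (@le_trans _ _ ((C ^+ 2 * strip_scale k)%:E * lebesgue2 (strip r k))%E).
  apply: integral_le_bound => //.
  have := fC k; rewrite /Linfty_norm Lnorm.unlock.
  (* The norm with exponent infinity is an essential supremum only if the whole space has positive
     measure; one cell witnesses this. *)
  have -> : (0 < lebesgue2 [set: plane R])%E.
    apply: (@lt_le_trans _ _ (lebesgue2 (cell r 0 0 0))).
      by rewrite lebesgue2_cell// lte_fin divr_gt0// exprn_gt0.
    by apply: le_measure; rewrite ?inE//; exact: measurable_cell.
  move=> /ess_supP; apply: ae_mono => x /= + Sx.
  by rewrite patchE mem_set// /strip_scale !mulrA.
rewrite [leRHS]EFinM; apply: lee_wpmul2l; rewrite ?lee_fin//.
exact: lebesgue2_strip_le.
Qed.

End StripMass.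

(** * Transport in a strip *)

(** At [h = L - k.+1] one row is left: the blocks are then as high as the strip. Truncated
    subtraction keeps a single row beyond that level. *)
Definition blockI L k h : finType := ('I_(2 ^ (L - h)) * 'I_(2 ^ (L - k.+1 - h)))%type.

Lemma divn_expB (a n h : nat) : (a < 2 ^ n)%N -> (a %/ 2 ^ h < 2 ^ (n - h))%N.
Proof.
move=> an; rewrite ltn_divLR ?expn_gt0// -expnD.
by rewrite (leq_trans an)// leq_exp2l//; lia.
Qed.

(* The block of side 2^(h - L) containing a leaf. *)
Definition block L k h (i : leafI L k) : blockI L k h :=
  (Ordinal (divn_expB h (ltn_ord i.1)), Ordinal (divn_expB h (ltn_ord i.2))).

Lemma divn2_expB (a n h : nat) : (a < 2 ^ (n - h))%N -> (a %/ 2 < 2 ^ (n - h.+1))%N.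
Proof. by move=> /(divn_expB 1); rewrite expn1 -subnDA addn1. Qed.

Definition parent_block L k h (b : blockI L k h) : blockI L k h.+1 :=
  (Ordinal (divn2_expB (ltn_ord b.1)), Ordinal (divn2_expB (ltn_ord b.2))).

Lemma block_succ L k h (i : leafI L k) : block h.+1 i = parent_block (block h i).
Proof.
by congr pair; apply: val_inj; rewrite /= -divnMA -expnSr.
Qed.

Section StripPlans.
Context {R : realType}.
Variables (p r : R).
Hypotheses (p1 : 1 <= p) (r0 : 0 < r).
Implicit Types (t x y : R * R) (k L h : nat).

Lemma strip_ex t : Omega t -> OmegaR r t -> exists k, strip r k t.
Proof.
move=> /(Omega_vcoord _ r0) v0 /(OmegaR_uvcoord _ r0)[uu /andP[_ v1]].
have ex : exists k, (2 ^+ k.+1)^-1 < vcoord r t.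
  exists (Num.truncn (vcoord r t)^-1).
  rewrite -[ltRHS]invrK ltf_pV2 ?posrE ?exprn_gt0 ?invr_gt0//.
  have vV0 : 0 <= (vcoord r t)^-1 by rewrite invr_ge0 ltW.
  have /andP[_ h] := truncn_itv vV0; apply: (lt_le_trans h).
  by rewrite -(natrX R 2) ler_nat ltnW// ltn_expl.
have [k kv kmin] := ex_minnP ex; exists k; apply/(strip_uvcoord _ _ r0).
split => //; rewrite kv /=; case: k kv kmin => [|k] kv kmin.
  by rewrite expr0 invr1.
by rewrite leNgt; apply/negP => /kmin; rewrite ltnn.
Qed.

Definition block_cost L h : R := 2 * (2 * r * (2 ^+ h / 2 ^+ L)) `^ p.

Lemma block_cost_ge0 L h : 0 <= block_cost L h.
Proof. by rewrite mulr_ge0// powR_ge0. Qed.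

Let L0 L : (0 : R) < 2 ^+ L. Proof. by rewrite exprn_gt0. Qed.

Let scaled_dist L (a b : R) (e : R) :
  `|2 ^+ L * a - 2 ^+ L * b| <= e -> `|a - b| <= e / 2 ^+ L.
Proof.
by rewrite -mulrBr normrM (gtr0_norm (L0 L)) ler_pdivlMr// mulrC.
Qed.

Lemma block_tcost L k h (i j : leafI L k) x y : block h i = block h j ->
  leaf r i x -> leaf r j y -> tcost p (x, y) <= block_cost L h.
Proof.
move=> [ij1 ij2] [/= xu xv] [/= yu yv].
have cellD (a b c : nat) (z w : R) : (a %/ 2 ^ h = b %/ 2 ^ h)%N ->
    (c + a)%:R < z < (c + a).+1%:R -> (c + b)%:R < w < (c + b).+1%:R ->
    `|z - w| <= 2 ^+ h.
  have lt (m n : nat) : (m %/ 2 ^ h = n %/ 2 ^ h -> m < n + 2 ^ h)%N.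
    move=> mn; rewrite (divn_eq m (2 ^ h)) (divn_eq n (2 ^ h)) mn -addnA ltn_add2l.
    by rewrite ltn_addl// ltn_pmod// expn_gt0.
  move=> ab zc wc.
  have h1 : ((c + a).+1%:R : R) <= (c + b)%:R + 2 ^+ h.
    by rewrite -(natrX R 2 h) -natrD ler_nat -addnS -addnA leq_add2l lt.
  have h2 : ((c + b).+1%:R : R) <= (c + a)%:R + 2 ^+ h.
    by rewrite -(natrX R 2 h) -natrD ler_nat -addnS -addnA leq_add2l lt.
  move: zc wc h1 h2; move: (_%:R) (_%:R) (_.+1%:R) (_.+1%:R) => A B C D.
  by rewrite ler_norml; lra.
apply: tcost_le_lin => //.
- by apply: scaled_dist; apply: (cellD i.1 j.1 0).
- by apply: scaled_dist; exact: (cellD _ _ _ _ _ ij2 xv yv).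
Qed.

(** The point with [u = i.1 / 2^L] and [v = 0], below the left edge of the column of the leaf. *)
Definition diag_point L k (i : leafI L k) : R * R :=
  let c := (i.1%:R / 2 ^+ L - 1 / 2) * (Num.sqrt 2 * r) / 2 in (c, c).

Let diag_dist L k (i : leafI L k) x : (k < L)%N -> leaf r i x ->
  `|ucoord r x - ucoord r (diag_point i)| <= 2 ^+ (L - k) / 2 ^+ L /\
  `|vcoord r x - vcoord r (diag_point i)| <= 2 ^+ (L - k) / 2 ^+ L.
Proof.
move=> kL ix; have [_ /andP[v0 v1]] := (strip_uvcoord _ _ r0).1 (leaf_sub_strip r0 kL ix).
have s0 : Num.sqrt 2 * r != 0 by rewrite gt_eqF// mulr_gt0// sqrtr_gt0.
have E : 2 ^+ (L - k) / 2 ^+ L = (2 ^+ k)^-1 :> R.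
  by rewrite -[in X in _ / X](subnK (ltnW kL)) exprD invfM mulrA divff ?mul1r// gt_eqF.
split.
  have -> : ucoord r (diag_point i) = i.1%:R / 2 ^+ L.
    rewrite /ucoord /diag_point /=; move: (Num.sqrt 2 * r) s0 => S S0.
    by field; rewrite S0 expf_neq0.
  apply: scaled_dist; rewrite [X in _ - X]mulrCA divff ?mulr1 ?gt_eqF//.
  have [/= /andP[u1 u2] _] := ix; rewrite -natr1 in u2.
  have : 1 <= 2 ^+ (L - k) :> R by rewrite exprn_ege1// ler1n.
  by rewrite ler_norml; lra.
have -> : vcoord r (diag_point i) = 0 by rewrite /vcoord /= subrr mul0r.
by rewrite subr0 E ger0_norm// (le_trans _ (ltW v0))// invr_ge0 exprn_ge0.
Qed.

(** Both coordinate differences are at most 2^-k, the upper edge of the strip, which is the side of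
    a block one level above the top. The move to the diagonal is thus priced like one more level. *)
Lemma diag_point_tcost L k (i : leafI L k) x : (k < L)%N -> leaf r i x ->
  tcost p (x, diag_point i) <= block_cost L (L - k) /\
  tcost p (diag_point i, x) <= block_cost L (L - k).
Proof.
move=> kL ix; have [h1 h2] := diag_dist kL ix.
split; apply: tcost_le_lin => //; rewrite ?divr_ge0 ?exprn_ge0//.
  by rewrite distrC.
by rewrite distrC.
Qed.

(** Greedy matching stops at level [L - k.+1], and the rests of both measures go to the diagonal at
    the cost of level [L - k]. Each rest is at most the top discrepancy, whence the factor 2; at
    lower levels it is slack. *)
Lemma has_plan_strip (nu : {measure set (plane R) -> \bar R}) L k
    (a : leafI L k -> R) (b := fun i : leafI L k => fine (nu (leaf r i))) :
    (k < L)%N -> nu (grid r L) = 0%E -> (nu (strip r k) < +oo)%E ->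
    (forall i, 0 <= a i) ->
  has_plan p
    (fun A => \sum_i (a i / (r ^+ 2 / 4 ^+ L))%:E * lebesgue2 (A `&` leaf r i))%E
    (fun B => nu (B `&` strip r k))
    (block_cost L 0 * (\sum_i b i)
     + 2 * \sum_(h < L - k) block_cost L h.+1 * discrepancy (@block L k h) a b)%:E.
Proof.
move=> kL nuG nuS a0.
have mS := measurable_strip k r0.
have lS (i : leafI L k) : leaf r i `<=` strip r k by exact: leaf_sub_strip.
have ml (i : leafI L k) : measurable (leaf r i : set (plane R)).
  exact: measurable_leaf.
have lO (i : leafI L k) : leaf r i `<=` clOmega.
  by move=> t /lS /(strip_sub_Omega r0) Ot; left.
have nul (i : leafI L k) : (nu (leaf r i) < +oo)%E.
  by apply: le_lt_trans nuS; apply: le_measure; rewrite ?inE.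
have lel (i : leafI L k) : (lebesgue2 (leaf r i) < +oo)%E.
  by rewrite lebesgue2_leaf// ltry.
have b0 (i : leafI L k) : 0 <= b i by exact: fine_ge0.
(* Greedy matching wants one cost per pair of leaves, valid at all levels at once: the supremum of
   the cost over their points. *)
pose cset (i j : leafI L k) := [set tcost p z | z in leaf r i `*` leaf r j].
pose c i j := sup (cset i j).
have cset_ub h i j : block h i = block h j -> ubound (cset i j) (block_cost L h).
  by move=> ij _ [[x y] [/= xi yj] <-]; exact: block_tcost ij xi yj.
(* At level [L] there is a single block, so each [cset i j] is bounded and its supremum is an upper
   bound. *)
have top (i j : leafI L k) : block L i = block L j.
  by congr pair; apply: val_inj; rewrite /= !divn_small//;
    apply: (leq_trans (ltn_ord _)); rewrite leq_exp2l// leq_subr.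
have cP (i j : leafI L k) x y : leaf r i x -> leaf r j y -> tcost p (x, y) <= c i j.
  move=> xi yj; apply: ub_le_sup; last by exists (x, y).
  by exists (block_cost L L); apply: cset_ub; exact: top.
have cD h i j : block h i = block h j -> c i j <= block_cost L h.
  move=> ij; rewrite /c; have [->|/set0P ne] := eqVneq (cset i j) set0.
    by rewrite sup0 block_cost_ge0.
  by apply: ge_sup => //; exact: cset_ub.
have c0 i j : 0 <= c i j.
  have [E|/set0P [z [[x y] [/= xi yj] _]]] := eqVneq (cset i j) set0.
    by rewrite /c E sup0.
  exact: le_trans (tcost_ge0 p _) (cP _ _ _ _ xi yj).
have [G [x [y [pl cost xs ys]]]] := greedy_transport (D := block_cost L)
  (h := fun h => @block L k h) (par := fun h => @parent_block L k h)
  (c := c) (n := L - k.+1) (fun h i => block_succ h i)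
  (fun h i j _ => @cD h i j) (block_cost_ge0 L) a0 b0.
pose m1 i := mfrestr (ml i) (lel i).
pose m2 i := mfrestr (ml i) (nul i).
have m1T i : m1 i setT = (r ^+ 2 / 4 ^+ L)%:E.
  by rewrite /m1 /mfrestr /mrestr setTI lebesgue2_leaf.
have m2T i : m2 i setT = (b i)%:E.
  by rewrite /m2 /mfrestr /mrestr setTI /b fineK// ge0_fin_numE.
have area0 : r ^+ 2 / 4 ^+ L != 0 by rewrite gt_eqF// divr_gt0// exprn_gt0.
have H := @has_plan_discrete R p p1 (leafI L k) m1 m2 (@leaf R r L k)
  (fun=> r ^+ 2 / 4 ^+ L) b a b x y G c (block_cost L (L - k))
  (@diag_point L k) pl m1T m2T.
apply: eq_has_plan (H _ _ _ _ _ _ _ _ _ _ _ _) => //.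
- move=> B mB BO; rewrite (@measure_strip_leaf _ r L k)//; last first.
    apply/eqP; rewrite eq_le measure_ge0 andbT -nuG.
    have mG := @measurable_grid R r L.
    by apply: le_measure; rewrite ?inE//; exact: measurableI.
  apply: eq_bigr => i _; have [bi0|bi0] := eqVneq (b i) 0.
    rewrite bi0 mul0r mul0e; apply/esym/eqP; rewrite eq_le measure_ge0 andbT.
    have -> : 0%E = nu (leaf r i).
      by rewrite -[RHS]fineK ?ge0_fin_numE//; exact/esym/congr1.
    by apply: le_measure; rewrite ?inE//; exact: measurableI.
  by rewrite divff// mul1e.
- rewrite lee_fin; apply: (@le_trans _ _
    (block_cost L 0 * \sum_i b i
     + \sum_(m < L - k.+1) block_cost L m.+1 * discrepancy (block m) a b
     + block_cost L (L - k) * (2 * discrepancy (block (L - k.+1)) a b))).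
    apply: lerD => //; rewrite ler_wpM2l ?block_cost_ge0//.
    by rewrite mulr_natl mulr2n; exact: lerD.
  have -> : (L - k = (L - k.+1).+1)%N by rewrite -subnSK.
  rewrite -addrA lerD2l big_ord_recr /= mulrDr; apply: lerD.
    rewrite ler_peMl ?ler1n// sumr_ge0// => i _.
    by rewrite mulr_ge0 ?block_cost_ge0// sumr_ge0.
  by rewrite mulrCA.
- by move=> i /eqP; rewrite (negbTE area0).
- move=> i; transitivity (lebesgue2 (~` leaf r i `&` leaf r i)) => //.
  by rewrite setICl measure0.
- move=> i; transitivity (nu (~` leaf r i `&` leaf r i)) => //.
  by rewrite setICl measure0.
- exact: block_cost_ge0.
- move=> i x' xi; exact: (diag_point_tcost kL xi).1.
- move=> i x' xi; exact: (diag_point_tcost kL xi).2.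
Qed.

End StripPlans.

Section TailPlans.
Context {R : realType}.
Variables (p r : R).
Hypotheses (p1 : 1 <= p) (r0 : 0 < r).
Implicit Types (t x y : R * R) (k : nat).

(** Only finitely many strips reach height [e] above the diagonal, so finiteness on each strip gives
    finiteness away from the diagonal. *)
Lemma strip_finite_far (nu : {measure set (plane R) -> \bar R}) (e : R) :
    0 < e -> (forall k, (nu (strip r k) < +oo)%E) ->
  exists2 U : set (plane R), measurable U & (nu U < +oo)%E /\
    forall x, Omega x -> OmegaR r x -> e <= x.2 - x.1 -> U x.
Proof.
move=> e0 nuS; pose n := Num.truncn (Num.sqrt 2 * r / e).
have s0 : 0 < Num.sqrt 2 * r by rewrite mulr_gt0// sqrtr_gt0.
have nE : Num.sqrt 2 * r < e * 2 ^+ n.+1.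
  have h0 : 0 <= Num.sqrt 2 * r / e by rewrite divr_ge0// ltW.
  have /andP[_ h] := truncn_itv h0; rewrite [ltRHS]mulrC -ltr_pdivrMr//.
  by apply: (lt_le_trans h); rewrite -(natrX R 2) ler_nat ltnW// ltn_expl.
exists (\bigcup_(k : 'I_n.+1) (strip r k : set (plane R))).
  apply: fin_bigcup_measurable => [|k _]; first exact: finite_finset.
  exact: measurable_strip.
split.
  rewrite measure_bigcup_finType.
  - by apply/lte_sum_pinfty => k _; exact: nuS.
  - by move=> k; exact: measurable_strip.
  - by move=> k k' _ _ [t [tk tk']]; apply: val_inj; exact: (strip_inj r0 tk tk').
move=> x xO xR; rewrite (vcoordK x r0) => ev; have [k xk] := strip_ex r0 xO xR.
have [_ /andP[v1 v2]] := (strip_uvcoord _ _ r0).1 xk.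
have kn : (k < n.+1)%N.
  rewrite ltnNge; apply/negP => nk.
  have h : vcoord r x <= (2 ^+ n.+1)^-1.
    apply: (le_trans v2); rewrite lef_pV2 ?posrE ?exprn_gt0//.
    by rewrite ler_weXn2l// ler1n.
  have := le_trans ev (ler_wpM2l (ltW s0) h).
  by rewrite ler_pdivlMr ?exprn_gt0// leNgt nE.
by exists (Ordinal kn).
Qed.

Lemma perp_tcost k x : strip r k x ->
  tcost p (perp x, x) <= 2 * (2 * r * (2 ^+ k)^-1) `^ p.
Proof.
move=> xk; have [_ /andP[v1 v2]] := (strip_uvcoord _ _ r0).1 xk.
have v0 : 0 <= vcoord r x.
  by apply: ltW; apply: lt_trans v1; rewrite invr_gt0 exprn_gt0.
apply: tcost_le_lin => //.
- have -> : ucoord r (perp x) = ucoord r x.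
    by rewrite /ucoord /perp /=; congr (_ / _ + _); field.
  by rewrite subrr normr0 invr_ge0 exprn_ge0.
- have -> : vcoord r (perp x) = 0 by rewrite /vcoord /= subrr mul0r.
  by rewrite sub0r normrN ger0_norm.
Qed.

(** The first marginal is zero because the estimator vanishes below strip [K]. The bound [T] is
    asked of all partial sums, so it survives the limit over infinitely many strips. *)
Lemma has_plan_tail (nu : {measure set (plane R) -> \bar R}) K (T : R)
    (B : nat -> R) (S := (Omega `&` OmegaR r) `\` \bigcup_(k : 'I_K.+1) strip r k) :
    (forall k, (nu (strip r k) <= (B k)%:E)%E) ->
    (forall n, \sum_(0 <= k < n)
       2 * (2 * r * (2 ^+ (K.+1 + k))^-1) `^ p * B (K.+1 + k)%N <= T) ->
  has_plan p (fun=> 0%E) (fun A => nu (A `&` S)) T%:E.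
Proof.
move=> nuB BT.
have mOR := measurable_OmegaR r0; have mO := @measurable_Omega R.
have mS k := measurable_strip k r0.
have mU : measurable (\bigcup_(k : 'I_K.+1) strip r k : set (plane R)).
  by apply: fin_bigcup_measurable => [|k _]; [exact: finite_finset|exact: mS].
have mSS : measurable (S : set (plane R)).
  by apply: measurableD => //; exact: measurableI.
have nuS k : (nu (strip r k) < +oo)%E by apply: le_lt_trans (nuB k) _; rewrite ltry.
apply: has_plan_project => //.
- by move=> x [[]].
- move=> e e0; have [U mUU [Uoo US]] := strip_finite_far e0 nuS.
  apply: le_lt_trans Uoo; apply: le_measure; rewrite ?inE//.
    apply: measurableI => //; rewrite -[X in measurable X]setTI.
    have m : measurable_fun setT (fun x : plane R => x.2 - x.1).
      by apply: measurable_funB; [exact: measurable_snd|exact: measurable_fst].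
    have := m measurableT `[e, +oo[%classic (measurable_itv _).
    by congr measurable; apply/seteqP; split => x /=; rewrite in_itv/= andbT.
  by move=> x [[[Ox Rx] _] ex]; exact: US.
pose F n : set (plane R) := strip r (K.+1 + n).
have SF : S = \bigcup_n F n.
  apply/seteqP; split => [x [[Ox Rx] nx]|x [n _ xn]].
    have [k xk] := strip_ex r0 Ox Rx; have [kK|Kk] := ltnP k K.+1.
      by exfalso; apply: nx; exists (Ordinal kK).
    by exists (k - K.+1)%N => //; rewrite /F subnKC.
  split; first by split; [exact: strip_sub_Omega xn|case: xn].
  move=> [k _ xk]; have := strip_inj r0 xn xk => E.
  by have := ltn_ord k; rewrite -E ltnNge leq_addr.
have mcost (D : set (plane R)) :
    measurable_fun D (fun x => (tcost p (perp x, x))%:E).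
  apply/measurable_EFinP; apply: measurable_funTS.
  apply: (measurableT_comp (measurable_tcost p1)).
  by apply: measurable_fun_pair; [exact: measurable_perp|exact: measurable_id].
rewrite SF ge0_integral_bigcup//; last 3 first.
- by move=> n; exact: mS.
- by move=> x _; rewrite lee_fin tcost_ge0.
- move=> m n _ _ [x [xm xn]]; apply/eqP; rewrite -(eqn_add2l K.+1).
  by apply/eqP; exact: strip_inj xm xn.
apply: lime_le.
  by apply: is_cvg_nneseries => n _ _; apply: integral_ge0 => x _; rewrite lee_fin tcost_ge0.
apply: nearW => n; apply: (@le_trans _ _ (\sum_(0 <= k < n)
    2 * (2 * r * (2 ^+ (K.+1 + k))^-1) `^ p * B (K.+1 + k)%N)%:E).
  rewrite -sumEFin; apply: lee_sum => k _.
  apply: (@le_trans _ _ ((2 * (2 * r * (2 ^+ (K.+1 + k))^-1) `^ p)%:E * nu (F k))%E).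
    apply: (@le_trans _ _ (\int[nu]_(x in F k)
        (2 * (2 * r * (2 ^+ (K.+1 + k))^-1) `^ p)%:E)%E).
      apply: ge0_le_integral => //; first exact: mS.
      - by move=> x _; rewrite lee_fin tcost_ge0.
      - by move=> x xk; rewrite lee_fin; exact: perp_tcost.
    by rewrite (integral_cst _ (mS _)).
  rewrite [in leRHS]EFinM; apply: lee_wpmul2l; last exact: nuB.
  by rewrite lee_fin mulr_ge0 ?powR_ge0.
by rewrite lee_fin; exact: BT.
Qed.

End TailPlans.

Section EstimatePlan.
Context {R : realType}.
Variables (p r : R).
Hypotheses (p1 : 1 <= p) (r0 : 0 < r).

Lemma measure_strips (nu : {measure set (plane R) -> \bar R}) K (B : set (plane R)) :
    nu (~` (Omega `&` OmegaR r)) = 0%E -> measurable B ->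
  (nu B = \sum_(k < K.+1) nu (B `&` strip r k)
          + nu (B `&` ((Omega `&` OmegaR r) `\` \bigcup_(k : 'I_K.+1) strip r k)))%E.
Proof.
move=> nu0 mB; have mS k := measurable_strip k r0.
set S := (Omega `&` OmegaR r) : set (plane R).
set U := \bigcup_(k : 'I_K.+1) strip r k : set (plane R).
have mSS : measurable S.
  by apply: measurableI; [exact: measurable_Omega|exact: measurable_OmegaR].
have mU : measurable U.
  by apply: fin_bigcup_measurable => [|k _]; [exact: finite_finset|exact: mS].
have -> : nu B = nu (B `&` S).
  rewrite [LHS](measureDI nu mB mSS) [X in (X + _)%E](_ : _ = 0%E) ?add0e//.
  apply/eqP; rewrite eq_le measure_ge0 andbT -nu0.
  apply: le_measure; rewrite ?inE//.
  - exact: measurableD.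
  - exact: measurableC.
have mBS : measurable (B `&` S) by exact: measurableI.
rewrite [LHS](measureDI nu mBS mU) addeC setIDA; congr (_ + _)%E.
transitivity (nu (\bigcup_(k : 'I_K.+1) (B `&` strip r k : set (plane R)))).
  rewrite -setI_bigcupr -/U -setIA; congr (nu (_ `&` _)).
  apply/setIidPr => t [k _ tk]; split; first exact: strip_sub_Omega tk.
  by case: tk.
apply: measure_bigcup_finType.
- by move=> k; exact: measurableI.
- by move=> k k' _ _ [t [[_ tk] [_ tk']]]; apply: val_inj; exact: (strip_inj r0 tk tk').
Qed.

Lemma has_plan_estimate N (mu : 'I_N -> {measure set (plane R) -> \bar R})
    (nu : {measure set (plane R) -> \bar R}) J K (B : nat -> R) (T : R)
    (L := (J + K).+1)
    (b := fun k (i : leafI L k) => fine (nu (leaf r i))) :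
    (forall n, mu n (grid r L) = 0%E) ->
    (forall n k, (mu n (strip r k) < +oo)%E) ->
    nu (~` (Omega `&` OmegaR r)) = 0%E -> nu (grid r L) = 0%E ->
    (forall k, (nu (strip r k) <= (B k)%:E)%E) ->
    (forall n, \sum_(0 <= k < n)
       2 * (2 * r * (2 ^+ (K.+1 + k))^-1) `^ p * B (K.+1 + k)%N <= T) ->
  has_plan p (mu_hat r mu J K) nu
    (\sum_(k < K.+1) (block_cost p r L 0 * (\sum_i b k i)
     + 2 * \sum_(h < L - k) block_cost p r L h.+1
           * discrepancy (@block L k h) (@leaf_mean R r N J K mu k) (b k)) + T)%:E.
Proof.
move=> muG muS nuO nuG nuB BT.
have kL (k : 'I_K.+1) : (k < L)%N by rewrite /L; have := ltn_ord k; lia.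
have nuS k : (nu (strip r k) < +oo)%E by apply: le_lt_trans (nuB k) _; rewrite ltry.
have a0 (k : 'I_K.+1) i : 0 <= @leaf_mean R r N J K mu k i.
  by rewrite /leaf_mean mulr_ge0 ?invr_ge0 ?sumr_ge0// => n _; exact: fine_ge0.
have H (k : 'I_K.+1) := has_plan_strip p1 r0 (kL k) nuG (nuS k) (a0 k).
apply: eq_has_plan (has_planD p1 (has_plan_sum p1 (index_enum 'I_K.+1) H)
  (has_plan_tail p1 r0 nuB BT)).
- by move=> A mA AO; rewrite adde0 mu_hatE.
- by move=> A mA AO; rewrite [RHS](measure_strips K nuO mA).
- by rewrite EFinD sumEFin.
Qed.

End EstimatePlan.

(** * Expected cost *)

Section IidDeviation.
Context {R : realType} {d d' : measure_display}.
Context {T : measurableType d} {Y : measurableType d'}.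
Variables (Pr : probability T R) (P : probability Y R).
Variables (N : nat) (X : 'I_N -> T -> Y).
Hypotheses (N0 : (0 < N)%N) (iidX : iid_with_law Pr P X).

Definition deviation (I : finType) (h : I -> Y -> R) (w : T) : R :=
  \sum_t `|N%:R^-1 * (\sum_(i < N) h t (X i w)) - \int[P]_y h t y|.

Lemma measurable_deviation (I : finType) (h : I -> Y -> R) :
  (forall t, measurable_fun setT (h t)) -> measurable_fun setT (deviation h).
Proof.
move=> mh; have [mX _ _] := iidX.
apply: measurable_sum => t; apply: measurableT_comp => //.
apply: measurable_funB => //; apply: measurable_funM => //.
by apply: measurable_sum => i; exact: measurableT_comp.
Qed.

(** Cauchy-Schwarz in the pointwise form [|Z| <= Z^2 / (2 l) + l / 2]. The number [l] is the root of
    the average, over [I], of the bounds on the mean squares; with it both halves contribute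
    [#|I| * l / 2]. *)
Lemma iid_deviation_bound (I : finType) (h : I -> Y -> R) (b V : R) :
    0 < b -> 0 < V -> (0 < #|I|)%N ->
    (forall t, measurable_fun setT (h t)) ->
    (forall t y, 0 <= h t y <= b) -> \sum_t \int[P]_y h t y <= V ->
  (\int[Pr]_w (deviation h w)%:E <= (Num.sqrt (#|I|%:R * b * V / N%:R))%:E)%E.
Proof.
move=> b0 V0 I0 mh hb hV; have [mX _ _] := iidX.
have NR : (0 : R) < N%:R by rewrite ltr0n.
have IR : (0 : R) < #|I|%:R by rewrite ltr0n.
pose Z t w := N%:R^-1 * (\sum_(i < N) h t (X i w)) - \int[P]_y h t y.
have mZ t : measurable_fun setT (Z t).
  apply: measurable_funB => //; apply: measurable_funM => //.
  by apply: measurable_sum => i; exact: measurableT_comp.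
have mZ2 t : measurable_fun setT (fun w => (Z t w ^+ 2)%:E).
  by apply/measurable_EFinP; apply: measurable_funX.
pose l := Num.sqrt (b * V / (N%:R * #|I|%:R)).
have l0 : 0 < l by rewrite sqrtr_gt0 divr_gt0 ?mulr_gt0.
have lE : Num.sqrt (#|I|%:R * b * V / N%:R) = #|I|%:R * l.
  rewrite -[X in X * l](ger0_norm (ltW IR)) -sqrtr_sqr -sqrtrM ?sqr_ge0//.
  by congr Num.sqrt; field; rewrite !gt_eqF.
have l2 : l ^+ 2 = b * V / (N%:R * #|I|%:R).
  by rewrite sqr_sqrtr// divr_ge0 ?mulr_ge0// ltW.
under eq_integral do rewrite /deviation -sumEFin.
rewrite ge0_integral_sum//; last first.
  by move=> t; apply/measurable_EFinP; exact: measurableT_comp (mZ t).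
apply: (@le_trans _ _ (\sum_t (((2 * l)^-1 * (b * \int[P]_y h t y / N%:R)
    + l / 2)%:E))%E).
  apply: lee_sum => t _.
  apply: (@le_trans _ _ (\int[Pr]_w ((2 * l)^-1%:E * (Z t w ^+ 2)%:E
      + (l / 2)%:E))%E).
    apply: ge0_le_integral => //.
    - by apply/measurable_EFinP; exact: measurableT_comp (mZ t).
    - by apply: emeasurable_funD; [exact: measurable_funeM|exact: measurable_cst].
    - move=> w _; rewrite lee_fin -/(Z t w) -(real_normK (num_real (Z t w))).
      rewrite -subr_ge0 (_ : _ - _ = (2 * l)^-1 * (`|Z t w| - l) ^+ 2).
        by rewrite mulr_ge0 ?sqr_ge0// invr_ge0 mulr_ge0// ltW.
      by field; rewrite gt_eqF.
  rewrite ge0_integralD//; last 3 first.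
  - by move=> w _; rewrite lee_fin mulr_ge0 ?sqr_ge0// invr_ge0 mulr_ge0// ltW.
  - exact: measurable_funeM.
  - by move=> w _; rewrite lee_fin divr_ge0// ltW.
  rewrite ge0_integralZl//; last 2 first.
  - by move=> w _; rewrite lee_fin sqr_ge0.
  - by rewrite lee_fin invr_ge0 mulr_ge0// ltW.
  rewrite [X in (_ + X)%E]integral_cst//= (probability_setT Pr) mule1.
  rewrite EFinD leeD2r// EFinM.
  rewrite lee_wpmul2l ?lee_fin ?invr_ge0 ?mulr_ge0 ?(ltW l0)//.
  exact: iid_mean_square_bound.
rewrite sumEFin lee_fin lE big_split /= sumr_const -[_ *+ #|_|]mulr_natl.
have -> : \sum_t (2 * l)^-1 * (b * \int[P]_y h t y / N%:R)
    = b / (2 * l * N%:R) * \sum_t \int[P]_y h t y.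
  rewrite mulr_sumr; apply: eq_bigr => t _; field.
  by rewrite !gt_eqF.
have c0 : 0 <= b / (2 * l * N%:R) by rewrite divr_ge0 ?mulr_ge0 // ltW.
apply: le_trans (lerD (ler_wpM2l c0 hV) (lexx _)) _.
have -> : b / (2 * l * N%:R) * V = #|I|%:R * l ^+ 2 / (2 * l).
  by rewrite l2; field; rewrite !gt_eqF.
by rewrite le_eqVlt; apply/orP; left; apply/eqP; field; rewrite gt_eqF.
Qed.

End IidDeviation.

(** * Block masses as bounded random variables *)

Section BlockMass.
Context {R : realType}.
Variables (q : \bar R) (s M r : R) (P : probability (measT R) R).
Hypotheses (q1 : (1 <= q)%E) (s0 : 0 <= s) (M0 : 0 < M) (r0 : 0 < r).
Hypothesis PM : {ae P, forall m : measT R, M_sRM q s r M m}.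

Lemma sum_leaf_le (m : {measure set (plane R) -> \bar R}) L k (B : R) :
    (k < L)%N -> (m (strip r k) <= B%:E)%E ->
  \sum_(i : leafI L k) fine (m (leaf r i)) <= B.
Proof.
move=> kL mB; have mS := measurable_strip k r0.
have ml (i : leafI L k) : measurable (leaf r i : set (plane R)).
  exact: measurable_leaf.
have lS (i : leafI L k) : leaf r i `<=` strip r k by exact: leaf_sub_strip.
have fin (i : leafI L k) : m (leaf r i) \is a fin_num.
  rewrite ge0_fin_numE//; apply: le_lt_trans (ltry B); apply: le_trans mB.
  by apply: le_measure; rewrite ?inE.
rewrite -lee_fin -sumEFin; apply: le_trans mB.
under eq_bigr do rewrite fineK//.
rewrite -measure_bigcup_finType//; last exact: trivIset_leaf.
apply: le_measure; rewrite ?inE//.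
  by apply: fin_bigcup_measurable => [|i _]; [exact: finite_finset|].
by move=> x [i _] /lS.
Qed.

Definition strip_bound k : R := 4 `^ s * strip_scale s M r k.

Lemma strip_bound_gt0 k : 0 < strip_bound k.
Proof. by rewrite mulr_gt0 ?powR_gt0// strip_scale_gt0. Qed.

Definition block_mass L k h (t : blockI L k h) (m : measT R) : R :=
  class_sum (@block L k h) (fun i => fine ((m : meas R) (leaf r i))) t.

(* Clipping does not change the mass for almost every m, and makes it bounded. *)
Definition clipped_mass L k h (t : blockI L k h) (m : measT R) : R :=
  Num.min (block_mass t m) (strip_bound k).

Lemma block_mass_ge0 L k h (t : blockI L k h) m : 0 <= block_mass t m.
Proof. by apply: sumr_ge0 => i _; exact: fine_ge0. Qed.

Lemma clipped_mass_bounds L k h (t : blockI L k h) m :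
  0 <= clipped_mass t m <= strip_bound k.
Proof.
by rewrite le_min block_mass_ge0 (ltW (strip_bound_gt0 k)) ge_min lexx orbT.
Qed.

Lemma measurable_clipped_mass L k h (t : blockI L k h) :
  measurable_fun setT (clipped_mass t).
Proof.
apply: measurable_minr => //; rewrite /block_mass /class_sum.
under eq_fun do rewrite -big_filter.
apply: measurable_sum => i; apply: (measurableT_comp (fine_measurable measurableT)).
by apply: measurable_eval; exact: measurable_leaf.
Qed.

Lemma clipped_massE L k h (t : blockI L k h) (m : measT R) :
  (k < L)%N -> M_sRM q s r M m -> clipped_mass t m = block_mass t m.
Proof.
move=> kL /(M_sRM_strip q1 s0 r0 k) mS; apply/min_idPl.
apply: le_trans (sum_leaf_le kL mS).
rewrite /block_mass /class_sum [leLHS]big_mkcond; apply: ler_sum => i _.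
by case: ifP => // _; exact: fine_ge0.
Qed.

(** The clip is inactive almost surely and the expected mass of the strip is finite, so passing to
    real values by [fine] commutes with the expectation. *)
Lemma Rintegral_clipped_mass L k h (t : blockI L k h) : (k < L)%N ->
  \int[P]_m clipped_mass t m
  = class_sum (@block L k h) (fun i => fine (EPD P (leaf r i))) t.
Proof.
move=> kL; rewrite /class_sum -big_filter.
have ml (i : leafI L k) : measurable (leaf r i : set (plane R)).
  exact: measurable_leaf.
have fin (m : {measure set (plane R) -> \bar R}) (i : leafI L k) :
    (m (strip r k) <= (strip_bound k)%:E)%E -> m (leaf r i) \is a fin_num.
  move=> mB; rewrite ge0_fin_numE//; apply: le_lt_trans (ltry (strip_bound k)).
  apply: le_trans mB; apply: le_measure; rewrite ?inE//.
    exact: measurable_strip.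
  exact: leaf_sub_strip.
apply: EFin_inj; rewrite -sumEFin.
have E : (\int[P]_m (clipped_mass t m)%:E
    = \sum_(i <- [seq i <- index_enum (leafI L k) | block h i == t])
        EPD P (leaf r i))%E.
  rewrite /EPD -ge0_integral_sum//; last by move=> i; exact: measurable_eval.
  apply: ge0_ae_eq_integral => //.
  - by apply/measurable_EFinP; exact: measurable_clipped_mass.
  - by apply: emeasurable_sum => i; exact: measurable_eval.
  - by move=> m _; rewrite lee_fin; have /andP[] := clipped_mass_bounds t m.
  - by move=> m _; apply: sume_ge0.
  - apply: ae_mono PM => m mM _; rewrite clipped_massE// /block_mass /class_sum.
    rewrite -big_filter -sumEFin; apply: eq_bigr => i _; rewrite fineK//.
    by apply: fin; exact: M_sRM_strip mM.
rewrite /Rintegral E fineK.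
  apply: eq_bigr => i _; rewrite fineK//.
  by apply: fin; exact: (EPD_strip_le q1 s0 M0 r0 PM).
apply/sum_fin_numP => i _ _; apply: fin.
exact: (EPD_strip_le q1 s0 M0 r0 PM).
Qed.

End BlockMass.

Section ExpectedCost.
Context {R : realType}.
Variables (p s : R) (q : \bar R) (M r C : R) (P : probability (measT R) R).
Variable f : R * R -> R.
Hypotheses (p1 : 1 <= p) (s0 : 0 <= s).
Hypotheses (q1 : (1 <= q)%E) (M0 : 0 < M) (r0 : 0 < r) (C0 : 0 < C).
Hypothesis PM : {ae P, forall m : measT R, M_sRM q s r M m}.
Hypothesis Pf : is_lebesgue_density (EPD P) f.
Hypothesis fC : forall k : nat, (Linfty_norm (strip r k) f
       <= (C ^+ 2 * M * r `^ (- s) * 2 `^ (k%:R * s))%:E)%E.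
Context {d : measure_display} {T : measurableType d}.
Variables (Pr : probability T R) (N : nat) (X : 'I_N -> T -> measT R).
Hypotheses (N0 : (0 < N)%N) (iidX : iid_with_law Pr P X).

Lemma iid_ae (A : measT R -> Prop) : {ae P, forall m, A m} ->
  {ae Pr, forall w, forall i, A (X i w)}.
Proof.
move=> [Z [mZ Z0 AZ]]; have [mX lawX _] := iidX.
(* The index becomes a natural number so that countable intersection of almost sure events applies;
   for n >= N the claim is void. *)
have H n : {ae Pr, forall w, forall i : 'I_N, i = n :> nat -> A (X i w)}.
  have [nN|Nn] := ltnP n N.
    exists (X (Ordinal nN) @^-1` Z); split.
    - by rewrite -[X in measurable X]setTI; exact: mX.
    - by rewrite lawX.
    - move=> w /= nA; apply: AZ => /= Aw; apply: nA => i iE.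
      by rewrite (_ : i = Ordinal nN)//; exact: val_inj.
  exists set0; split => // w /=; apply => i iE.
  by move: (ltn_ord i); rewrite iE ltnNge Nn.
by apply: ae_mono (ae_foralln H) => w Hw i; exact: Hw.
Qed.

Let B := strip_bound s M r.
Let V k : R := C ^+ 2 * strip_scale s M r k * (r ^+ 2 / 2 ^+ k).

(** For almost every sample the cost is at most a constant plus a nonnegative combination of block
    deviations. This majorant [G] is measurable, so its expectation splits term by term. *)
Lemma expected_OT_le J K (T0 : R) (L := (J + K).+1) :
    (forall n, \sum_(0 <= k < n)
       2 * (2 * r * (2 ^+ (K.+1 + k))^-1) `^ p * B (K.+1 + k)%N <= T0) ->
  (\int[Pr]_w (OT p (mu_hat r (fun i => X i w : meas R) J K) (EPD P) `^ p)
   <= (\sum_(k < K.+1) (block_cost p r L 0 * B k + 2 * \sum_(h < L - k)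
          block_cost p r L h.+1
          * Num.sqrt (#|blockI L k h|%:R * B k * V k / N%:R)) + T0)%:E)%E.
Proof.
move=> hT; have mG := measurable_grid r L.
have kL (k : 'I_K.+1) : (k < L)%N by rewrite /L; have := ltn_ord k; lia.
have EG := EPD_null r0 PM Pf mG (lebesgue2_grid L r0).
pose good m := M_sRM q s r M m /\ (m : meas R) (grid r L) = 0%E.
have aeg : {ae P, forall m, good m}.
  have h1 := ae_eval0 mG EG.
  have [Z1 [mZ1 Z10 AZ1]] := PM; have [Z2 [mZ2 Z20 AZ2]] := h1.
  exists (Z1 `|` Z2); split; first exact: measurableU.
    by rewrite measureU0.
  move=> m /= ng; apply: contrapT => /not_orP[nZ1 nZ2]; apply: ng; split.
    by apply: contrapT => h; apply: nZ1; exact: AZ1.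
  by apply: contrapT => h; apply: nZ2; exact: AZ2.
have [Z [mZ Z0 AZ]] := iid_ae aeg.
have EB k : (EPD P (strip r k) <= (B k)%:E)%E.
  exact: (EPD_strip_le q1 s0 M0 r0 PM).
have B0 k : 0 < B k by exact: strip_bound_gt0.
have V0 k : 0 < V k.
  have h := strip_scale_gt0 s M0 r0 k.
  by rewrite /V mulr_gt0// ?divr_gt0 ?exprn_gt0// mulr_gt0// exprn_gt0.
pose D (k : 'I_K.+1) (h : 'I_(L - k)) w :=
  deviation P X (fun t : blockI L k h => clipped_mass s M r t) w.
pose c0 := \sum_(k < K.+1) block_cost p r L 0 * B k + T0.
pose c (h : nat) := 2 * block_cost p r L h.+1.
have bc0 h : 0 <= block_cost p r L h by exact: block_cost_ge0.
have ch0 h : 0 <= c h by rewrite mulr_ge0.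
have T00 : 0 <= T0 by apply: le_trans (hT 0); rewrite big_geq.
have c00 : 0 <= c0.
  by rewrite addr_ge0// sumr_ge0// => k _; rewrite mulr_ge0// ltW.
have D0 k h w : 0 <= @D k h w by exact: sumr_ge0.
have mD k h : measurable_fun setT (fun w => (@D k h w)%:E).
  apply/measurable_EFinP; apply: (measurable_deviation iidX) => t.
  exact: measurable_clipped_mass.
pose G w := (c0%:E + \sum_(k < K.+1) \sum_(h < L - k) (c h)%:E * (@D k h w)%:E)%E.
have G0 (k : 'I_K.+1) (h : 'I_(L - k)) w :
    (0 <= (c h)%:E * (@D k h w)%:E)%E.
  by rewrite mule_ge0 ?lee_fin.
apply: (@le_trans _ _ (\int[Pr]_w G w)%E).
  apply: (ge0_le_integral_off_null mZ Z0).
  - by move=> w; exact: poweR_ge0.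
  - by move=> w; rewrite adde_ge0 ?lee_fin// sume_ge0// => k _; exact: sume_ge0.
  move=> w /(contra_notP (AZ w)) gw.
  have wG n : (X n w : meas R) (grid r L) = 0%E by have [] := gw n.
  have wS n k : ((X n w : meas R) (strip r k) < +oo)%E.
    have [wM _] := gw n.
    by apply: le_lt_trans (M_sRM_strip q1 s0 r0 k wM) (ltry _).
  have H := has_plan_estimate (nu := EPD P) p1 r0 wG wS (EPD_outside r0 PM) EG EB hT.
  apply: le_trans (has_plan_OT p1 H) _.
  have -> : G w = (c0 + \sum_(k < K.+1) \sum_(h < L - k) c h * @D k h w)%:E.
    rewrite EFinD -sumEFin; congr (_ + _)%E.
    by apply: eq_bigr => k _; rewrite -sumEFin.
  rewrite lee_fin big_split /= /c0 addrAC; apply: lerD.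
    rewrite lerD2r; apply: ler_sum => k _; rewrite ler_wpM2l//.
    exact: sum_leaf_le (kL k) (EB k).
  apply: ler_sum => k _; rewrite mulr_sumr; apply: ler_sum => h _.
  rewrite [leLHS]mulrA; apply: (ler_wpM2l (ch0 h)); apply: ler_sum => t _.
  rewrite (Rintegral_clipped_mass q1 s0 M0 r0 PM)//.
  rewrite le_eqVlt; apply/orP; left; apply/eqP; congr `|_ - _|.
  rewrite /class_sum /leaf_mean -mulr_sumr exchange_big; congr (_ * _).
  apply: eq_bigr => n _; have [wM _] := gw n.
  by rewrite (clipped_massE q1 s0 r0 t (kL k) wM).
rewrite ge0_integralD//; last 2 first.
- by move=> w _; apply: sume_ge0 => k _; exact: sume_ge0.
- apply: emeasurable_sum => k; apply: emeasurable_sum => h.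
  exact: measurable_funeM.
rewrite integral_cst//= (probability_setT Pr) mule1.
rewrite ge0_integral_sum//; last 2 first.
- move=> k; apply: emeasurable_sum => h; exact: measurable_funeM.
- by move=> k w _; exact: sume_ge0.
have -> : \sum_(k < K.+1) (block_cost p r L 0 * B k + 2 * \sum_(h < L - k)
          block_cost p r L h.+1
          * Num.sqrt (#|blockI L k h|%:R * B k * V k / N%:R)) + T0
  = c0 + \sum_(k < K.+1) \sum_(h < L - k) c h
          * Num.sqrt (#|blockI L k h|%:R * B k * V k / N%:R).
  rewrite big_split /= /c0 addrAC; congr (_ + _); apply: eq_bigr => k _.
  by rewrite mulr_sumr; apply: eq_bigr => h _; rewrite mulrA.
rewrite [in leRHS]EFinD leeD2l// -sumEFin; apply: lee_sum => k _.
rewrite ge0_integral_sum//; last by move=> h; exact: measurable_funeM.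
rewrite -sumEFin; apply: lee_sum => h _.
rewrite ge0_integralZl ?lee_fin//; last by move=> w _; rewrite lee_fin.
rewrite [in leRHS]EFinM; apply: lee_wpmul2l; rewrite ?lee_fin//.
apply: (iid_deviation_bound N0 iidX) => //.
- by rewrite card_prod !card_ord muln_gt0 !expn_gt0.
- by move=> t; exact: measurable_clipped_mass.
- by move=> t m; exact: clipped_mass_bounds.
under eq_bigr do rewrite (Rintegral_clipped_mass q1 s0 M0 r0 PM)//.
rewrite sum_class_sum; apply: sum_leaf_le => //.
exact: (EPD_strip_density_le M0 r0 C0 Pf fC).
Qed.

End ExpectedCost.

(** * Summation over levels and strips *)

Section GeometricSums.
Context {R : realType}.
Implicit Types (p s r M C x y : R) (k h K L n : nat).

Lemma geometric_sum_le y n : 0 <= y < 1 -> \sum_(k < n) y ^+ k <= (1 - y)^-1.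
Proof.
move=> /andP[y0 y1]; have y1' : 0 < 1 - y by rewrite subr_gt0.
rewrite -[leRHS]mul1r ler_pdivlMr// mulrC.
have -> : (1 - y) * \sum_(k < n) y ^+ k = 1 - y ^+ n.
  rewrite -[in RHS](expr1n _ n) subrXX; congr (_ * _).
  by apply: eq_bigr => k _; rewrite expr1n mul1r.
by rewrite gerBl exprn_ge0.
Qed.

Lemma powR_exprn p h : (2 ^+ h : R) `^ p = (2 `^ p) ^+ h.
Proof.
rewrite -(powR_mulrn h (ler0n R 2)) -(powR_mulrn h (powR_ge0 2 p)).
by rewrite -!powRrM mulrC.
Qed.

Lemma powR_exprnV p h : ((2 ^+ h)^-1 : R) `^ p = ((2 `^ p) ^+ h)^-1.
Proof.
apply: (@mulfI _ ((2 ^+ h) `^ p)); first by rewrite gt_eqF// powR_gt0// exprn_gt0.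
rewrite -powRM ?invr_ge0 ?exprn_ge0// divff ?gt_eqF ?exprn_gt0// powR1.
by rewrite powR_exprn divff// gt_eqF// exprn_gt0// powR_gt0.
Qed.

Lemma block_costE p r L h : 0 < r ->
  block_cost p r L h = 2 * ((2 `^ p * r `^ p) * ((2 `^ p) ^+ h / (2 `^ p) ^+ L)).
Proof.
move=> r0; rewrite /block_cost.
rewrite !powRM ?mulr_ge0 ?invr_ge0 ?exprn_ge0 ?(ltW r0)//.
by rewrite powR_exprn powR_exprnV.
Qed.

Lemma strip_scaleE s M r k : strip_scale s M r k = M * r `^ (- s) * (2 `^ s) ^+ k.
Proof. by rewrite /strip_scale mulrC [k%:R * s]mulrC powRrM powR_mulrn ?powR_ge0// mulrC. Qed.

Lemma strip_boundE s M r k :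
  strip_bound s M r k = (2 `^ s) ^+ 2 * strip_scale s M r k.
Proof.
rewrite /strip_bound -powR_exprn; congr (_ `^ _ * _); ring.
Qed.

(** There are at most [4^(L-k-h) * 2^k] blocks, and [2^k] cancels the area factor 2^-k of the strip;
    what is left under the root is a perfect square over N. *)
Lemma block_deviation_le s M r C N L k h (b := strip_scale s M r k) :
    0 < M -> 0 < r -> 0 < C -> (0 < N)%N -> (h < L - k)%N ->
  Num.sqrt (#|blockI L k h|%:R * strip_bound s M r k
            * (C ^+ 2 * b * (r ^+ 2 / 2 ^+ k)) / N%:R)
  <= 2 `^ s * b * C * r * 2 ^+ (L - k - h) / Num.sqrt N%:R.
Proof.
move=> M0 r0 C0 N0 hLk; have NR : (0 : R) < N%:R by rewrite ltr0n.
have sN : 0 < Num.sqrt (N%:R : R) by rewrite sqrtr_gt0.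
have b0 : 0 < b by exact: strip_scale_gt0.
rewrite strip_boundE -/b; clearbody b; move: (2 `^ s) (powR_ge0 2 s) => S S0.
set Q := S * b * C * r * 2 ^+ (L - k - h) / Num.sqrt N%:R.
have Q0 : 0 <= Q.
  by rewrite /Q mulr_ge0 ?invr_ge0 ?(ltW sN)// mulr_ge0 ?exprn_ge0// !mulr_ge0// ltW.
rewrite -[leRHS](ger0_norm Q0) -sqrtr_sqr; apply: ler_wsqrtr.
have card : (#|blockI L k h|%:R : R) <= (2 ^+ (L - k - h)) ^+ 2 * 2 ^+ k.
  rewrite card_prod !card_ord -expnD -exprM -exprD -(natrX R 2) ler_nat.
  by rewrite leq_exp2l//; lia.
have -> : Q ^+ 2 = (2 ^+ (L - k - h)) ^+ 2 * 2 ^+ k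
    * ((S ^+ 2 * b) * (C ^+ 2 * b * (r ^+ 2 / 2 ^+ k)) / N%:R).
  rewrite /Q exprMn exprVn sqr_sqrtr ?(ltW NR)//.
  have : (2 ^+ k : R) != 0 by rewrite gt_eqF// exprn_gt0.
  move: (2 ^+ (L - k - h)) (2 ^+ k) => u v v0.
  by field; rewrite v0 gt_eqF.
have v0 : 0 <= C ^+ 2 * b * (r ^+ 2 / 2 ^+ k).
  by rewrite !mulr_ge0 ?invr_ge0 ?exprn_ge0// ltW.
move: (_ * (r ^+ 2 / _)) v0 => v v0.
rewrite -[in leLHS]mulrA -[in leLHS]mulrA [in leLHS](mulrA (S ^+ 2 * b)).
apply: ler_wpM2r card; rewrite !mulr_ge0 ?invr_ge0 ?exprn_ge0//.
exact: ltW.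
Qed.

End GeometricSums.

(** * Summing the levels and the strips *)

Section TotalCost.
Context {R : realType}.
Implicit Types (p s r M C x y : R) (k h K L n N : nat).

Lemma ceil_log2_bounds N (K := `|Num.ceil (log2 (N%:R : R))|%N) : (2 <= N)%N ->
  [/\ 1 <= log2 (N%:R : R), K%:R <= log2 (N%:R : R) + 1 & (N%:R : R) <= 2 ^+ K].
Proof.
move=> N2; have N2R : (2 : R) <= N%:R by rewrite ler_nat.
have N0 : (0 : R) < N%:R by apply: lt_le_trans N2R.
have l2 : (0 : R) < ln 2 by rewrite ln_gt0// ltr1n.
have l1 : 1 <= log2 (N%:R : R).
  by rewrite /log2 ler_pdivlMr// mul1r ler_ln// posrE.
have /andP[c1 c2] := ceil_itv (log2 (N%:R : R)).
(* Since log2 N >= 1 the ceiling is positive, so the absolute value that makes it a natural number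
   is harmless. *)
have KE : (K%:R : R) = (Num.ceil (log2 (N%:R : R)))%:~R.
  rewrite -[LHS]/(K%:Z%:~R); congr (_%:~R); apply: gez0_abs.
  by rewrite -(ler_int R) (le_trans _ c2)// (le_trans _ l1).
split => //.
  by rewrite KE; move: c1; rewrite intrD mulrNz; lra.
have -> : (N%:R : R) = 2 `^ (log2 N%:R).
  by rewrite /powR pnatr_eq0 /log2 divfK ?gt_eqF// lnK.
by rewrite -powR_mulrn// ; apply: ler_powR; rewrite ?ler1n// KE.
Qed.

Lemma ltr_powR2 s p : s < p -> (2 : R) `^ s < 2 `^ p.
Proof. by move=> sp; rewrite /powR pnatr_eq0 ltr_expR ltr_pM2r// ln_gt0// ltr1n. Qed.

Lemma sum_expr_rev x n : \sum_(h < n) x ^+ (n - h) = \sum_(h < n) x ^+ h.+1.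
Proof.
rewrite (reindex_inj rev_ord_inj); apply: eq_bigr => h _ /=.
by rewrite subKn.
Qed.

(** The bound separates into a power of [y = 2^(s-p)] for the strip and a power of [x = 2^(1-p)] for
    the level below its top: moving down one level doubles the deviation and divides the cost by
    [2^p]. *)
Lemma weighted_deviation_le p s M r C N L k h
    (x := 2 / 2 `^ p) (y := 2 `^ s / 2 `^ p) :
    0 < M -> 0 < r -> 0 < C -> (0 < N)%N -> (k <= L)%N -> (h < L - k)%N ->
  block_cost p r L h.+1
  * Num.sqrt (#|blockI L k h|%:R * strip_bound s M r k
              * (C ^+ 2 * strip_scale s M r k * (r ^+ 2 / 2 ^+ k)) / N%:R)
  <= 2 * (2 `^ p) ^+ 2 * 2 `^ s * (M * r `^ (p - s)) * (C * r / Num.sqrt N%:R)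
     * (y ^+ k * x ^+ (L - k - h)).
Proof.
move=> M0 r0 C0 N0 kL hLk.
apply: le_trans (ler_wpM2l (block_cost_ge0 _ _ _ _)
  (block_deviation_le s M0 r0 C0 N0 hLk)) _.
rewrite block_costE// strip_scaleE powRD; last by rewrite (gt_eqF r0) implybT.
have A0 : (0 : R) < 2 `^ p by rewrite powR_gt0.
have -> : (L = h + k + (L - k - h))%N by lia.
have -> : (h + k + (L - k - h) - k - h = L - k - h)%N by lia.
rewrite /x /y !expr_div_n 2!exprD [_ ^+ h.+1]exprS.
have Ah n : (2 `^ p) ^+ n != 0 by rewrite expf_neq0// gt_eqF.
move: (Ah h) (Ah k) (Ah (L - k - h)%N) (gt_eqF A0).
have : Num.sqrt (N%:R : R) != 0 by rewrite gt_eqF// sqrtr_gt0 ltr0n.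
move: (r `^ p) (r `^ (- s)) (2 `^ s) ((2 `^ s) ^+ k) (2 ^+ (L - k - h)).
move: ((2 `^ p) ^+ h) ((2 `^ p) ^+ k) ((2 `^ p) ^+ (L - k - h)) (2 `^ p).
move: (Num.sqrt N%:R) => S a b c A rp rs Ss Sk t S0 a0 b0 c0 /negbT A1.
rewrite le_eqVlt; apply/orP; left; apply/eqP; field.
by rewrite S0 a0 b0 c0.
Qed.

Lemma total_cost_le p s M r C N K (L := (K + K).+1)
    (a := if p == 1 then log2 (N%:R : R) else 1)
    (A := 2 `^ p) (S := 2 `^ s) (y := S / A)
    (g := if p == 1 then 5 else (1 - 2 / A)^-1) :
    1 <= p -> 0 <= s < p -> 0 < M -> 0 < r -> 0 < C -> (0 < N)%N ->
    1 <= log2 (N%:R : R) -> K%:R <= log2 (N%:R : R) + 1 ->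
  \sum_(k < K.+1) (block_cost p r L 0 * strip_bound s M r k
     + 2 * \sum_(h < L - k) block_cost p r L h.+1
       * Num.sqrt (#|blockI L k h|%:R * strip_bound s M r k
           * (C ^+ 2 * strip_scale s M r k * (r ^+ 2 / 2 ^+ k)) / N%:R))
  <= M * r `^ (p - s) * (2 * S ^+ 2 * y ^+ K
       + 4 * A ^+ 2 * S * g * (1 - y)^-1 * (C * r * a / Num.sqrt N%:R)).
Proof.
move=> p1 /andP[s0 sp] M0 r0 C0 N0 l1 Kl.
have A0 : 0 < A by rewrite powR_gt0.
have S0 : 0 < S by rewrite powR_gt0.
have S1 : 1 <= S by rewrite -(powRr0 2); apply: ler_powR; rewrite ?ler1n.
have A2 : 2 <= A by rewrite -[leLHS]powRr1//; apply: ler_powR; rewrite ?ler1n.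
have y01 : 0 <= y < 1.
  by rewrite divr_ge0 ?(ltW S0) ?(ltW A0)//= ltr_pdivrMr// mul1r ltr_powR2.
have y0 : 0 <= y by have /andP[] := y01.
have sN : 0 < Num.sqrt (N%:R : R) by rewrite sqrtr_gt0 ltr0n.
pose x := 2 / A.
have inner (k : nat) : (k < K.+1)%N -> \sum_(h < L - k) x ^+ (L - k - h) <= g * a.
  move=> kK; rewrite sum_expr_rev /g /a; case: eqVneq => [p1'|pn1].
    (* At p = 1 all levels weigh the same, and their number is at most 2K + 1 <= 2 log2 N + 3 <= 5
       log2 N; hence the constant 5 in [g]. *)
    have -> : x = 1 by rewrite /x /A p1' powRr1// divff.
    under eq_bigr do rewrite expr1n.
    rewrite sumr_const card_ord; apply: (@le_trans _ _ (L%:R)).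
      by rewrite ler_nat leq_subr.
    have -> : (L%:R : R) = K%:R + K%:R + 1 by rewrite -natrD natr1.
    by move: l1 Kl; move: (K%:R : R) (log2 N%:R : R) => u v; lra.
  have x01 : 0 <= x < 1.
    rewrite divr_ge0 ?(ltW A0)//= ltr_pdivrMr// mul1r -[ltLHS]powRr1//.
    by rewrite ltr_powR2// lt_neqAle eq_sym pn1.
  rewrite mulr1; apply: le_trans (geometric_sum_le (L - k) x01).
  have /andP[x0 x1] := x01.
  by apply: ler_sum => h _; rewrite exprS ler_piMl ?exprn_ge0// ltW.
have ga0 : 0 <= g * a.
  apply: le_trans (inner 0%N _) => //; apply: sumr_ge0 => h _.
  by rewrite exprn_ge0// divr_ge0// ltW.
rewrite big_split /= mulrDr; apply: lerD.
  apply: (@le_trans _ _ (\sum_(k < K.+1) block_cost p r L 0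
      * (S ^+ 2 * (M * r `^ (- s) * S ^+ K)))).
    apply: ler_sum => k _; rewrite strip_boundE strip_scaleE.
    rewrite ler_wpM2l ?block_cost_ge0// ler_wpM2l ?exprn_ge0 ?(ltW S0)//.
    rewrite ler_wpM2l ?mulr_ge0 ?powR_ge0 ?(ltW M0)//.
    by rewrite ler_weXn2l// -ltnS.
  rewrite sumr_const card_ord -[leLHS]mulr_natl.
  (* The K + 1 equal terms are paid with [A^K]: the cost of a leaf carries [A^-(2K+1)], so together
     with [S^K] the factor [y^K] remains. *)
  have KA : (K.+1%:R : R) <= A ^+ K.
    apply: (@le_trans _ _ (2 ^+ K)); last by rewrite lerXn2r// nnegrE ltW.
    by rewrite -(natrX R 2) ler_nat ltn_expl.
  rewrite block_costE// expr0 powRD; last by rewrite (gt_eqF r0) implybT.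
  rewrite /y expr_div_n /L exprS exprD -/A.
  have AK : 0 < A ^+ K by rewrite exprn_gt0.
  rewrite [leRHS](_ : _ = A ^+ K * (2 * (A * r `^ p * (1 / (A * (A ^+ K * A ^+ K))))
      * (S ^+ 2 * (M * r `^ (- s) * S ^+ K)))).
    rewrite ler_wpM2r// !mulr_ge0 ?invr_ge0 ?mulr_ge0 ?powR_ge0 ?exprn_ge0
      ?(ltW M0) ?(ltW A0) ?(ltW S0)//.
  move: (gt_eqF A0) (gt_eqF AK) => /negbT A1 /negbT AK1.
  move: (r `^ p) (r `^ (- s)) (A ^+ K) (S ^+ K) AK1 => rp rs AK' SK AK1.
  by field; rewrite A1 AK1.
pose D := 2 * A ^+ 2 * S * (M * r `^ (p - s)) * (C * r / Num.sqrt N%:R).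
have D0 : 0 <= D.
  rewrite /D !mulr_ge0 ?invr_ge0 ?powR_ge0 ?exprn_ge0
    ?(ltW M0) ?(ltW C0) ?(ltW r0) ?(ltW S0) ?(ltW A0) ?(ltW sN)//.
apply: (@le_trans _ _ (\sum_(k < K.+1) 2 * (D * (y ^+ k * (g * a))))).
  apply: ler_sum => k _; rewrite ler_wpM2l//.
  have kL : (k <= L)%N.
    by apply: leq_trans (ltnW (ltn_ord k)) _; rewrite /L ltnS leq_addr.
  apply: (@le_trans _ _ (\sum_(h < L - k) D * (y ^+ k * x ^+ (L - k - h)))).
    by apply: ler_sum => h _; exact: weighted_deviation_le.
  rewrite -mulr_sumr ler_wpM2l// -mulr_sumr ler_wpM2l ?exprn_ge0//.
  exact: inner.
rewrite -mulr_sumr -mulr_sumr -mulr_suml.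
apply: (@le_trans _ _ (2 * (D * ((1 - y)^-1 * (g * a))))).
  rewrite ler_wpM2l// ler_wpM2l// ler_wpM2r//.
  exact: geometric_sum_le.
rewrite /D; move: (1 - y)^-1 (r `^ (p - s)) (Num.sqrt N%:R)^-1 => Y rps SN.
by rewrite le_eqVlt; apply/orP; left; apply/eqP; ring.
Qed.

End TotalCost.

(** Each further strip multiplies the mass bound by [S] and the cost by [A^-1], so the terms are
    geometric with ratio [y], and [s < p] gives [y < 1]. *)
Lemma tail_sum_le (R : realType) (p s r M : R) (K n : nat)
    (A := 2 `^ p) (S := 2 `^ s) (y := S / A) : 0 < M -> 0 < r -> s < p ->
  \sum_(0 <= k < n) 2 * (2 * r * (2 ^+ (K.+1 + k))^-1) `^ p
                    * strip_bound s M r (K.+1 + k)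
  <= M * r `^ (p - s) * (2 * A * S ^+ 2 * (1 - y)^-1 * y ^+ K).
Proof.
move=> M0 r0 sp.
have A0 : 0 < A by rewrite powR_gt0.
have S0 : 0 < S by rewrite powR_gt0.
have y01 : 0 <= y < 1.
  by rewrite divr_ge0 ?(ltW S0) ?(ltW A0)//= ltr_pdivrMr// mul1r ltr_powR2.
have /andP[y0 y1] := y01.
pose c := M * r `^ (p - s) * (2 * A * S ^+ 2) * y ^+ K.
have c0 : 0 <= c.
  by rewrite !mulr_ge0 ?powR_ge0 ?exprn_ge0 ?(ltW M0) ?(ltW A0) ?(ltW S0).
have E k : 2 * (2 * r * (2 ^+ (K.+1 + k))^-1) `^ p * strip_bound s M r (K.+1 + k)
    = c * y ^+ k.+1.
  rewrite !powRM ?mulr_ge0 ?invr_ge0 ?exprn_ge0 ?(ltW r0)//.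
  rewrite powR_exprnV strip_boundE strip_scaleE -/A -/S addSnnS !exprD.
  rewrite /c powRD; last by rewrite (gt_eqF r0) implybT.
  rewrite /y !expr_div_n.
  have An m : A ^+ m != 0 by rewrite expf_neq0// gt_eqF.
  move: (An K) (An k.+1); move: (A ^+ K) (A ^+ k.+1) => u v u0 v0.
  move: (S ^+ K) (S ^+ k.+1) (r `^ p) (r `^ (- s)) => a b rp rs.
  by field; rewrite u0 v0.
under eq_bigr do rewrite E.
rewrite -mulr_sumr big_mkord; apply: (@le_trans _ _ (c * (1 - y)^-1)).
  apply: (ler_wpM2l c0); apply: le_trans (geometric_sum_le n y01).
  by apply: ler_sum => k _; rewrite exprS ler_piMl ?exprn_ge0// ltW.
rewrite /c; move: (1 - y)^-1 (y ^+ K) (r `^ (p - s)) => a b rps.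
by rewrite le_eqVlt; apply/orP; left; apply/eqP; ring.
Qed.

Lemma expr_ratio_le (R : realType) (p s : R) (N K : nat) : s <= p -> (0 < N)%N ->
  (N%:R : R) <= 2 ^+ K -> (2 `^ s / 2 `^ p) ^+ K <= 1 / N%:R `^ (p - s).
Proof.
move=> sp N0 NK; have N0R : (0 : R) < N%:R by rewrite ltr0n.
have -> : 2 `^ s / 2 `^ p = (2 `^ (p - s))^-1 :> R.
  by rewrite -!powRN -powRD ?pnatr_eq0 ?implybT//; congr (_ `^ _); ring.
rewrite exprVn -powR_exprn div1r lef_pV2 ?posrE ?powR_gt0 ?exprn_gt0//.
by apply: ge0_ler_powR; rewrite ?subr_ge0 ?nnegrE ?exprn_ge0.
Qed.

Theorem theorem9 (R : realType) (p s : R) (hp : 1 <= p) (hs : 0 <= s < p) :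
  exists c : R, 0 < c /\
  forall (q : \bar R) (M r C : R) (P : probability (measT R) R)
         (f : R * R -> R),
    (1 <= q)%E -> 0 < M -> 0 < r -> 0 < C ->
    {ae P, forall m : measT R, M_sRM q s r M m} ->
    is_lebesgue_density (EPD P) f ->
    (forall k : nat, (Linfty_norm (strip r k) f
       <= (C ^+ 2 * M * r `^ (- s) * 2 `^ (k%:R * s))%:E)%E) ->
  forall (N : nat) (d : measure_display) (T : measurableType d)
         (Pr : probability T R) (X : 'I_N -> T -> measT R),
    (2 <= N)%N ->
    iid_with_law Pr P X ->
    let K := `|Num.ceil (log2 (N%:R : R))|%N in
    let a := if p == 1 then log2 (N%:R : R) else 1 in
    (\int[Pr]_w ((OT p (mu_hat r (fun i => X i w : meas R) K K) (EPD P)) `^ p)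
     <= (c * M * r `^ (p - s) *
         (r / N%:R `^ p + C * r * a / Num.sqrt N%:R
          + 1 / N%:R `^ (p - s)))%:E)%E.
Proof.
have /andP[s0 sp] := hs.
pose A : R := 2 `^ p; pose S : R := 2 `^ s; pose y := S / A.
pose g : R := if p == 1 then 5 else (1 - 2 / A)^-1.
have A0 : 0 < A by rewrite powR_gt0.
have S0 : 0 < S by rewrite powR_gt0.
have y1 : 0 < 1 - y by rewrite subr_gt0 /y ltr_pdivrMr// mul1r ltr_powR2.
have g0 : 0 < g.
  rewrite /g; case: eqVneq => // pn1.
  rewrite invr_gt0 subr_gt0 ltr_pdivrMr// mul1r -[ltLHS]powRr1//.
  by rewrite ltr_powR2// lt_neqAle eq_sym pn1.
(* [c1] collects the block fluctuations; [c2] the matching inside leaves and the projected tail,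
   both proportional to [y^K], hence at most of order N^-(p-s). *)
pose c1 := 4 * A ^+ 2 * S * g * (1 - y)^-1.
pose c2 := 2 * S ^+ 2 + 2 * A * S ^+ 2 * (1 - y)^-1.
have c10 : 0 < c1 by rewrite !mulr_gt0 ?invr_gt0 ?exprn_gt0.
have c20 : 0 < c2 by rewrite addr_gt0 ?mulr_gt0 ?invr_gt0 ?exprn_gt0.
exists (c1 + c2); split; first exact: addr_gt0.
move=> q M r C P f q1 M0 r0 C0 PM Pf fC N d T Pr X N2 iidX; cbv zeta.
set K := `|Num.ceil (log2 N%:R)|%N.
set a := if p == 1 then log2 N%:R else 1.
have N0 : (0 < N)%N by apply: ltn_trans N2.
have NR : (0 : R) < N%:R by rewrite ltr0n.
have [l1] := @ceil_log2_bounds R N N2; rewrite -/K; clearbody K => Kl NK.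
apply: le_trans (expected_OT_le hp s0 q1 M0 r0 C0 PM Pf fC N0 iidX
  K (K := K) (fun n => tail_sum_le K n M0 r0 sp)) _.
rewrite lee_fin.
apply: le_trans (lerD (total_cost_le hp hs M0 r0 C0 N0 l1 Kl) (lexx _)) _.
rewrite -/A -/S -/y -/g -/a.
set Y := y ^+ K; set D := C * r * a / Num.sqrt N%:R.
have Mr0 : 0 <= M * r `^ (p - s) by rewrite mulr_ge0 ?powR_ge0// ltW.
have YE : Y <= 1 / N%:R `^ (p - s) by exact: expr_ratio_le (ltW sp) N0 NK.
have Y0 : 0 <= Y by rewrite exprn_ge0// divr_ge0// ltW.
have a0 : 0 <= a by rewrite /a; case: ifP => // _; lra.
have D0 : 0 <= D.
  by rewrite divr_ge0 ?sqrtr_ge0// !mulr_ge0// ltW.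
have Z0 : 0 <= r / N%:R `^ p by rewrite divr_ge0 ?powR_ge0// ltW.
apply: (@le_trans _ _ (M * r `^ (p - s) * (c1 * D + c2 * Y))).
  by rewrite le_eqVlt; apply/orP; left; apply/eqP; rewrite /c1 /c2; ring.
have -> : (c1 + c2) * M * r `^ (p - s) = M * r `^ (p - s) * (c1 + c2) by ring.
rewrite -[leRHS]mulrA; apply: (ler_wpM2l Mr0).
rewrite [leRHS]mulrDl; apply: lerD; apply: ler_wpM2l; rewrite ?(ltW c10) ?(ltW c20)//.
  by rewrite addrAC lerDr addr_ge0 // (le_trans Y0).
by apply: (le_trans YE); rewrite lerDr addr_ge0.
Qed.
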